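(* Consider the system of four equations for $(\delta,\gamma,\beta,\alpha)$ $$m\int_\beta^\alpha s^{-m-1}h(s)\,ds+rK_0\beta^{-m}+rK_1\alpha^{-m}=0,\qquad n\int_\beta^\alpha s^{-n-1}h(s)\,ds+rK_0\beta^{-n}+rK_1\alpha^{-n}=0,$$ $$m\int_\delta^\gamma s^{-m-1}[h(s)+rK_0]\,ds+r(K-K_0)\delta^{-m}=0,$$ $$n\int_\delta^\gamma s^{-n-1}[h(s)+rK_0]\,ds+r(K-K_0)\delta^{-n}+n\int_\beta^\infty s^{-n-1}[h(s)+rK_0]\,ds=0,\qquad(\ast)$$ and let $$A=-\tfrac1{\sigma^2(n-m)}\int_0^\beta s^{-m-1}[h(s)+rK_0]\,ds,\qquad B=\tfrac1{\sigma^2(n-m)}\int_\alpha^\infty s^{-n-1}[h(s)-rK_1]\,ds,$$ $$\Gamma_1=-\tfrac1{\sigma^2(n-m)}\int_0^\gamma s^{-m-1}[h(s)+rK_0]\,ds,\qquad\Gamma_2=-\tfrac1{\sigma^2(n-m)}\int_\gamma^\beta s^{-n-1}[h(s)+rK_0]\,ds,$$ $$w_1(x)=\begin{cases}-K,&x\le\delta,\\ \Gamma_1x^m+\Gamma_2x^n+R_h(x),&\delta<x<\gamma,\\ Bx^n-K_0,&\gamma\le x\le\beta,\\ Ax^m+R_h(x),&x>\beta,\end{cases}\qquad w_0(x)=\begin{cases}Bx^n,&x<\alpha,\\ Ax^m+R_h(x)-K_1,&x\ge\alpha.\end{cases}$$ The system $(\ast)$ has a unique solution $(\delta,\gamma,\beta,\alpha)$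 such that $0<\delta<\gamma<\beta<\alpha$ and the functions $w_1,w_0$, with $A>0$, $B>0$, $\Gamma_1>0$, $\Gamma_2>0$ given by the formulas above, are increasing and satisfy the HJB equation (stated in the context) if and only if $$0\le K,\quad h(0)<-rK_0\quad\text{and}\quad K<K_0<K_0^\star,$$ where $K_0^\star\in(K,-r^{-1}h(0))$, which depends on all problem data except $K_0$, is the point defined in the context.
   Context: Let $b\in\mathbb R$, $\sigma\ne0$, $r>0$ be constants, $W$ a standard one-dimensional Brownian motion and, for $x>0$, let $X$ solve $dX_t=bX_t\,dt+\sqrt2\,\sigma X_t\,dW_t$, $X_0=x$. Standing assumption: $h:(0,\infty)\to\mathbb R$ is right-continuous and increasing (''increasing'' does not mean strictly increasing), $\lim_{x\to\infty}h(x)=\infty$, $\mathbb E[\int_0^\infty e^{-rt}|h(X_t)|\,dt]<\infty$ for every $x>0$; $K_1,K_0>0$, $K\in\mathbb R$. Put $h(0):=\lim_{x\downarrow0}h(x)$. The constants $m<0<n$ are $m,n=\frac1{2\sigma^2}\big[\sigma^2-b\mp\sqrt{(b-\sigma^2)^2+4\sigma^2r}\big]$, and $$R_h(x)=\frac1{\sigma^2(n-m)}\Big[x^m\int_0^xs^{-m-1}h(s)\,ds+x^n\int_x^\infty s^{-n-1}h(s)\,ds\Big]=\mathbb E\Big[\int_0^\infty e^{-rs}h(X_s)\,ds\Big].$$ HJB equation: the coupled quasi-variational inequalities $$\max\{\sigma^2x^2w_1''(x)+bxw_1'(x)-rw_1(x)+h(x),\ w_0(x)-w_1(x)-K_0,\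 -w_1(x)-K\}=0,$$ $$\max\{\sigma^2x^2w_0''(x)+bxw_0'(x)-rw_0(x),\ w_1(x)-w_0(x)-K_1,\ -w_0(x)-K\}=0$$ on $(0,\infty)$; the solutions $w_1,w_0$ are $C^1$ as well as $C^2$ outside a finite set, and satisfy these equations in the classical sense. Definition of $K_0^\star$: let $(\delta_\dagger,\alpha_\dagger)$ be the unique pair with $0<\delta_\dagger<\alpha_\dagger$ such that $\int_{\delta_\dagger}^\infty s^{-n-1}[h(s)+rK]\,ds=0$ and $m\int_{\delta_\dagger}^{\alpha_\dagger}s^{-m-1}[h(s)-rK_1]\,ds+r(K_1+K)\delta_\dagger^{-m}=0$, and let $\hat x\in(\delta_\dagger,\alpha_\dagger)$ be the unique solution of $m\hat x^m\int_{\hat x}^{\alpha_\dagger}s^{-m-1}[h(s)-rK_1]\,ds-n\hat x^n\int_{\hat x}^{\alpha_\dagger}s^{-n-1}[h(s)-rK_1]\,ds=0$. Then $K_0^\star=-K_1-\frac{m\hat x^m}{r}\int_{\hat x}^{\alpha_\dagger}s^{-m-1}[h(s)-rK_1]\,ds$. (The point $\alpha_\dagger$ here is not the point $\alpha$ of the claim.)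
   Formalization: In the HJB equation, ''C^2 outside a finite set'' and the equations are required only outside a finite set and the jump points of h: if h jumps at all integers, R_h'' jumps there too and the literal claim fails; for finitely many jumps of h nothing changes. *)

(* Defs.v *)
From HB Require Import structures.
From mathcomp Require Import all_boot all_order all_algebra.
From mathcomp Require Import all_classical all_reals all_analysis.

Set Implicit Arguments.
Unset Strict Implicit.
Unset Printing Implicit Defensive.

Import Order.TTheory GRing.Theory Num.Theory.
Import numFieldNormedType.Exports.

Local Open Scope classical_set_scope.
Local Open Scope ring_scope.

Section StochasticSetting.
Context (R : realType) (d : measure_display) (T : measurableType d).
Variable P : probability T R.

(* Processes are indexed by R; only the times t >= 0 matter.  Testing the
   product rule on arbitrary measurable B i (setT included) yields mutual
   independence of the increments. *)
Definition brownian_motion (W : R -> T -> R) : Prop :=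
  [/\ forall t, 0 <= t -> measurable_fun setT (W t),
      {ae P, forall w, W 0 w = 0},
      forall w, {within `[0, +oo[, continuous (fun t => W t w)},
      forall s t, 0 <= s -> s < t -> forall B, measurable B ->
        P [set w | B (W t w - W s w)] = normal_prob 0 (Num.sqrt (t - s)) B
    & forall (k : nat) (t : nat -> R) (B : nat -> set R),
        0 <= t 0%N -> (forall i, t i <= t i.+1) ->
        (forall i, measurable (B i)) ->
        P [set w | forall i, (i < k)%N -> B i (W (t i.+1) w - W (t i) w)] =
        (\prod_(i < k) P [set w | B i (W (t i.+1) w - W (t i) w)%R])%E].

Definition natural_filtration (W : R -> T -> R) (t : R) : set (set T) :=
  <<s \bigcup_(s in `[0, t]) preimage_set_system setT (W s) measurable >>.

Definition adapted (W Y : R -> T -> R) : Prop :=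
  forall t, 0 <= t ->
    preimage_set_system setT (Y t) measurable `<=` natural_filtration W t.

(* I is (a version of) the Ito integral of Y against W over [0, t].  For an
   adapted integrand with continuous paths, the only case in which this is
   used, the Ito integral is the limit in probability of the left-endpoint
   sums along partitions of vanishing mesh. *)
Definition is_ito_integral (W Y : R -> T -> R) (t : R) (I : T -> R) : Prop :=
  let node (N i : nat) : R := t * i%:R / N.+1%:R in
  forall e : R, 0 < e ->
    P [set w | e <= `|\sum_(i < N.+1)
          Y (node N i) w * (W (node N i.+1) w - W (node N i) w) - I w|]
      @[N --> \oo] --> 0%E.

(* dX = b X dt + sqrt 2 sg X dW, X_0 = x, in integrated form, for processes
   with values in (0, oo), the domain of the running payoff h. *)
Definition gbm_solution (b sg : R) (W : R -> T -> R) (x : R)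
    (X : R -> T -> R) : Prop :=
  [/\ adapted W X,
      forall w, {within `[0, +oo[, continuous (fun t => X t w)},
      forall t w, 0 <= t -> 0 < X t w,
      {ae P, forall w, X 0 w = x}
    & forall t, 0 <= t ->
        is_ito_integral W (fun s w => Num.sqrt 2 * sg * X s w) t
          (fun w => X t w - x
                    - \int[lebesgue_measure]_(s in `[0, t]) (b * X s w))].

(* E[int_0^oo e^{-rt} |h(X_t)| dt] < oo, whatever the starting point.  The
   solution X of the SDE is unique up to indistinguishability. *)
Definition payoff_integrable (b sg r : R) (h : R -> R) (W : R -> T -> R) :
    Prop :=
  forall x, 0 < x -> forall X, gbm_solution b sg W x X ->
    (\int[P]_w \int[lebesgue_measure]_(t in `[0%R, +oo[)
       (expR (- (r * t)) * `|h (X t w)|)%:E < +oo)%E.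

End StochasticSetting.

Section ProblemData.
Context (R : realType).
Implicit Types h w : R -> R.

Definition increasing_pos w : Prop :=
  forall x y, 0 < x -> x <= y -> w x <= w y.

(* Functions on (0, oo) are represented by functions on R, whose values on
   (-oo, 0] are never used. *)
Definition payoff_regular h : Prop :=
  [/\ forall x, 0 < x -> h y @[y --> x^'+] --> h x,
      increasing_pos h
    & h x @[x --> +oo] --> +oo].

(* h(0) is an extended real: it may be -oo. *)
Definition h_at0 h : \bar R := lim ((h x)%:E @[x --> 0^'+]).

Variables b sg r : R.

Definition root_m : R :=
  (sg ^+ 2 - b - Num.sqrt ((b - sg ^+ 2) ^+ 2 + 4 * sg ^+ 2 * r))
  / (2 * sg ^+ 2).
Definition root_n : R :=
  (sg ^+ 2 - b + Num.sqrt ((b - sg ^+ 2) ^+ 2 + 4 * sg ^+ 2 * r))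
  / (2 * sg ^+ 2).

Local Notation m := root_m.
Local Notation n := root_n.

(* int_a^c s^{-p-1} [h(s) + q] ds over (a, c], where
   a = 0 is allowed, and over (a, oo). *)
Definition wint (p : R) h (q a c : R) : R :=
  \int[lebesgue_measure]_(s in `]a, c]) (s `^ (- p - 1) * (h s + q)).
Definition wint_oo (p : R) h (q a : R) : R :=
  \int[lebesgue_measure]_(s in `]a, +oo[) (s `^ (- p - 1) * (h s + q)).

Variable h : R -> R.

Definition R_h (x : R) : R :=
  (sg ^+ 2 * (n - m))^-1 *
  (x `^ m * wint m h 0 0 x + x `^ n * wint_oo n h 0 x).

(* The coupled system
     max{sg^2 x^2 w1'' + b x w1' - r w1 + h, w0 - w1 - K0, - w1 - K} = 0,
     max{sg^2 x^2 w0'' + b x w0' - r w0,     w1 - w0 - K1, - w0 - K} = 0.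
   The functions are C^1 on (0, oo).  They are C^2, and satisfy the equations
   pointwise, away from a finite set F; since sg^2 x^2 w1'' + h is continuous
   where the first equation holds with equality in its first term, w1'' cannot
   exist at a jump of h there, so the jumps of h are left out as well.  If h has
   finitely many jumps, this is "C^2 outside a finite set".  As the jumps may be
   dense, continuity of w'' is relative to the remaining set of points. *)
Definition regular_points (F : set R) : set R :=
  [set x | 0 < x /\ ~ F x /\ {for x, continuous h}].

Definition C1_C2_off (F : set R) (w : R -> R) : Prop :=
  [/\ forall x, 0 < x -> derivable w x 1,
      forall x, 0 < x -> {for x, continuous (derive1 w)},
      forall x, regular_points F x -> derivable (derive1 w) x 1
    & {within regular_points F, continuous (derive1 (derive1 w))}].

Variables K K1 : R.

Definition HJB_solution (K0 : R) (w1 w0 : R -> R) : Prop :=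
  exists F : set R,
    [/\ finite_set F, C1_C2_off F w1, C1_C2_off F w0
      & forall x, regular_points F x ->
          Num.max (Num.max
            (sg ^+ 2 * x ^+ 2 * derive1 (derive1 w1) x + b * x * derive1 w1 x
               - r * w1 x + h x)
            (w0 x - w1 x - K0))
            (- w1 x - K) = 0
          /\
          Num.max (Num.max
            (sg ^+ 2 * x ^+ 2 * derive1 (derive1 w0) x + b * x * derive1 w0 x
               - r * w0 x)
            (w1 x - w0 x - K1))
            (- w0 x - K) = 0].

(* (delta_dagger, alpha_dagger) *)
Definition is_dagger (p : R * R) : Prop :=
  [/\ 0 < p.1, p.1 < p.2,
      wint_oo n h (r * K) p.1 = 0
    & m * wint m h (- (r * K1)) p.1 p.2 + r * (K1 + K) * p.1 `^ (- m) = 0].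

Definition is_xhat (p : R * R) (x : R) : Prop :=
  [/\ p.1 < x, x < p.2
    & m * x `^ m * wint m h (- (r * K1)) x p.2
      - n * x `^ n * wint n h (- (r * K1)) x p.2 = 0].

(* The chosen values are meaningful only when the corresponding existence and
   uniqueness statements hold. *)
Definition dagger : R * R := xget (0, 0) [set p | is_dagger p].
Definition xhat : R := xget 0 [set x | is_xhat dagger x].

Definition K0_star : R :=
  - K1 - m * xhat `^ m / r * wint m h (- (r * K1)) xhat dagger.2.

Variable K0 : R.

Definition ordered (delta gamma beta alpha : R) : Prop :=
  [/\ 0 < delta, delta < gamma, gamma < beta & beta < alpha].

Definition free_boundary_system (delta gamma beta alpha : R) : Prop :=
  [/\ m * wint m h 0 beta alpha
        + r * K0 * beta `^ (- m) + r * K1 * alpha `^ (- m) = 0,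
      n * wint n h 0 beta alpha
        + r * K0 * beta `^ (- n) + r * K1 * alpha `^ (- n) = 0,
      m * wint m h (r * K0) delta gamma
        + r * (K - K0) * delta `^ (- m) = 0
    & n * wint n h (r * K0) delta gamma
        + r * (K - K0) * delta `^ (- n)
        + n * wint_oo n h (r * K0) beta = 0].

Definition A_coef (beta : R) : R :=
  - (sg ^+ 2 * (n - m))^-1 * wint m h (r * K0) 0 beta.
Definition B_coef (alpha : R) : R :=
  (sg ^+ 2 * (n - m))^-1 * wint_oo n h (- (r * K1)) alpha.
Definition Gamma1_coef (gamma : R) : R :=
  - (sg ^+ 2 * (n - m))^-1 * wint m h (r * K0) 0 gamma.
Definition Gamma2_coef (gamma beta : R) : R :=
  - (sg ^+ 2 * (n - m))^-1 * wint n h (r * K0) gamma beta.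

Definition w1_fun (delta gamma beta alpha x : R) : R :=
  if x <= delta then - K
  else if x < gamma then
    Gamma1_coef gamma * x `^ m + Gamma2_coef gamma beta * x `^ n + R_h x
  else if x <= beta then B_coef alpha * x `^ n - K0
  else A_coef beta * x `^ m + R_h x.

Definition w0_fun (beta alpha x : R) : R :=
  if x < alpha then B_coef alpha * x `^ n
  else A_coef beta * x `^ m + R_h x - K1.

End ProblemData.

(* Main.v *)
(* Write M_q(x) = -m int_0^x s^(-m-1) [h(s)+q] ds and
   N_q(x) = n int_x^oo s^(-n-1) [h(s)+q] ds.  In these terms the system says
     M_{rK0}(beta) = M_{-rK1}(alpha),   N_{rK0}(beta) = N_{-rK1}(alpha),
     M_{rK}(delta) = M_{rK0}(gamma),
     N_{rK}(delta) + N_{rK0}(beta) = N_{rK0}(gamma),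
   so (beta, alpha) can be found before (delta, gamma).  Where h+q has a constant
   sign, the increments of M_q over [a, c] are those of N_q up to a factor between
   (-m/n) a^(n-m) and (-m/n) c^(n-m).  This comparison, together with the
   intermediate value theorem, gives existence, uniqueness and the position of K0
   relative to K0_star.

   The functions w1 and w0 are the Green potentials of the running rates
   -rK | h | -rK0 | h and 0 | h - rK1 (on the successive intervals), which gives the
   linear equations at once; up to a positive factor, the derivative of a potential
   is the difference of two weighted averages of the rate over (x, oo) and (0, x),
   so the monotonicity of w1, w0 and w1 - w0 follows by comparing such averages.

   That the integrals defining M_q and N_q converge has to be extracted from the
   expectation in the hypothesis: the explicit geometric Brownian motion is a
   solution (its Ito sums converge in L^2), and it spends near exp(y) an expected
   discounted time of at least a constant times exp(-n y) for large y, and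
   exp(-m y) for large -y. *)

Require Import Defs.
From HB Require Import structures.
From mathcomp Require Import all_boot all_order all_algebra.
From mathcomp Require Import all_classical all_reals all_analysis.
From mathcomp Require Import measurable_realfun real_interval ring lra.
Import Order.TTheory GRing.Theory Num.Theory.
Import numFieldNormedType.Exports.
Local Open Scope classical_set_scope.
Local Open Scope ring_scope.

Set Implicit Arguments.
Unset Strict Implicit.
Unset Printing Implicit Defensive.

(** * Geometric Brownian motion solves the equation *)

(** [K0_star] is the level at which the interval [gamma, beta] closes up. For K0 = K0_star the pair
    (beta, alpha) is (xhat, alpha_dagger), and M_{rK}(delta_dagger) = M_{-rK1}(alpha_dagger) =
    M_{rK0}(beta) with N_{rK}(delta_dagger) = 0, which is the last pair of equations with gamma =
    beta and delta = delta_dagger. Since alpha increases strictly with K0, a smaller K0 puts alpha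
    to the left of alpha_dagger, and then the point e with M_{rK}(e) = M_{rK0}(beta) lies to the
    right of delta_dagger, so that N_{rK}(e) > 0; this sign decides whether (delta, gamma) exists.
    The obstacle throughout is that h is only monotone and may be flat or have dense jumps. Implicit
    functions such as beta(alpha) are never differentiated: continuity and monotonicity come from
    the comparison of increments, strictness from powers or from a strict change of the comparison
    factor. The potentials too are differentiated through sign estimates on increments. The
    integrability hypothesis speaks of solutions of the equation, so a solution has to be exhibited
    before it yields anything; hence the stochastic calculus. *)

Section Transfer.
Import HBNNSimple.
Context {R : realType} {d1 d2 : measure_display}.
Context {X : measurableType d1} {Y : measurableType d2}.
Variables (mu1 : {measure set X -> \bar R}) (mu2 : {measure set Y -> \bar R}).
Variables (u phi : X -> R) (v psi : Y -> R).
Hypotheses (mu_ : measurable_fun setT u) (mphi : measurable_fun setT phi).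
Hypotheses (mv_ : measurable_fun setT v) (mpsi : measurable_fun setT psi).
Hypotheses (u0 : forall x, 0 <= u x) (v0 : forall y, 0 <= v y).

(** The push-forwards of u mu1 by phi and of v mu2 by psi agree on sets, hence on simple functions
    and, by monotone convergence, on nonnegative functions. The weights let one statement serve
    twice: 1 against a density for the law of an increment, a random variable against a constant for
    independence. *)
Lemma ge0_integral_transfer :
  (forall B : set R, measurable B ->
    (\int[mu1]_x (u x * \1_B (phi x))%:E = \int[mu2]_y (v y * \1_B (psi y))%:E)%E) ->
  forall g : R -> R, measurable_fun setT g -> (forall x, 0 <= g x) ->
    (\int[mu1]_x (u x * g (phi x))%:E = \int[mu2]_y (v y * g (psi y))%:E)%E.
Proof.
move=> H g mg g0.
have /measurable_EFinP mEg := mg.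
pose a := nnsfun_approx measurableT mEg.
have decomp n d (Z : measurableType d) (m : {measure set Z -> \bar R})
    (w p : Z -> R) : measurable_fun setT w -> measurable_fun setT p ->
    (forall z, 0 <= w z) ->
    (\int[m]_x (w x * a n (p x))%:E =
     \sum_(y \in range (a n)) y%:E * \int[m]_x (w x * \1_(a n @^-1` [set y]) (p x))%:E)%E.
  move=> mw mp w0.
  have mI y : measurable_fun setT (fun x => w x * \1_(a n @^-1` [set y]) (p x)).
    apply: measurable_funM => //.
    by apply: (measurableT_comp _ mp); exact: measurable_indic.
  transitivity (\int[m]_x \sum_(y \in range (a n))
      (y%:E * (w x * \1_(a n @^-1` [set y]) (p x))%:E))%E.
    apply: eq_integral => z _.
    under eq_fsbigr do rewrite -EFinM mulrCA EFinM.
    rewrite -ge0_mule_fsumr; last first.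
      by move=> y; rewrite EFinM nnfun_muleindic_ge0.
    by rewrite fsumEFin//= -fimfunE.
  rewrite ge0_integral_fsum//=.
  - apply: eq_fsbigr => y; rewrite inE => -[x _ <-].
    rewrite ge0_integralZl//=.
    + exact/measurable_EFinP.
    + by move=> z _; rewrite lee_fin mulr_ge0.
    + by rewrite lee_fin.
  - by move=> y; apply/measurable_EFinP; exact: measurable_funM.
  - move=> y z _; rewrite -EFinM mulrCA EFinM mule_ge0//.
      by rewrite lee_fin.
    by rewrite EFinM nnfun_muleindic_ge0.
have simple n : (\int[mu1]_x (u x * a n (phi x))%:E =
                 \int[mu2]_y (v y * a n (psi y))%:E)%E.
  by rewrite !decomp//; apply: eq_fsbigr => y _; rewrite H.
have lim d (Z : measurableType d) (m : {measure set Z -> \bar R})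
    (w p : Z -> R) : measurable_fun setT w -> measurable_fun setT p ->
    (forall z, 0 <= w z) ->
    (\int[m]_x (w x * a n (p x))%:E @[n --> \oo] --> \int[m]_x (w x * g (p x))%:E)%E.
  move=> mw mp w0.
  have gl x : (w x * g (p x))%:E = limn (fun n => (w x * a n (p x))%:E).
    apply/esym/cvg_lim => //; apply: cvg_EFin; first by near=> k.
    apply: cvgMr.
    have := @cvg_nnsfun_approx _ _ _ _ measurableT _ mEg (fun x _ => g0 x) (p x) I.
    by move=> /fine_cvg.
  rewrite (eq_integral (fun x => limn (fun n => (w x * a n (p x))%:E))); last by move=> x _.
  apply: cvg_monotone_convergence => //.
  - move=> n; apply/measurable_EFinP; apply: measurable_funM => //.
    exact: (measurableT_comp _ mp).
  - by move=> n x _; rewrite lee_fin mulr_ge0.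
  - move=> x _ k l kl; rewrite lee_fin ler_wpM2l//.
    by have /lefP := @nd_nnsfun_approx _ _ _ _ measurableT _ mEg k l kl; exact.
have l1 := lim _ _ mu1 u phi mu_ mphi u0.
have l2 := lim _ _ mu2 v psi mv_ mpsi v0.
apply: (cvg_unique _ l1) => //.
by rewrite (funext simple).
Unshelve. all: by end_near. Qed.

End Transfer.

(** * Expectations and products of independent variables *)

Section Expectation.
Context {R : realType} {d : measure_display} {T : measurableType d}.
Variable P : probability T R.

(** Integrability and the value travel together, so that expectations can be added and scaled
    without side conditions on extended reals. *)
Definition hasE (f : T -> R) (v : R) :=
  P.-integrable setT (EFin \o f) /\ (\int[P]_w (f w)%:E = v%:E)%E.

Lemma hasE_meas f v : hasE f v -> measurable_fun setT f.
Proof. by move=> [/integrableP[/measurable_EFinP]]. Qed.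

Lemma hasE_eq f g v : f =1 g -> hasE f v -> hasE g v.
Proof. by move=> /funext ->. Qed.

Lemma hasE_uniq f v v' : hasE f v -> hasE f v' -> v = v'.
Proof. by move=> [_ h] [_]; rewrite h => -[]. Qed.

Lemma hasE_ge0 (f : T -> R) v : measurable_fun setT f -> (forall w, 0 <= f w) ->
  (\int[P]_w (f w)%:E = v%:E)%E -> hasE f v.
Proof.
move=> mf f0 fv; split => //; apply/integrableP; split.
  exact/measurable_EFinP.
under eq_integral do rewrite /= ger0_norm//.
by rewrite fv ltry.
Qed.

Lemma hasE_int f : P.-integrable setT (EFin \o f) -> exists v, hasE f v.
Proof.
move=> fi; exists (fine (\int[P]_w (f w)%:E)); split => //.
by rewrite fineK//; exact: integrable_fin_num.
Qed.

Lemma hasE_cst c : hasE (fun=> c) c.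
Proof.
split; first exact: finite_measure_integrable_cst.
by rewrite integral_cst//= probability_setT mule1.
Qed.

Lemma hasE_add f g v v' : hasE f v -> hasE g v' ->
  hasE (fun w => f w + g w) (v + v').
Proof.
move=> [fi fv] [gi gv]; split.
  by apply: eq_integrable (integrableD measurableT fi gi).
under eq_integral do rewrite EFinD.
by rewrite integralD//= fv gv.
Qed.

Lemma hasE_scale k f v : hasE f v -> hasE (fun w => k * f w) (k * v).
Proof.
move=> [fi fv]; split.
  by apply: eq_integrable (integrableZl measurableT k fi).
under eq_integral do rewrite EFinM.
by rewrite integralZl//= fv.
Qed.

Lemma hasE_sub f g v v' : hasE f v -> hasE g v' ->
  hasE (fun w => f w - g w) (v - v').
Proof.
move=> fv gv; have := hasE_add fv (hasE_scale (-1) gv).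
by rewrite mulN1r; apply: hasE_eq => w; rewrite mulN1r.
Qed.

Lemma hasE_le f g v v' : hasE f v -> hasE g v' -> (forall w, f w <= g w) -> v <= v'.
Proof.
move=> [fi fv] [gi gv] fg; rewrite -lee_fin -fv -gv.
by apply: le_integral => // w _; rewrite lee_fin.
Qed.

Lemma hasE_dom (f g : T -> R) v : measurable_fun setT f -> hasE g v ->
  (forall w, `|f w| <= g w) -> exists2 v', hasE f v' & `|v'| <= v.
Proof.
move=> mf gv fg.
have fi : P.-integrable setT (EFin \o f).
  apply: le_integrable (gv.1) => //; first exact/measurable_EFinP.
  move=> w _ /=; rewrite lee_fin (le_trans (fg w))//.
  exact: ler_norm.
have [v' fv] := hasE_int fi; exists v' => //.
rewrite ler_norml; apply/andP; split.
  rewrite -mulN1r; apply: (hasE_le (hasE_scale (-1) gv) fv) => w.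
  by rewrite mulN1r lerNl (le_trans _ (fg w))// -normrN ler_norm.
by apply: (hasE_le fv gv) => w; rewrite (le_trans _ (fg w))// ler_norm.
Qed.

Lemma hasE_sum (I : Type) (s : seq I) (f : I -> T -> R) (v : I -> R) :
  (forall i, hasE (f i) (v i)) ->
  hasE (fun w => \sum_(i <- s) f i w) (\sum_(i <- s) v i).
Proof.
move=> h; elim: s => [|i s ih].
  rewrite big_nil; apply: hasE_eq (hasE_cst 0) => w.
  by rewrite big_nil.
rewrite big_cons; apply: hasE_eq (hasE_add (h i) ih) => w.
by rewrite big_cons.
Qed.

(** The hypothesis says that under P weighted by U the law of Z is e times its law under P. Used
    repeatedly with U a product, it exchanges one indicator for a function at a time. *)
Lemma hasE_mul_indep (U Z : T -> R) (e : R) :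
  measurable_fun setT U -> measurable_fun setT Z -> (forall w, 0 <= U w) -> 0 <= e ->
  (forall B : set R, measurable B ->
     (\int[P]_w (U w * \1_B (Z w))%:E = e%:E * P (Z @^-1` B))%E) ->
  forall (g : R -> R) (v : R), measurable_fun setT g -> (forall x, 0 <= g x) ->
    hasE (fun w => g (Z w)) v -> (\int[P]_w (U w * g (Z w))%:E = (e * v)%:E)%E.
Proof.
move=> mU mZ U0 e0 H g v mg g0 gv.
rewrite (@ge0_integral_transfer _ _ _ _ _ P P U Z (fun=> e) Z)//.
  by have [_ ->] := hasE_scale e gv.
move=> B mB; rewrite H//.
under [RHS]eq_integral do rewrite EFinM.
have mI : measurable_fun setT (fun w => \1_B (Z w) : R).
  by apply: (measurableT_comp _ mZ); exact: measurable_indic.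
rewrite ge0_integralZl//=; last exact/measurable_EFinP.
rewrite (_ : (fun w => (\1_B (Z w))%:E) = (fun w => (\1_(Z @^-1` B) w)%:E)).
  rewrite integral_indic//= ?setIT//.
  by rewrite -[X in measurable X]setTI; exact: mZ.
by apply/funext => w; rewrite !indicE.
Qed.

(** Four blocks are what a product of two remainders at times s < t needs: the path up to s, the
    first step, the gap, the second step. The product rule for events becomes one for functions in
    four passes ([s1], [s2], [s3] and the conclusion), each replacing one indicator. *)
Lemma hasE_indep4_ge0 (Z1 Z2 Z3 Z4 : T -> R) (f1 f2 f3 f4 : R -> R) e1 e2 e3 e4 :
  measurable_fun setT Z1 -> measurable_fun setT Z2 ->
  measurable_fun setT Z3 -> measurable_fun setT Z4 ->
  (forall B1 B2 B3 B4 : set R, measurable B1 -> measurable B2 ->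
    measurable B3 -> measurable B4 ->
    (P [set w | [/\ B1 (Z1 w), B2 (Z2 w), B3 (Z3 w) & B4 (Z4 w)]] =
     P (Z1 @^-1` B1) * P (Z2 @^-1` B2) * P (Z3 @^-1` B3) * P (Z4 @^-1` B4))%E) ->
  measurable_fun setT f1 -> measurable_fun setT f2 ->
  measurable_fun setT f3 -> measurable_fun setT f4 ->
  (forall x, 0 <= f1 x) -> (forall x, 0 <= f2 x) ->
  (forall x, 0 <= f3 x) -> (forall x, 0 <= f4 x) ->
  hasE (fun w => f1 (Z1 w)) e1 -> hasE (fun w => f2 (Z2 w)) e2 ->
  hasE (fun w => f3 (Z3 w)) e3 -> hasE (fun w => f4 (Z4 w)) e4 ->
  hasE (fun w => f1 (Z1 w) * f2 (Z2 w) * f3 (Z3 w) * f4 (Z4 w)) (e1 * e2 * e3 * e4).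
Proof.
move=> mZ1 mZ2 mZ3 mZ4 ind mf1 mf2 mf3 mf4 f10 f20 f30 f40 E1 E2 E3 E4.
have mc (f : R -> R) (Z : T -> R) : measurable_fun setT f -> measurable_fun setT Z ->
    measurable_fun setT (fun w => f (Z w) : R).
  by move=> mf mZ; exact: (measurableT_comp mf mZ).
have mi (B : set R) (Z : T -> R) : measurable B -> measurable_fun setT Z ->
    measurable_fun setT (fun w => \1_B (Z w) : R).
  by move=> mB mZ; apply: mc => //; exact: measurable_indic.
have mpre (B : set R) (Z : T -> R) : measurable B -> measurable_fun setT Z ->
    measurable (Z @^-1` B).
  by move=> mB mZ; rewrite -[X in measurable X]setTI; exact: mZ.
have pos (f : R -> R) (Z : T -> R) (e : R) : (forall x, 0 <= f x) -> hasE (fun w => f (Z w)) e -> 0 <= e.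
  by move=> f0 h; apply: (hasE_le (hasE_cst 0) h) => w; exact: f0.
have e10 := pos _ _ _ f10 E1; have e20 := pos _ _ _ f20 E2.
have e30 := pos _ _ _ f30 E3; have e40 := pos _ _ _ f40 E4.
have fp (A : set T) : measurable A -> (P A = (fine (P A))%:E)%E.
  by move=> mA; rewrite fineK// fin_num_measure.
have p0 (A : set T) : 0 <= fine (P A) by rewrite fine_ge0.
have s1 (B2 B3 B4 : set R) : measurable B2 -> measurable B3 -> measurable B4 ->
  (\int[P]_w (\1_B2 (Z2 w) * \1_B3 (Z3 w) * \1_B4 (Z4 w) * f1 (Z1 w))%:E =
   (fine (P (Z2 @^-1` B2)) * fine (P (Z3 @^-1` B3)) * fine (P (Z4 @^-1` B4)) * e1)%:E)%E.
  move=> m2 m3 m4; apply: hasE_mul_indep => //.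
  - by apply: measurable_funM; [apply: measurable_funM|]; exact: mi.
  - by rewrite !mulr_ge0.
  move=> B1 m1; rewrite !EFinM -!fp//; try exact: mpre.
  rewrite muleC !muleA -ind//.
  rewrite -(setIT [set w | _]) -integral_indic//; last first.
    rewrite (_ : [set w | _] = (Z1 @^-1` B1) `&` (Z2 @^-1` B2) `&` (Z3 @^-1` B3) `&` (Z4 @^-1` B4)).
      by do 3 (apply: measurableI; last exact: mpre); exact: mpre.
    by apply/seteqP; split=> w /=; [move=> []|move=> [[[]]]].
  apply: eq_integral => w _; congr EFin.
  rewrite !indicE -!natrM !mulnb; congr (nat_of_bool _)%:R.
  apply/idP/idP => [/andP[/andP[/andP[]]]|].
    by rewrite !inE.
  by rewrite inE => -[? ? ? ?]; rewrite !mem_set.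
have s2 (B3 B4 : set R) : measurable B3 -> measurable B4 ->
  (\int[P]_w (\1_B3 (Z3 w) * \1_B4 (Z4 w) * f1 (Z1 w) * f2 (Z2 w))%:E =
   (fine (P (Z3 @^-1` B3)) * fine (P (Z4 @^-1` B4)) * e1 * e2)%:E)%E.
  move=> m3 m4; apply: hasE_mul_indep => //.
  - by apply: measurable_funM; [apply: measurable_funM; exact: mi|exact: mc].
  - by move=> w; rewrite !mulr_ge0.
  - by rewrite !mulr_ge0.
  move=> B2 m2; rewrite (fp (Z2 @^-1` B2)); last exact: mpre.
  rewrite -EFinM [in RHS]mulrC !mulrA -s1//.
  by apply: eq_integral => w _; congr EFin; ring.
have s3 (B4 : set R) : measurable B4 ->
  (\int[P]_w (\1_B4 (Z4 w) * f1 (Z1 w) * f2 (Z2 w) * f3 (Z3 w))%:E =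
   (fine (P (Z4 @^-1` B4)) * e1 * e2 * e3)%:E)%E.
  move=> m4; apply: hasE_mul_indep => //.
  - by apply: measurable_funM; [apply: measurable_funM; [exact: mi|exact: mc]|exact: mc].
  - by move=> w; rewrite !mulr_ge0.
  - by rewrite !mulr_ge0.
  move=> B3 m3; rewrite (fp (Z3 @^-1` B3)); last exact: mpre.
  rewrite -EFinM [in RHS]mulrC !mulrA -s2//.
  by apply: eq_integral => w _; congr EFin; ring.
apply: hasE_ge0.
- by do 3 (apply: measurable_funM; last exact: mc); exact: mc.
- by move=> w; rewrite !mulr_ge0.
apply: hasE_mul_indep => //.
- by do 2 (apply: measurable_funM; last exact: mc); exact: mc.
- by move=> w; rewrite !mulr_ge0.
- by rewrite !mulr_ge0.
move=> B4 m4; rewrite (fp (Z4 @^-1` B4)); last exact: mpre.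
rewrite -EFinM [in RHS]mulrC !mulrA -s3//.
by apply: eq_integral => w _; congr EFin; ring.
Qed.

Lemma hasE_posneg (f : R -> R) (Z : T -> R) e : measurable_fun setT f ->
  measurable_fun setT Z -> hasE (fun w => f (Z w)) e ->
  exists ep en, [/\ hasE (fun w => Num.max (f (Z w)) 0) ep,
    hasE (fun w => Num.max (- f (Z w)) 0) en & e = ep - en].
Proof.
move=> mf mZ fe.
have [v nv] : exists v, hasE (fun w => `|f (Z w)|) v.
  by apply: hasE_int; have := integrable_norm fe.1.
have mfZ := hasE_meas fe.
have [||ep hp _] := @hasE_dom (fun w => Num.max (f (Z w)) 0) _ _ _ nv.
- by apply: measurable_maxr.
- by move=> w; rewrite ger0_norm ?le_max ?lexx ?orbT// ge_max normr_ge0 ler_norm.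
have [||en hn _] := @hasE_dom (fun w => Num.max (- f (Z w)) 0) _ _ _ nv.
- by apply: measurable_maxr => //; exact: measurableT_comp.
- move=> w; rewrite ger0_norm ?le_max ?lexx ?orbT// ge_max normr_ge0 andbT.
  by rewrite -normrN ler_norm.
exists ep, en; split => //; apply: (hasE_uniq fe).
apply: hasE_eq (hasE_sub hp hn) => w.
by rewrite /Num.max; case: ltP => h1; case: ltP => h2; lra.
Qed.

(** The second and fourth factors will involve the remainders, which change sign; they are split
    into positive and negative parts. *)
Lemma hasE_indep4 (Z1 Z2 Z3 Z4 : T -> R) (f1 f2 f3 f4 : R -> R) e1 e2 e3 e4 :
  measurable_fun setT Z1 -> measurable_fun setT Z2 ->
  measurable_fun setT Z3 -> measurable_fun setT Z4 ->
  (forall B1 B2 B3 B4 : set R, measurable B1 -> measurable B2 ->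
    measurable B3 -> measurable B4 ->
    (P [set w | [/\ B1 (Z1 w), B2 (Z2 w), B3 (Z3 w) & B4 (Z4 w)]] =
     P (Z1 @^-1` B1) * P (Z2 @^-1` B2) * P (Z3 @^-1` B3) * P (Z4 @^-1` B4))%E) ->
  measurable_fun setT f1 -> measurable_fun setT f2 ->
  measurable_fun setT f3 -> measurable_fun setT f4 ->
  (forall x, 0 <= f1 x) -> (forall x, 0 <= f3 x) ->
  hasE (fun w => f1 (Z1 w)) e1 -> hasE (fun w => f2 (Z2 w)) e2 ->
  hasE (fun w => f3 (Z3 w)) e3 -> hasE (fun w => f4 (Z4 w)) e4 ->
  hasE (fun w => f1 (Z1 w) * f2 (Z2 w) * f3 (Z3 w) * f4 (Z4 w)) (e1 * e2 * e3 * e4).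
Proof.
move=> mZ1 mZ2 mZ3 mZ4 ind mf1 mf2 mf3 mf4 f10 f30 E1 E2 E3 E4.
have [a2 [b2 [A2 B2 ->]]] := hasE_posneg mf2 mZ2 E2.
have [a4 [b4 [A4 B4 ->]]] := hasE_posneg mf4 mZ4 E4.
pose p (f : R -> R) (x : R) : R := Num.max (f x) 0; pose n (f : R -> R) (x : R) : R := Num.max (- f x) 0.
have mp (f : R -> R) : measurable_fun setT f -> measurable_fun setT (p f).
  by move=> mf; exact: measurable_maxr.
have mn (f : R -> R) : measurable_fun setT f -> measurable_fun setT (n f).
  by move=> mf; apply: measurable_maxr => //; exact: measurableT_comp.
have p0 f x : 0 <= p f x by rewrite /p le_max lexx orbT.
have n0 f x : 0 <= n f x by rewrite /n le_max lexx orbT.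
have fE f x : f x = p f x - n f x.
  by rewrite /p /n /Num.max; case: ltP => h1; case: ltP => h2; lra.
have K (g2 g4 : R -> R) (v2 v4 : R) : measurable_fun setT g2 -> measurable_fun setT g4 ->
  (forall x, 0 <= g2 x) -> (forall x, 0 <= g4 x) ->
  hasE (fun w => g2 (Z2 w)) v2 -> hasE (fun w => g4 (Z4 w)) v4 ->
  hasE (fun w => f1 (Z1 w) * g2 (Z2 w) * f3 (Z3 w) * g4 (Z4 w)) (e1 * v2 * e3 * v4).
  by move=> *; exact: hasE_indep4_ge0.
have K1 := K _ _ _ _ (mp _ mf2) (mp _ mf4) (p0 _) (p0 _) A2 A4.
have K2 := K _ _ _ _ (mp _ mf2) (mn _ mf4) (p0 _) (n0 _) A2 B4.
have K3 := K _ _ _ _ (mn _ mf2) (mp _ mf4) (n0 _) (p0 _) B2 A4.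
have K4 := K _ _ _ _ (mn _ mf2) (mn _ mf4) (n0 _) (n0 _) B2 B4.
have := hasE_add (hasE_sub K1 K2) (hasE_sub K4 K3).
rewrite (_ : _ + _ = e1 * (a2 - b2) * e3 * (a4 - b4)); last by ring.
apply: hasE_eq => w.
by rewrite (fE f2 (Z2 w)) (fE f4 (Z4 w)); ring.
Qed.

End Expectation.

Lemma expR_sub1_le {R : realType} (u : R) : expR u - 1 <= u * expR u.
Proof.
have h := expR_ge1Dx (- u).
have : (1 - u) * expR u <= 1.
  have := expRxMexpNx_1 u; have := expR_gt0 u; nra.
lra.
Qed.

Lemma expR_taylor1 {R : realType} (u : R) :
  `|expR u - 1 - u| <= u ^+ 2 * expR `|u|.
Proof.
have h1 := expR_ge1Dx u; have h2 := expR_sub1_le u.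
rewrite ger0_norm; last by lra.
have [u0|u0] := leP 0 u.
  rewrite ger0_norm//; apply: (@le_trans _ _ (u * (expR u - 1))); first by lra.
  by rewrite expr2 -mulrA ler_wpM2l.
apply: (@le_trans _ _ (u ^+ 2)); first by nra.
by rewrite ler_peMr ?sqr_ge0// -expR0 ler_expR.
Qed.

(** The constant is 4^4: y / 4 <= exp(y / 4), raised to the fourth power. *)
Lemma exprn4_le_expR {R : realType} (y : R) : 0 <= y -> y ^+ 4 <= 256 * expR y.
Proof.
move=> y0; have := expR_ge1Dx (y / 4).
have -> : expR y = expR (y / 4) ^+ 4.
  by rewrite -expRM_natl; congr expR; field.
move=> h.
have h2 : y / 4 <= expR (y / 4) by lra.
have : (y / 4) ^+ 4 <= expR (y / 4) ^+ 4.
  by rewrite lerXn2r// nnegrE ?expR_ge0// divr_ge0.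
rewrite exprMn (_ : (4^-1) ^+ 4 = 256^-1 :> R); last by field.
lra.
Qed.

(** * Law and independence of Brownian increments *)

Section BrownianIncrements.
Context {R : realType} {d : measure_display} {T : measurableType d}.
Variables (P : probability T R) (W : R -> T -> R).
Hypothesis hW : brownian_motion P W.

Lemma bm_meas t : 0 <= t -> measurable_fun setT (W t).
Proof. by have [+ _ _ _ _] := hW; exact. Qed.

Lemma inc_meas s t : 0 <= s -> 0 <= t -> measurable_fun setT (fun w => W t w - W s w).
Proof. by move=> s0 t0; apply: measurable_funB; exact: bm_meas. Qed.

Lemma ge0_integral_inc s t (g : R -> R) : 0 <= s -> s < t -> measurable_fun setT g ->
  (forall x, 0 <= g x) ->
  (\int[P]_w (g (W t w - W s w))%:E =
   \int[lebesgue_measure]_z (normal_pdf 0 (Num.sqrt (t - s)) z * g z)%:E)%E.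
Proof.
move=> s0 st mg g0; have t0 : 0 <= t by lra.
rewrite -(@ge0_integral_transfer _ _ _ _ _ P lebesgue_measure (fun=> 1)
  (fun w => W t w - W s w) (normal_pdf 0 (Num.sqrt (t - s))) id)//.
- by apply: eq_integral => w _; rewrite mul1r.
- exact: inc_meas.
- exact: measurable_normal_pdf.
- by move=> y; exact: normal_pdf_ge0.
- move=> B mB.
  have [_ _ _ /(_ s t s0 st B mB) + _] := hW.
  rewrite (_ : [set w | B (W t w - W s w)] = (fun w => W t w - W s w) @^-1` B)//.
  rewrite -[in P _](setIT (_ @^-1` B)) -integral_indic//; last first.
    by rewrite -[X in measurable X]setTI; exact: inc_meas.
  move=> e; transitivity (\int[P]_w (\1_((fun w => W t w - W s w) @^-1` B) w)%:E)%E.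
    by apply: eq_integral => w _; rewrite mul1r !indicE.
  rewrite e /normal_prob [LHS]integral_mkcond; apply: eq_integral => z _.
  by rewrite patchE indicE; case: (z \in B); rewrite ?mulr1 ?mulr0.
Qed.

(** Completing the square: exp(a z) moves the mean of the normal density to a sd^2 and leaves a
    constant factor. *)
Lemma integral_normal_pdf_expR (sd a : R) : sd != 0 ->
  (\int[lebesgue_measure]_z (normal_pdf 0 sd z * expR (a * z))%:E =
   (expR (a ^+ 2 * sd ^+ 2 / 2))%:E)%E.
Proof.
move=> sd0.
transitivity (\int[lebesgue_measure]_z
    ((expR (a ^+ 2 * sd ^+ 2 / 2))%:E * (normal_pdf (a * sd ^+ 2) sd z)%:E))%E.
  apply: eq_integral => z _; rewrite -EFinM; congr EFin.
  rewrite !normal_pdfE// mulrCA -[LHS]mulrA; congr (_ * _).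
  rewrite /normal_fun -!expRD; congr expR.
  by field.
rewrite ge0_integralZl//=.
- by rewrite integral_normal_pdf mule1.
- by apply/measurable_EFinP; exact: measurable_normal_pdf.
- by move=> z _; rewrite lee_fin normal_pdf_ge0.
Qed.

Lemma hasE_expR_inc s t a : 0 <= s -> s <= t ->
  hasE P (fun w => expR (a * (W t w - W s w))) (expR (a ^+ 2 * (t - s) / 2)).
Proof.
(* The case s = t is apart: the law of an increment is given only for s < t. *)
move=> s0; rewrite le_eqVlt => /predU1P[<-|st].
  rewrite subrr mulr0 mul0r expR0.
  by apply: hasE_eq (hasE_cst P 1) => w; rewrite subrr mulr0 expR0.
have t0 : 0 <= t by lra.
have mg : measurable_fun setT (fun x : R => expR (a * x)).
  by apply: measurableT_comp => //; exact: measurable_funM.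
apply: hasE_ge0.
- exact: (measurableT_comp mg (inc_meas s0 t0)).
- by move=> w; exact: expR_ge0.
rewrite (ge0_integral_inc s0 st mg); last by move=> x; exact: expR_ge0.
rewrite integral_normal_pdf_expR ?sqr_sqrtr//; first by lra.
by rewrite gt_eqF// sqrtr_gt0; lra.
Qed.

Lemma inc_indep4 t0 t1 t2 t3 t4 : 0 <= t0 -> t0 <= t1 -> t1 <= t2 -> t2 <= t3 -> t3 <= t4 ->
  forall B1 B2 B3 B4 : set R, measurable B1 -> measurable B2 ->
    measurable B3 -> measurable B4 ->
    (P [set w | [/\ B1 (W t1 w - W t0 w)%R, B2 (W t2 w - W t1 w)%R,
                   B3 (W t3 w - W t2 w)%R & B4 (W t4 w - W t3 w)%R]] =
     P ((fun w => W t1 w - W t0 w)%R @^-1` B1) * P ((fun w => W t2 w - W t1 w)%R @^-1` B2) *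
     P ((fun w => W t3 w - W t2 w)%R @^-1` B3) * P ((fun w => W t4 w - W t3 w)%R @^-1` B4))%E.
Proof.
move=> p0 p1 p2 p3 p4 B1 B2 B3 B4 m1 m2 m3 m4.
have [_ _ _ _ ind] := hW.
(* The default [t4] keeps the sequence nondecreasing beyond the last node; the default [B4] is a
   measurable filler. *)
pose tt (i : nat) := nth t4 [:: t0; t1; t2; t3; t4] i.
pose BB (i : nat) := nth B4 [:: B1; B2; B3; B4] i.
have := ind 4 tt BB p0.
have h1 i : tt i <= tt i.+1 by do 5 (case: i => [//|i]); rewrite /tt /= !nth_nil.
have h2 i : measurable (BB i) by do 4 (case: i => [//|i]); rewrite /BB /= nth_nil.
move=> /(_ h1 h2).
rewrite !big_ord_recl big_ord0 /= mule1 !muleA => <-; congr (P _).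
apply/seteqP; split => w /= => [[? ? ? ?]|h].
  by do 4 (case=> [//|]).
by split; [exact: (h 0%N)|exact: (h 1%N)|exact: (h 2%N)|exact: (h 3%N)].
Qed.

End BrownianIncrements.

(** * One-step remainder of the exponential *)

Section ItoRemainder.
Context {R : realType}.
Variables (nu c t0 : R).

(* For b = nu + c^2/2, the increment of the process exp(nu t + c W_t) minus
   its drift and diffusion parts, relative to the current value *)
Definition ito_rem (dt z : R) : R :=
  expR (nu * dt + c * z) - 1 - c * z - (nu + c ^+ 2 / 2) * dt.

Let C0 := `|nu| * Num.sqrt t0 + `|c|.
Let kp := 2 * (C0 * Num.sqrt t0) + 1.

(** With x = |z| / sqrt dt the exponent u satisfies |u| <= sqrt dt C0 (1 + x), so the squared Taylor
    remainder is at most dt^2 C0^4 (1 + x)^4 exp(2 |u|). The fourth power is absorbed into 256 exp(1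
    + x), which accounts for the 1 in [kp], and 2 |u| accounts for the rest of [kp]. The
    exponentials kept at the end have, for an increment of variance dt, an expectation independent
    of dt. *)
Lemma ito_rem_sqr_le dt z : 0 < dt -> dt <= t0 ->
  ito_rem dt z ^+ 2 <= dt ^+ 2 *
    (512 * C0 ^+ 4 * expR kp *
       (expR (kp / Num.sqrt dt * z) + expR (- (kp / Num.sqrt dt) * z)) + c ^+ 4 / 2).
Proof.
move=> dt0 dtt; set q := Num.sqrt dt.
have q0 : 0 < q by rewrite sqrtr_gt0.
have q2 : q ^+ 2 = dt by rewrite sqr_sqrtr// ltW.
have qt : q <= Num.sqrt t0 by rewrite ler_wsqrtr.
have C00 : 0 <= C0 by rewrite addr_ge0// mulr_ge0// sqrtr_ge0.
set x := `|z| / q; have x0 : 0 <= x by rewrite divr_ge0// ltW.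
have zx : `|z| = q * x by rewrite /x mulrC divfK// gt_eqF.
set u := nu * dt + c * z.
have uq : `|u| <= q * (C0 * (1 + x)).
  apply: (le_trans (ler_normD _ _)); rewrite !normrM zx (ger0_norm (ltW dt0)) -q2.
  have h1 : `|nu| * q <= `|nu| * Num.sqrt t0 by rewrite ler_wpM2l.
  have h2 : 0 <= `|nu| * Num.sqrt t0 by rewrite mulr_ge0// sqrtr_ge0.
  have -> : `|nu| * q ^+ 2 + `|c| * (q * x) = q * (`|nu| * q + `|c| * x) by ring.
  rewrite ler_pM2l// /C0; have := normr_ge0 c; nra.
have uk : `|u| <= C0 * Num.sqrt t0 * (1 + x).
  apply: (le_trans uq); rewrite mulrA [q * _]mulrC.
  by rewrite ler_wpM2r ?addr_ge0// ler_wpM2l.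
set a := expR u - 1 - u.
have a2 : a ^+ 2 <= 256 * (dt ^+ 2 * C0 ^+ 4 * expR (kp * (1 + x))).
  apply: (@le_trans _ _ ((u ^+ 2 * expR `|u|) ^+ 2)).
    have p0 : 0 <= u ^+ 2 * expR `|u| by rewrite mulr_ge0 ?expR_ge0// sqr_ge0.
    by rewrite -(real_normK (num_real a)) lerXn2r ?nnegrE//; exact: expR_taylor1.
  rewrite exprMn -exprM -expRM_natl.
  apply: (@le_trans _ _ ((q * (C0 * (1 + x))) ^+ 4 * expR (2 * (C0 * Num.sqrt t0 * (1 + x))))).
    have u4 : u ^+ (2 * 2) <= (q * (C0 * (1 + x))) ^+ 4.
      rewrite exprM -(real_normK (num_real u)) -exprM.
      apply: lerXn2r => //; rewrite nnegrE.
      by apply: mulr_ge0; [exact: ltW|apply: mulr_ge0 => //; exact: addr_ge0].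
    apply: ler_pM; [exact: exprn_even_ge0|exact: expR_ge0|exact: u4|].
    by rewrite ler_expR ler_pM2l.
  have -> : kp * (1 + x) = (1 + x) + 2 * (C0 * Num.sqrt t0 * (1 + x)).
    by rewrite /kp; ring.
  rewrite expRD !exprMn -q2 -exprM.
  have h := @exprn4_le_expR _ (1 + x) ltac:(lra).
  have h2 : 0 <= q ^+ 4 * C0 ^+ 4 * expR (2 * (C0 * Num.sqrt t0 * (1 + x))).
    by rewrite !mulr_ge0 ?exprn_ge0 ?expR_ge0// ltW.
  have := ler_wpM2l h2 h; lra.
have kq : expR (kp * (1 + x)) <= expR kp * (expR (kp / q * z) + expR (- (kp / q) * z)).
  rewrite mulrDr mulr1 expRD ler_pM2l ?expR_gt0// /x.
  have [z0|z0] := leP 0 z.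
    rewrite ger0_norm// (_ : kp * (z / q) = kp / q * z); last by ring.
    by rewrite lerDl expR_ge0.
  rewrite ltr0_norm// (_ : kp * (- z / q) = - (kp / q) * z); last by ring.
  by rewrite lerDr expR_ge0.
have -> : ito_rem dt z = a - c ^+ 2 / 2 * dt by rewrite /ito_rem /a /u; lra.
have h : (a - c ^+ 2 / 2 * dt) ^+ 2 <= 2 * a ^+ 2 + c ^+ 4 / 2 * dt ^+ 2.
  have -> : c ^+ 4 / 2 * dt ^+ 2 = 2 * (c ^+ 2 / 2 * dt) ^+ 2 by field.
  have := sqr_ge0 (a + c ^+ 2 / 2 * dt); lra.
apply: (le_trans h).
have h3 : 0 <= dt ^+ 2 * C0 ^+ 4 by rewrite mulr_ge0 ?exprn_ge0// ltW.
have := ler_wpM2l h3 kq; lra.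
Qed.

End ItoRemainder.

Section ItoRemainderE.
Context {R : realType} {d : measure_display} {T : measurableType d}.
Variables (P : probability T R) (W : R -> T -> R).
Hypothesis hW : brownian_motion P W.
Variables (nu c t0 : R).
Local Notation bb := (nu + c ^+ 2 / 2).
Local Notation D s t w := (ito_rem nu c (t - s) (W t w - W s w)).

Lemma ito_rem_meas s t : 0 <= s -> 0 <= t -> measurable_fun setT (fun w => D s t w).
Proof.
move=> s0 t0'; have mi := inc_meas hW s0 t0'.
apply: measurable_funB => //; apply: measurable_funB; last exact: measurable_funM.
apply: measurable_funB => //; apply: measurableT_comp => //.
by apply: measurable_funD => //; exact: measurable_funM.
Qed.

Lemma hasE_expR_drift s t k : 0 <= s -> s <= t ->
  hasE P (fun w => expR (k * (nu * (t - s) + c * (W t w - W s w))))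
    (expR ((k * nu + k ^+ 2 * c ^+ 2 / 2) * (t - s))).
Proof.
move=> s0 st.
have := hasE_scale (expR (k * (nu * (t - s)))) (hasE_expR_inc hW (k * c) s0 st).
rewrite -expRD (_ : k * (nu * (t - s)) + (k * c) ^+ 2 * (t - s) / 2 =
  (k * nu + k ^+ 2 * c ^+ 2 / 2) * (t - s)); last by field.
by apply: hasE_eq => w; rewrite -expRD; congr expR; ring.
Qed.

(** The mean is of order dt^2, one order better than the second moment suggests, because the drift
    nu + c^2/2 cancels the first-order term. In the square of a sum of remainders the diagonal uses
    the first bound; an off-diagonal pair uses the third for the earlier step, whose growth factor
    multiplies all that follows, and the second for the later step. *)
Lemma ito_rem_moments : exists C : R, 0 <= C /\ forall s t, 0 <= s -> s < t -> t - s <= t0 ->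
  [/\ exists2 v, hasE P (fun w => D s t w ^+ 2) v & v <= C * (t - s) ^+ 2,
      exists2 v, hasE P (fun w => D s t w) v & `|v| <= C * (t - s) ^+ 2
    & exists2 v, hasE P (fun w => D s t w *
                                  expR (nu * (t - s) + c * (W t w - W s w))) v
        & `|v| <= C * (t - s)].
Proof.
pose C0 := `|nu| * Num.sqrt t0 + `|c|.
pose kp := 2 * (C0 * Num.sqrt t0) + 1.
pose C1 := 1024 * C0 ^+ 4 * expR kp * expR (kp ^+ 2 / 2) + c ^+ 4 / 2.
pose C2 := bb ^+ 2 * expR (`|bb| * `|t0|) + `|c| * expR (`|t0| ^+ 3 / 2).
pose C3 := expR (`|2 * nu + 2 ^+ 2 * c ^+ 2 / 2| * `|t0|).
have C10 : 0 <= C1.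
  apply: addr_ge0; last by apply: divr_ge0 => //; exact: exprn_even_ge0.
  apply: mulr_ge0; last exact: expR_ge0.
  apply: mulr_ge0; last exact: expR_ge0.
  by apply: mulr_ge0; [exact: ler0n|exact: exprn_even_ge0].
have C20 : 0 <= C2.
  apply: addr_ge0; apply: mulr_ge0 => //; try exact: expR_ge0; exact: sqr_ge0.
have C30 : 0 <= C3 by rewrite /C3 expR_ge0.
exists (C1 + C2 + C3); split; first by lra.
move=> s t s0 st stt; set dt := t - s.
have dt0 : 0 < dt by rewrite /dt; lra.
have t0' : 0 <= t by lra.
have dtt : dt <= t0 by [].
have q0 : Num.sqrt dt != 0 by rewrite gt_eqF// sqrtr_gt0.
have mD := ito_rem_meas s0 t0'.
have [v2 Ev2 v2C] : exists2 v, hasE P (fun w => D s t w ^+ 2) v & v <= C1 * dt ^+ 2.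
  have E1 := hasE_expR_inc hW (kp / Num.sqrt dt) s0 (ltW st).
  have E2 := hasE_expR_inc hW (- (kp / Num.sqrt dt)) s0 (ltW st).
  have e1 : (kp / Num.sqrt dt) ^+ 2 * (t - s) / 2 = kp ^+ 2 / 2.
    by rewrite exprMn exprVn sqr_sqrtr ?(ltW dt0)// -/dt; field; rewrite gt_eqF.
  move: E2; rewrite sqrrN e1 => E2; move: E1; rewrite e1 => E1.
  have E3 := hasE_scale (dt ^+ 2) (hasE_add (hasE_scale (512 * C0 ^+ 4 * expR kp)
    (hasE_add E1 E2)) (hasE_cst P (c ^+ 4 / 2))).
  have [||v Ev vle] := @hasE_dom _ _ _ P (fun w => D s t w ^+ 2) _ _ _ E3.
  - exact: measurable_funX.
  - by move=> w; rewrite ger0_norm ?sqr_ge0//; exact: ito_rem_sqr_le.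
  exists v => //; apply: (le_trans (ler_norm _)); apply: (le_trans vle).
  by rewrite /C1; lra.
have [v1 Ev1] : exists v, hasE P (fun w => D s t w) v.
  have [||v Ev _] := @hasE_dom _ _ _ P (fun w => D s t w) _ _ _ (hasE_add (hasE_cst P 1) Ev2) => //.
    move=> w; have := sqr_ge0 (`|D s t w| - 1); rewrite -(real_normK (num_real (D s t w))).
    have := sqr_ge0 `|D s t w|; lra.
  by exists v.
(* Only exponential moments are at hand, so the mean of the increment is bounded instead of
   computed: v <= exp v - 1 for v = dt (W_t - W_s) and for its opposite gives |E v| <= exp(dt^3 / 2)
   - 1, and the result is divided by dt. *)
have [z Ez zle] : exists2 z, hasE P (fun w => W t w - W s w) z &
    `|z| <= dt ^+ 2 * expR (`|t0| ^+ 3 / 2).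
  have Ep := hasE_expR_inc hW dt s0 (ltW st).
  have En := hasE_expR_inc hW (- dt) s0 (ltW st).
  rewrite sqrrN in En; rewrite -/dt in Ep En.
  have [||z Ez _] := @hasE_dom _ _ _ P (fun w => dt * (W t w - W s w)) _ _ _ (hasE_add Ep En).
  - by apply: measurable_funM => //; exact: (inc_meas hW s0 t0').
  - move=> w; have := expR_ge1Dx (dt * (W t w - W s w)).
    have := expR_ge1Dx (- dt * (W t w - W s w)).
    have := expR_gt0 (dt * (W t w - W s w)).
    have := expR_gt0 (- dt * (W t w - W s w)).
    by rewrite ler_norml => *; apply/andP; split; lra.
  have zp : z <= expR (dt ^+ 2 * dt / 2) - 1.
    apply: (hasE_le Ez (hasE_sub Ep (hasE_cst P 1))) => w.
    by have := expR_ge1Dx (dt * (W t w - W s w)); lra.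
  have zn : 0 - z <= expR (dt ^+ 2 * dt / 2) - 1.
    apply: (hasE_le (hasE_sub (hasE_cst P 0) Ez) (hasE_sub En (hasE_cst P 1))) => w.
    by have := expR_ge1Dx (- dt * (W t w - W s w)); lra.
  exists (dt^-1 * z).
    apply: hasE_eq (hasE_scale dt^-1 Ez) => w.
    by rewrite mulrA mulVf ?mul1r// gt_eqF.
  rewrite normrM gtr0_norm ?invr_gt0// ler_pdivrMl//.
  have : expR (dt ^+ 2 * dt / 2) - 1 <= dt ^+ 3 * expR (`|t0| ^+ 3 / 2).
    have /le_trans -> // := @expR_sub1_le R (dt ^+ 2 * dt / 2).
    have -> : dt ^+ 2 * dt / 2 = dt ^+ 3 / 2 by ring.
    have d3 : 0 < dt ^+ 3 by rewrite exprn_gt0.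
    have d3t : dt ^+ 3 <= `|t0| ^+ 3.
      by rewrite lerXn2r ?nnegrE ?(ltW dt0)// (le_trans dtt)// ler_norm.
    have e0 := expR_gt0 (dt ^+ 3 / 2).
    have e1 : expR (dt ^+ 3 / 2) <= expR (`|t0| ^+ 3 / 2) by rewrite ler_expR; lra.
    nra.
  have -> : dt * (dt ^+ 2 * expR (`|t0| ^+ 3 / 2)) = dt ^+ 3 * expR (`|t0| ^+ 3 / 2) by ring.
  by move=> h; rewrite ler_norml; apply/andP; split; lra.
have d20 : 0 <= dt ^+ 2 by exact: sqr_ge0.
have Eu := hasE_expR_drift 1 s0 (ltW st).
rewrite (_ : 1 * nu + _ = bb) in Eu; last by field.
have v1E : v1 = expR (bb * dt) - 1 - c * z - bb * dt.
  have := hasE_sub (hasE_sub (hasE_sub Eu (hasE_cst P 1)) (hasE_scale c Ez))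
    (hasE_cst P (bb * dt)).
  apply: hasE_uniq; apply: hasE_eq Ev1 => w.
  by rewrite /ito_rem mul1r.
split.
- exists v2 => //; apply: (le_trans v2C); rewrite ler_wpM2r//; lra.
- exists v1 => //; have h := expR_taylor1 (bb * dt).
  have -> : v1 = (expR (bb * dt) - 1 - bb * dt) - c * z by rewrite v1E; ring.
  apply: (le_trans (ler_normB _ _)).
  apply: (@le_trans _ _ (C2 * dt ^+ 2)); last by rewrite ler_wpM2r//; lra.
  rewrite /C2 [leRHS]mulrDl; apply: lerD.
    apply: (le_trans h); rewrite exprMn mulrAC ler_wpM2r//.
    rewrite ler_wpM2l ?sqr_ge0// ler_expR normrM ler_wpM2l// (gtr0_norm dt0).
    by rewrite (le_trans dtt)// ler_norm.
  rewrite normrM -mulrA ler_wpM2l// mulrC.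
  by move: zle; rewrite mulrC.
(* Young's inequality |x y| <= x^2 / dt + dt y^2, where E x^2 is of order dt^2 and E y^2 is
   bounded. *)
- have E2u := hasE_expR_drift 2 s0 (ltW st).
  have [||v Ev vle] := @hasE_dom _ _ _ P (fun w => D s t w *
      expR (nu * (t - s) + c * (W t w - W s w))) _ _ _
      (hasE_add (hasE_scale dt^-1 Ev2) (hasE_scale dt E2u)).
  + apply: measurable_funM => //; apply: measurableT_comp => //.
    apply: measurable_funD => //; apply: measurable_funM => //.
    exact: (inc_meas hW s0 t0').
  + move=> w; rewrite expRM_natl normrM (gtr0_norm (expR_gt0 _)).
    set x := D s t w; set y := expR _.
    have y0 : 0 <= y by exact: expR_ge0.
    rewrite -(real_normK (num_real x)).
    have : 0 <= dt^-1 * (`|x| - dt * y) ^+ 2.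
      by rewrite mulr_ge0 ?sqr_ge0// invr_ge0 ltW.
    have -> : dt^-1 * (`|x| - dt * y) ^+ 2 =
      dt^-1 * `|x| ^+ 2 + dt * y ^+ 2 - 2 * (`|x| * y).
      by field; rewrite gt_eqF.
    have := mulr_ge0 (normr_ge0 x) y0.
    by move=> h1 h2; lra.
  exists v => //; apply: (le_trans vle).
  have h1 : dt^-1 * v2 <= C1 * dt.
    by rewrite ler_pdivrMl//; have -> : dt * (C1 * dt) = C1 * dt ^+ 2 by ring.
  have h2 : expR ((2 * nu + 2 ^+ 2 * c ^+ 2 / 2) * (t - s)) <= C3.
    rewrite /C3 ler_expR; apply: (le_trans (ler_norm _)); rewrite normrM ler_wpM2l//.
    by rewrite (gtr0_norm dt0) (le_trans dtt)// ler_norm.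
  have h3 : dt * expR ((2 * nu + 2 ^+ 2 * c ^+ 2 / 2) * (t - s)) <= C3 * dt.
    by rewrite mulrC ler_pM2r.
  have : 0 <= C2 * dt by rewrite mulr_ge0// ltW.
  lra.
Qed.

End ItoRemainderE.

Section ItoSums.
Context {R : realType} {d : measure_display} {T : measurableType d}.
Variables (P : probability T R) (W : R -> T -> R).
Hypothesis hW : brownian_motion P W.
Variables (nu c : R).
Local Notation D s t w := (ito_rem nu c (t - s) (W t w - W s w)).

(** Built on [W t - W 0] because [W 0] vanishes only almost surely: the process starts at 1
    everywhere and is a function of increments. *)
Definition gbm (t : R) (w : T) : R := expR (nu * t + c * (W t w - W 0 w)).

Lemma gbm_meas t : 0 <= t -> measurable_fun setT (gbm t).
Proof.
move=> t0; apply: measurableT_comp => //; apply: measurable_funD => //.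
by apply: measurable_funM => //; exact: (inc_meas hW (lexx 0) t0).
Qed.

(** For s < s' <= t < t' the product of two terms is gbm_s^2, times the first remainder with its
    growth factor, times the growth over the gap, times the second remainder. These factors are
    independent, with expectations of order 1, dt, 1 and dt^2. *)
Lemma ito_products (t0 : R) : exists K : R, 0 <= K /\
  (forall s s' dt, 0 <= s -> 0 < dt -> s' - s = dt -> s' <= t0 ->
     exists2 v, hasE P (fun w => (gbm s w * D s s' w) ^+ 2) v & v <= K * dt ^+ 2) /\
  (forall s s' t t' dt, 0 <= s -> 0 < dt -> s' - s = dt -> s' <= t -> t' - t = dt ->
     t' <= t0 ->
     exists2 v, hasE P (fun w => gbm s w * D s s' w * (gbm t w * D t t' w)) v
       & v <= K * dt ^+ 3).
Proof.
have [C [C0 HC]] := ito_rem_moments hW nu c t0.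
pose G (k : R) := expR (`|k * nu + k ^+ 2 * c ^+ 2 / 2| * `|t0|).
have Gle k t : 0 <= t -> t <= t0 -> expR ((k * nu + k ^+ 2 * c ^+ 2 / 2) * t) <= G k.
  move=> t0' tt; rewrite ler_expR (le_trans (ler_norm _))// normrM ler_wpM2l//.
  by rewrite ger0_norm// (le_trans tt)// ler_norm.
have G0 k : 0 <= G k by exact: expR_ge0.
have mexp (k t : R) : measurable_fun setT (fun z : R => expR (k * (nu * t + c * z))).
  apply: measurableT_comp => //; apply: measurable_funM => //.
  by apply: measurable_funD => //; exact: measurable_funM.
have mrem dt : measurable_fun setT (fun z : R => ito_rem nu c dt z).
  apply: measurable_funB => //; apply: measurable_funB; last exact: measurable_funM.
  apply: measurable_funB => //; apply: measurableT_comp => //.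
  by apply: measurable_funD => //; exact: measurable_funM.
exists (G 2 * C + G 2 * C * G 1 * C); split.
  by rewrite addr_ge0// !mulr_ge0.
split.
- move=> s s' dt s0 dt0 sdt st.
  have [] := HC s s'; try lra.
  move=> [v Ev vle] _ _.
  have s'0 : 0 <= s' by lra.
  have ss' : s <= s' by lra.
  (* Two blocks suffice here; the last two are empty steps carrying the factor 1. *)
  have H := @hasE_indep4 _ _ _ P (fun w => W s w - W 0 w) (fun w => W s' w - W s w)
    (fun w => W s' w - W s' w) (fun w => W s' w - W s' w)
    (fun z => expR (2 * (nu * (s - 0) + c * z)))
    (fun z => ito_rem nu c (s' - s) z ^+ 2) (fun=> 1) (fun=> 1) _ v 1 1
    (inc_meas hW (lexx 0) s0) (inc_meas hW s0 s'0)
    (inc_meas hW s'0 s'0) (inc_meas hW s'0 s'0)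
    (inc_indep4 hW (lexx 0) s0 ss' (lexx s') (lexx s')) (mexp 2 (s - 0))
    (measurable_funX 2 (mrem _)) (measurable_cst _) (measurable_cst _)
    (fun=> expR_ge0 _) (fun=> ler01)
    (hasE_expR_drift hW nu c 2 (lexx 0) s0) Ev (hasE_cst P 1) (hasE_cst P 1).
  eexists; first (apply: hasE_eq H => w /=).
    by rewrite /gbm subr0 !mulr1 exprMn -expRM_natl.
  have h := Gle 2 (s - 0) ltac:(lra) ltac:(lra).
  rewrite !mulr1.
  have v0 : 0 <= v.
    by apply: (hasE_le (hasE_cst P 0) Ev) => w; exact: sqr_ge0.
  apply: (@le_trans _ _ (G 2 * (C * dt ^+ 2))).
    by apply: ler_pM => //; rewrite ?expR_ge0 -?sdt.
  rewrite mulrDl mulrA lerDl !mulr_ge0// ltW//.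
- move=> s s' t t' dt s0 dt0 sdt st tdt tt.
  have [] := HC s s'; try lra.
  move=> _ _ [v2 Ev2 v2le].
  have [] := HC t t'; try lra.
  move=> _ [v4 Ev4 v4le] _.
  have s'0 : 0 <= s' by lra.
  have t0' : 0 <= t by lra.
  have t'0 : 0 <= t' by lra.
  have ss' : s <= s' by lra.
  have tt' : t <= t' by lra.
  have mre : measurable_fun setT
      (fun z => ito_rem nu c (s' - s) z * expR (nu * (s' - s) + c * z)).
    apply: measurable_funM => //; apply: measurableT_comp => //.
    by apply: measurable_funD => //; exact: measurable_funM.
  have H := @hasE_indep4 _ _ _ P (fun w => W s w - W 0 w) (fun w => W s' w - W s w)
    (fun w => W t w - W s' w) (fun w => W t' w - W t w)
    (fun z => expR (2 * (nu * (s - 0) + c * z)))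
    (fun z => ito_rem nu c (s' - s) z * expR (nu * (s' - s) + c * z))
    (fun z => expR (1 * (nu * (t - s') + c * z)))
    (fun z => ito_rem nu c (t' - t) z) _ v2 _ v4
    (inc_meas hW (lexx 0) s0) (inc_meas hW s0 s'0)
    (inc_meas hW s'0 t0') (inc_meas hW t0' t'0)
    (inc_indep4 hW (lexx 0) s0 ss' st tt') (mexp 2 (s - 0)) mre
    (mexp 1 (t - s')) (mrem (t' - t)) (fun=> expR_ge0 _) (fun=> expR_ge0 _)
    (hasE_expR_drift hW nu c 2 (lexx 0) s0) Ev2 (hasE_expR_drift hW nu c 1 s'0 st) Ev4.
  eexists; first (apply: hasE_eq H => w /=).
    have -> : gbm t w = gbm s w * expR (nu * (s' - s) + c * (W s' w - W s w)) *
        expR (1 * (nu * (t - s') + c * (W t w - W s' w))).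
      by rewrite /gbm -!expRD; congr expR; ring.
    by rewrite subr0 [expR (2 * _)]expRM_natl -/(gbm s w); ring.
  have h := Gle 2 (s - 0) ltac:(lra) ltac:(lra).
  have h1 := Gle 1 (t - s') ltac:(lra) ltac:(lra).
  apply: (le_trans (ler_norm _)); rewrite !normrM !(gtr0_norm (expR_gt0 _)).
  apply: (@le_trans _ _ (G 2 * (C * dt) * G 1 * (C * dt ^+ 2))).
    rewrite sdt in v2le; rewrite tdt in v4le.
    have p1 := ler_pM (expR_ge0 _) (normr_ge0 v2) h v2le.
    have p2 := ler_pM (mulr_ge0 (expR_ge0 _) (normr_ge0 v2)) (expR_ge0 _) p1 h1.
    exact: (ler_pM (mulr_ge0 (mulr_ge0 (expR_ge0 _) (normr_ge0 v2)) (expR_ge0 _))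
      (normr_ge0 v4) p2 v4le).
  have -> : G 2 * (C * dt) * G 1 * (C * dt ^+ 2) = G 2 * C * G 1 * C * dt ^+ 3 by ring.
  rewrite mulrDl lerDr; apply: mulr_ge0; first by apply: mulr_ge0.
  by apply: exprn_ge0; exact: ltW.
Qed.

End ItoSums.

(** * Left-endpoint Riemann sums *)

Section RiemannSums.
Context {R : realType}.
Local Notation mu := lebesgue_measure.

Definition node (t : R) (N i : nat) : R := t * i%:R / N.+1%:R.

Lemma nodeS (t : R) N i : node t N i.+1 - node t N i = t / N.+1%:R.
Proof.
rewrite /node -mulrBl -mulrBr (_ : i.+1%:R = i%:R + 1); last by rewrite natr1.
by rewrite addrAC subrr add0r mulr1.
Qed.

Lemma node_ge0 t N i : 0 <= t -> 0 <= node t N i.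
Proof. by move=> t0; rewrite /node divr_ge0// mulr_ge0. Qed.

Lemma node_le (t : R) N i j : 0 <= t -> (i <= j)%N -> node t N i <= node t N j.
Proof. by move=> t0 ij; rewrite /node ler_pM2r ?invr_gt0// ler_wpM2l// ler_nat. Qed.

Lemma node_last t N : node t N N.+1 = t.
Proof. by rewrite /node mulfK// pnatr_eq0. Qed.

Lemma inv_natS_cvg (a : R) : a / N.+1%:R @[N --> \oo] --> (0 : R).
Proof.
rewrite -[X in _ --> X](mulr0 a); apply: cvgMr.
exact: cvg_harmonic.
Qed.

(** The sums are integrals of step functions which converge pointwise by continuity and are
    dominated by a bound of |f|. The right end of [0, t] is dropped so that each point lies in
    exactly one half-open cell. *)
Lemma riemann_sum_cvg (t : R) (f : R -> R) : 0 < t -> {within `[0, t], continuous f} ->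
  \sum_(i < N.+1) f (node t N i) * (t / N.+1%:R) @[N --> \oo] -->
  \int[mu]_(s in `[0, t]) f s.
Proof.
move=> t0 cf.
have itf : mu.-integrable `[0, t] (EFin \o f).
  by apply: continuous_compact_integrable => //; exact: segment_compact.
have itf' : mu.-integrable `[0, t[ (EFin \o f).
  apply: integrableS itf => // x /=.
  by rewrite !in_itv/= => /andP[-> /ltW ->].
have [M Mf] : exists M, forall s, s \in `[0, t] -> `|f s| <= M.
  have [M [_ HM]] := compact_bounded (continuous_compact cf (@segment_compact _ 0 t)).
  exists (M + 1) => s st; apply: (HM (M + 1)); first by rewrite ltrDl.
  by exists s.
pose I N i : set R := `[node t N i, node t N i.+1[%classic.
pose F N (s : R) := \sum_(i < N.+1) f (node t N i) * \1_(I N i) s.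
have idx s N : 0 <= s -> s < t -> exists i0 : 'I_N.+1,
    [/\ F N s = f (node t N i0), node t N i0 <= s & s - node t N i0 <= t / N.+1%:R].
  move=> s0 st; set x := s * N.+1%:R / t.
  have x0 : 0 <= x by rewrite /x divr_ge0 ?mulr_ge0// ltW.
  have /andP[k1 k2] := Num.Theory.truncn_itv x0; set k := Num.truncn x in k1 k2.
  have N0 : 0 < N.+1%:R :> R by rewrite ltr0n.
  have sx : s = t * x / N.+1%:R by rewrite /x mulrCA mulfV ?gt_eqF// mulr1 mulfK// gt_eqF.
  have kN : (k < N.+1)%N.
    rewrite -(ltr_nat R) (le_lt_trans k1)// /x ltr_pdivrMr// mulrC ltr_pM2l//.
  have Ik j : (s \in I N j) = (j == k).
    have nodex i : (node t N i <= s) = (i%:R <= x).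
      by rewrite /node sx ler_pM2r ?invr_gt0// ler_pM2l.
    have -> : (s \in I N j) = (j%:R <= x) && ~~ (j.+1%:R <= x).
      rewrite -!nodex -ltNge.
      by apply/idP/idP; rewrite inE /I /= in_itv.
    rewrite -ltNge.
    apply/andP/eqP => [[j1 j2]|->]; last by rewrite k1 k2.
    apply/eqP; rewrite eqn_leq -(ltnS j) -(ltnS k) -!(ltr_nat R).
    by rewrite (le_lt_trans j1 k2) (le_lt_trans k1 j2).
  exists (Ordinal kN); split.
  - rewrite /F (bigD1 (Ordinal kN))//= big1 ?addr0.
      by rewrite indicE Ik eqxx mulr1.
    move=> j jk; rewrite indicE Ik; case: eqP => [/= e|]; last by rewrite mulr0.
    by exfalso; move/eqP: jk; apply; exact: val_inj.
  - by rewrite /node sx ler_pM2r ?invr_gt0// ler_pM2l.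
  - rewrite -(nodeS t N k) lerD2r /node sx ler_pM2r ?invr_gt0// ler_pM2l//.
    exact: ltW.
have mF N : measurable_fun setT (F N).
  apply: measurable_sum => i; apply: measurable_funM => //.
  by apply: measurable_indic; exact: measurable_itv.
have intF N : (\int[mu]_(s in `[0%R, t[) (F N s)%:E =
    (\sum_(i < N.+1) f (node t N i) * (t / N.+1%:R))%:E)%E.
  transitivity (\int[mu]_(s in `[0%R, t[) (\sum_(i < N.+1) (f (node t N i))%:E * (\1_(I N i) s)%:E)%E)%E.
    by apply: eq_integral => s _; rewrite /F -sumEFin.
  rewrite integral_sum//=; last first.
    move=> i; apply: integrableZl => //.
    apply: (integrableS measurableT) => //.
    by apply: integrable_indic_itv.
  rewrite -sumEFin; apply: eq_bigr => i _.
  rewrite integralZl//=; last first.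
    apply: (integrableS measurableT) => //.
    by apply: integrable_indic_itv.
  rewrite integral_indic//=; last exact: measurable_itv.
  rewrite EFinM; congr (_ * _)%E.
  rewrite setIidl; last first.
    apply: subset_itv; rewrite bnd_simp.
      by apply: node_ge0; exact: ltW.
    by rewrite -{2}(node_last t N); apply: node_le => //; exact: ltW.
  rewrite lebesgue_measure_itv/= lte_fin.
  have := nodeS t N i => nS.
  have : 0 < t / N.+1%:R by rewrite divr_gt0.
  by rewrite -nS subr_gt0 => ->; rewrite -EFinB.
rewrite -(@Rintegral_itv_bndo_bndc _ (BLeft 0) t f)//.
rewrite (_ : (fun N => _) = (fun N => fine (\int[mu]_(s in `[0%R, t[) (F N s)%:E)%E)); last first.
  by apply/funext => N; rewrite intF.
apply: fine_cvg; rewrite fineK; last first.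
  by apply: integrable_fin_num itf' => //; exact: measurable_itv.
apply: (@dominated_cvg _ _ _ mu _ _ (fun N s => (F N s)%:E) _ (cst M%:E)) => //.
- by move=> N; apply/measurable_EFinP; exact: (measurable_funTS (mF N)).
- move=> s /=; rewrite in_itv/= => /andP[s0 st].
  apply: cvg_EFin; first by near=> N.
  apply/cvgrPdist_lt => e e0.
  have := (@subspace_continuousP _ `[0, t] _ f).1 cf s.
  rewrite /= in_itv/= s0 ltW// => /(_ isT) /cvgrPdist_lt /(_ e e0).
  rewrite near_withinE /= => -[dl /= dl0 Hd].
  have := inv_natS_cvg t => /cvgrPdist_lt /(_ dl dl0); apply: filterS => N.
  rewrite sub0r normrN ger0_norm; last by rewrite divr_ge0// ltW.
  move=> Ndl; have [i [-> i1 i2]] := idx s N s0 st.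
  apply: Hd => /=.
    by rewrite ger0_norm ?subr_ge0//; exact: (le_lt_trans i2 Ndl).
  by rewrite in_itv/= node_ge0 ?ltW//= ?(le_lt_trans i1).
- apply/integrableP; split => //=; rewrite integral_cst//= lebesgue_measure_itv/=.
  by rewrite lte_fin t0 -EFinB -EFinM ltry.
- move=> N s /=; rewrite in_itv/= => /andP[s0 st].
  have [i [-> i1 i2]] := idx s N s0 st; rewrite lee_fin; apply: Mf.
  by rewrite in_itv/= node_ge0 ?ltW//= (le_lt_trans i1).
Unshelve. all: by end_near. Qed.

End RiemannSums.

Section ConvergenceInProbability.
Context {R : realType} {d : measure_display} {T : measurableType d}.
Variable P : probability T R.

Lemma measurable_dev (f : T -> R) e : measurable_fun setT f ->
  measurable [set w | e <= `|f w|].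
Proof.
move=> mf; rewrite -[X in measurable X]setTI.
have -> : [set w | e <= `|f w|] = (fun w => `|f w|) @^-1` `[e, +oo[.
  by apply/seteqP; split => w /=; rewrite in_itv/= andbT.
exact: (measurableT_comp (@normr_measurable _ setT) mf).
Qed.

Lemma markov_sqr (f : T -> R) v e : 0 < e -> measurable_fun setT f ->
  hasE P (fun w => f w ^+ 2) v -> (P [set w | (e <= `|f w|)%R] <= (v / e ^+ 2)%:E)%E.
Proof.
move=> e0 mf Ev; have mA := @measurable_dev _ e mf; set A := [set w | _] in mA *.
have pf : P A \is a fin_num by exact: fin_num_measure.
have EA : hasE P (\1_A : T -> R) (fine (P A)).
  apply: hasE_ge0; [exact: measurable_indic|by []|].
  by rewrite integral_indic//= setIT fineK.
rewrite -(fineK pf) lee_fin ler_pdivlMr ?exprn_gt0// mulrC.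
apply: (hasE_le (hasE_scale _ EA) Ev) => w; rewrite indicE.
have [|_] := boolP (w \in A); last by rewrite mulr0 sqr_ge0.
rewrite inE /A /= mulr1 => ef.
rewrite -(real_normK (num_real (f w))).
by rewrite lerXn2r// nnegrE ltW.
Qed.

Lemma cvg_probability_pointwise (f : nat -> T -> R) e : 0 < e ->
  (forall N, measurable_fun setT (f N)) -> (forall w, f N w @[N --> \oo] --> (0 : R)) ->
  P [set w | (e <= `|f N w|)%R] @[N --> \oo] --> 0%E.
Proof.
move=> e0 mf cf; set A := fun N => [set w | e <= `|f N w|].
have mA N : measurable (A N) by exact: measurable_dev.
rewrite (_ : (fun N => _) = (fun N => \int[P]_w (\1_(A N) w)%:E)%E); last first.
  by apply/funext => N; rewrite integral_indic//= setIT.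
rewrite -(integral0 P setT).
apply: (@dominated_cvg _ _ _ P _ _ (fun N w => (\1_(A N) w)%:E) _ (cst 1%:E)) => //.
- by move=> N; apply/measurable_EFinP; exact: measurable_indic.
- move=> w _; have /cvgrPdist_lt /(_ e e0) h := cf w.
  apply: cvg_near_cst; apply: filterS h => N.
  rewrite sub0r normrN indicE ltNge => ef.
  by rewrite (_ : (w \in A N) = false)//; apply/negbTE; rewrite notin_setE; exact/negP.
- exact: finite_measure_integrable_cst.
- by move=> N w _ /=; rewrite lee_fin indicE; case: (_ \in _); rewrite ?normr1 ?normr0.
Qed.

End ConvergenceInProbability.

Section GbmSolution.
Context {R : realType} {d : measure_display} {T : measurableType d}.
Variables (P : probability T R) (W : R -> T -> R).
Hypothesis hW : brownian_motion P W.
Local Notation mu := lebesgue_measure.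

Lemma gbm_within_continuous nu c w : {within `[0, +oo[, continuous (fun t => gbm W nu c t w)}.
Proof.
have [_ _ cW _ _] := hW.
apply/subspace_continuousP => x x0.
apply: (cvg_comp _ expR); last exact: continuous_expR.
apply: cvgD; apply: cvgMr.
  by apply: cvg_within_filter; exact: cvg_id.
apply: cvgB; last exact: cvg_cst.
by have /subspace_continuousP := cW w; exact.
Qed.

Section ItoSum.
Variables (nu c t : R).
Hypothesis t0 : 0 < t.
Local Notation Y := (gbm W nu c).
Local Notation D s t w := (ito_rem nu c (t - s) (W t w - W s w)).
Let a N i w := Y (node t N i) w * D (node t N i) (node t N i.+1) w.

(** There are N + 1 diagonal terms of order dt^2 and about N^2 cross terms of order dt^3, with dt =
    t / (N + 1). *)
Lemma ito_sum_L2 : exists C : R, forall N,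
  exists2 v, hasE P (fun w => (\sum_(i < N.+1) a N i w) ^+ 2) v & v <= C / N.+1%:R.
Proof.
have [K [K0 [Kd Kc]]] := ito_products hW nu c t.
exists (K * t ^+ 2 + K * t ^+ 3) => N.
set dt := t / N.+1%:R.
have dt0 : 0 < dt by rewrite divr_gt0.
have n0 i : 0 <= node t N i by rewrite node_ge0// ltW.
have nt (i : 'I_N.+1) : node t N i.+1 <= t.
  by rewrite -{2}(node_last t N) node_le// ltW.
(* The cross bound is added on the diagonal too, which makes every row sum the same. *)
pose bd (i j : 'I_N.+1) : R := (i == j)%:R * (K * dt ^+ 2) + K * dt ^+ 3.
have H (i j : 'I_N.+1) : {v : R | hasE P (fun w => a N i w * a N j w) v & v <= bd i j}.
  apply: cid2; rewrite /bd.
  have K3 : 0 <= K * dt ^+ 3 by apply: mulr_ge0 => //; apply: exprn_ge0; exact: ltW.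
  case: (ltngtP i j) => [ij|ji|/val_inj ij].
  - have [v Ev vle] := Kc _ _ _ _ dt (n0 i) dt0 (nodeS t N i)
      (node_le N (ltW t0) ij) (nodeS t N j) (nt j).
    exists v => //; apply: (le_trans vle); rewrite lerDr.
    by rewrite mulr_ge0// mulr_ge0// sqr_ge0.
  - have [v Ev vle] := Kc _ _ _ _ dt (n0 j) dt0 (nodeS t N j)
      (node_le N (ltW t0) ji) (nodeS t N i) (nt i).
    exists v; first by apply: hasE_eq Ev => w; exact: mulrC.
    apply: (le_trans vle); rewrite lerDr.
    by rewrite mulr_ge0// mulr_ge0// sqr_ge0.
  - have [v Ev vle] := Kd _ _ dt (n0 i) dt0 (nodeS t N i) (nt i).
    exists v; first by apply: hasE_eq Ev => w; rewrite -ij expr2.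
    by apply: (le_trans vle); rewrite ij eqxx mul1r lerDl.
pose V (i j : 'I_N.+1) : R := s2val (H i j).
have HV (i j : 'I_N.+1) : hasE P (fun w => a N i w * a N j w) (V i j) by rewrite /V; case: (H i j).
have Vb i j : V i j <= bd i j by rewrite /V; case: (H i j).
exists (\sum_(i < N.+1) \sum_(j < N.+1) V i j).
  apply: hasE_eq (hasE_sum _ (fun i => hasE_sum _ (HV i))) => w.
  by rewrite expr2 big_distrlr.
apply: (@le_trans _ _ (\sum_(i < N.+1) \sum_(j < N.+1) bd i j)).
  by apply: ler_sum => i _; apply: ler_sum.
rewrite (_ : \sum_i _ = \sum_(i < N.+1) (K * dt ^+ 2 + N.+1%:R * (K * dt ^+ 3))); last first.
  apply: eq_bigr => i _; rewrite big_split/= (bigD1 i)//= eqxx mul1r big1 ?addr0.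
    by rewrite sumr_const card_ord mulr_natl.
  by move=> j ji; rewrite eq_sym (negbTE ji) mul0r.
rewrite sumr_const card_ord -mulr_natl /dt !exprMn.
have N0 : N.+1%:R != 0 :> R by rewrite pnatr_eq0.
set M : R := N.+1%:R in N0 *.
by rewrite le_eqVlt; apply/orP; left; apply/eqP; field.
Qed.

End ItoSum.

Section Solution.
Variables (b sg x : R).
Local Notation nu := (b - sg ^+ 2).
Local Notation c := (Num.sqrt 2 * sg).
Local Notation X t w := (x * gbm W nu c t w).

Let bbE : nu + c ^+ 2 / 2 = b.
Proof. by rewrite exprMn sqr_sqrtr//; field. Qed.

Lemma gbm0 w : gbm W nu c 0 w = 1.
Proof. by rewrite /gbm subrr !mulr0 addr0 expR0. Qed.

Lemma gbm_adapted : adapted W (fun t w => X t w).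
Proof.
move=> t t0; rewrite /natural_filtration; set G := \bigcup_(s in _) _.
have mW s : 0 <= s -> s <= t ->
    measurable_fun (setT : set (g_sigma_algebraType G)) (W s : g_sigma_algebraType G -> R).
  move=> s0 st _ B mB; rewrite setTI; apply: sub_sigma_algebra.
  by exists s; [rewrite /= in_itv/= s0|exists B => //; rewrite setTI].
have mX : measurable_fun (setT : set (g_sigma_algebraType G))
    ((fun w => X t w) : g_sigma_algebraType G -> R).
  apply: measurable_funM => //; apply: measurableT_comp => //.
  apply: measurable_funD => //; apply: measurable_funM => //.
  by apply: measurable_funB; exact: mW.
by move=> _ [B mB <-]; exact: mX.
Qed.

(** Over each step the increment of X is its drift part, its diffusion part and the current value
    times the remainder. Telescoping leaves -x S_N - Q_N as the error of the Ito sums: S_N tends to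
    0 in L^2, and Q_N, the error of a Riemann sum, tends to 0 along each path. *)
Lemma gbm_ito t : 0 <= t ->
  is_ito_integral P W (fun s w => Num.sqrt 2 * sg * X s w) t
    (fun w => X t w - x - \int[mu]_(s in `[0, t]) (b * X s w)).
Proof.
rewrite le_eqVlt => /predU1P[<-|t0].
  move=> e e0; apply: cvg_near_cst; apply: nearW => N.
  rewrite (_ : [set w | _] = set0) ?measure0// -subset0 => w /=.
  rewrite big1; last by move=> i _; rewrite !mul0r subrr mulr0.
  rewrite gbm0 mulr1 subrr set_itv1 Rintegral_set1 subrr subrr normr0.
  by rewrite leNgt e0.
move=> e e0.
set S := fun N w => \sum_(i < N.+1) gbm W nu c (node t N i) w *
  ito_rem nu c (node t N i.+1 - node t N i) (W (node t N i.+1) w - W (node t N i) w).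
have cX w : {within `[0, t], continuous (fun s => b * X s w)}.
  have cX0 : {within `[0, +oo[, continuous (fun s => b * X s w)}.
    apply/subspace_continuousP => s s0; apply: cvgMr; apply: cvgMr.
    by have /subspace_continuousP := @gbm_within_continuous nu c w; exact.
  apply: continuous_subspaceW cX0 => s /=.
  by rewrite !in_itv/= => /andP[->].
set Q := fun N w => \sum_(i < N.+1) (b * X (node t N i) w) * (t / N.+1%:R)
  - \int[mu]_(s in `[0, t]) (b * X s w).
have Q0 w : Q N w @[N --> \oo] --> (0 : R).
  by apply/subr_cvg0; exact: (riemann_sum_cvg t0 (cX w)).
have n0 N i : 0 <= node t N i by rewrite node_ge0// ltW.
have mS N : measurable_fun setT (S N).
  apply: measurable_sum => i; apply: measurable_funM.
    by apply: (gbm_meas hW); exact: n0.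
  by apply: (ito_rem_meas hW); exact: n0.
have mR N : measurable_fun setT
    (fun w => \sum_(i < N.+1) (b * X (node t N i) w) * (t / N.+1%:R)).
  apply: measurable_sum => i; apply: measurable_funM => //.
  by do 2 apply: measurable_funM => //; apply: (gbm_meas hW); exact: n0.
have mQ N : measurable_fun setT (Q N).
  apply: measurable_funB => //.
  by apply: (measurable_fun_cvg mR) => w _; exact: riemann_sum_cvg t0 (cX w).
have decomp N w : \sum_(i < N.+1) (c * X (node t N i) w *
    (W (node t N i.+1) w - W (node t N i) w)) -
    (X t w - x - \int[mu]_(s in `[0, t]) (b * X s w)) = - x * S N w - Q N w.
  have tel : X t w - x = \sum_(i < N.+1) (X (node t N i.+1) w - X (node t N i) w).
    rewrite -(big_mkord xpredT (fun i => X (node t N i.+1) w - X (node t N i) w)).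
    rewrite telescope_sumr// node_last /node mulr0 mul0r.
    by rewrite gbm0 mulr1.
  have aux (p1 p2 p3 p4 q : R) : p1 - p2 = p3 - p4 -> p1 - (p2 - q) = p3 - (p4 - q).
    by lra.
  rewrite tel; apply: aux; rewrite /S mulr_sumr.
  rewrite -!sumrB; apply: eq_bigr => i _.
  rewrite -(nodeS t N i) /ito_rem bbE.
  have -> : gbm W nu c (node t N i.+1) w = gbm W nu c (node t N i) w *
      expR (nu * (node t N i.+1 - node t N i) + c * (W (node t N i.+1) w - W (node t N i) w)).
    by rewrite /gbm -expRD; congr expR; ring.
  by ring.
have [C HC] := ito_sum_L2 nu c t0.
pose e2 := e / 2; have e20 : 0 < e2 by rewrite /e2 divr_gt0.
have bnd N : (P [set w | (e <= `|- x * S N w - Q N w|)%R] <=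
   (x ^+ 2 * C / e2 ^+ 2 / N.+1%:R)%:E + P [set w | (e2 <= `|Q N w|)%R])%E.
  have mD f : measurable_fun setT f -> forall e, measurable [set w : T | e <= `|f w : R|].
    by move=> mf e'; exact: measurable_dev.
  have mxS : measurable_fun setT (fun w => - x * S N w) by exact: measurable_funM.
  apply: (@le_trans _ _ (P ([set w | (e2 <= `|- x * S N w|)%R] `|` [set w | (e2 <= `|Q N w|)%R]))).
    apply: le_measure; rewrite ?inE.
    - by apply: mD; exact: measurable_funB.
    - by apply: measurableU; exact: mD.
    move=> w /= ew.
    have [h|h] := leP e2 `|Q N w|; [by right|left].
    by have := ler_normB (- x * S N w) (Q N w); rewrite /e2 in h *; lra.
  apply: (le_trans (measureU2 _ (mD _ mxS _) (mD _ (mQ N) _))).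
  rewrite leeD2r//.
  have [v Ev vle] := HC N.
  have Ex : hasE P (fun w => (- x * S N w) ^+ 2) (x ^+ 2 * v).
    by apply: hasE_eq (hasE_scale (x ^+ 2) Ev) => w; rewrite exprMn sqrrN.
  apply: (le_trans (markov_sqr e20 mxS Ex)).
  rewrite lee_fin [leRHS]mulrAC ler_pM2r ?invr_gt0 ?exprn_gt0//.
  by rewrite -[leRHS]mulrA ler_wpM2l ?sqr_ge0.
rewrite (_ : (fun N => _) = (fun N => P [set w | (e <= `|- x * S N w - Q N w|)%R])); last first.
  apply/funext => N; congr (P _); apply/seteqP; split => w /=; by rewrite -decomp.
apply: (@squeeze_cvge _ _ _ _ (cst 0%E) _
  (fun N => (x ^+ 2 * C / e2 ^+ 2 / N.+1%:R)%:E + P [set w | (e2 <= `|Q N w|)%R])%E).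
- by apply: nearW => N; apply/andP; split; [exact: measure_ge0|exact: bnd].
- exact: cvg_cst.
rewrite -[Z in _ --> Z]adde0; apply: cvgeD => //.
  by apply: cvg_EFin; [exact: nearW|exact: inv_natS_cvg].
exact: cvg_probability_pointwise.
Qed.

Lemma gbm_is_solution : 0 < x -> gbm_solution P b sg W x (fun t w => X t w).
Proof.
move=> x0; split.
- exact: gbm_adapted.
- move=> w; apply/subspace_continuousP => s s0; apply: cvgMr.
  by have /subspace_continuousP := @gbm_within_continuous nu c w; exact.
- by move=> t w _; rewrite mulr_gt0// expR_gt0.
- by apply: aeW => w; rewrite gbm0 mulr1.
- exact: gbm_ito.
Qed.

End Solution.
End GbmSolution.

(** * Integrability of the weighted payoff *)

Lemma nondecreasing_measurable {R : realType} (f : R -> R) :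
  {homo f : x y / x <= y} -> measurable_fun setT f.
Proof.
move=> ndf; apply: (measurability (@RGenOInfty.G R)); first exact: RGenOInfty.measurableE.
move=> _ [_ [x ->] <-]; rewrite setTI; apply: is_interval_measurable.
move=> a b /= ; rewrite !in_itv/= !andbT => fa fb z /andP[az _].
by rewrite in_itv/= andbT (lt_le_trans fa)// ndf.
Qed.

Section JointMeasurability.
Context {R : realType} {d : measure_display} {T : measurableType d}.
Variable V : R -> T -> R.
Hypothesis mV : forall t, 0 <= t -> measurable_fun setT (V t).
Hypothesis cV : forall w, {within `[0, +oo[, continuous (fun t => V t w)}.

(** By continuity of the paths the process is the limit of its values at the grid time just below t,
    and these approximations are countable gluings of sections at fixed times. The maximum with 0
    extends the process to all of R. *)
Lemma joint_measurable :
  measurable_fun setT (fun z : T * R => V (Num.max z.2 0) z.1).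
Proof.
pose k n (t : R) := Num.truncn (Num.max t 0 * n.+1%:R).
pose Vn n (z : T * R) := V ((k n z.2)%:R / n.+1%:R) z.1.
have max0 (t : R) : 0 <= Num.max t 0 by rewrite le_max lexx orbT.
apply: (@measurable_fun_cvg _ _ _ _ Vn).
  move=> n _ B mB; rewrite setTI.
  have -> : Vn n @^-1` B =
      \bigcup_j ((fun z : T * R => V (j%:R / n.+1%:R) z.1) @^-1` B `&`
        (fun z : T * R => Num.max z.2 0 * n.+1%:R) @^-1` `[j%:R, j.+1%:R[).
    apply/seteqP; split => [z Bz|z [j _ /= [Bz]]].
      exists (k n z.2) => //; split => //=.
      by rewrite in_itv/=; apply: Num.Theory.truncn_itv; rewrite mulr_ge0.
    rewrite in_itv/= -Num.Theory.truncn_eq ?mulr_ge0// => /eqP kj.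
    by rewrite /Vn /= /k kj.
  apply: bigcup_measurable => j _; apply: measurableI.
    rewrite -[X in measurable X]setTI.
    have mj : measurable_fun setT (V (j%:R / n.+1%:R)) by apply: mV; rewrite divr_ge0.
    exact: (measurableT_comp mj (@measurable_fst _ _ T (measurableTypeR R))).
  rewrite -[X in measurable X]setTI.
  have m2 : measurable_fun setT (fun z : T * R => Num.max z.2 0 * n.+1%:R).
    apply: measurable_funM => //; apply: measurable_maxr => //.
  by apply: m2 => //; exact: measurable_itv.
move=> [w t] _ /=; rewrite /Vn /=; set s := Num.max t 0.
apply/cvgrPdist_lt => e e0.
have /subspace_continuousP /(_ s) := @cV w.
rewrite /= in_itv/= max0 => /(_ isT) /cvgrPdist_lt /(_ e e0).
rewrite near_withinE /= => -[dl /= dl0 Hd].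
have := inv_natS_cvg (1 : R) => /cvgrPdist_lt /(_ dl dl0); apply: filterS => N.
rewrite sub0r normrN ger0_norm// => Ndl.
have N0 : 0 < N.+1%:R :> R by rewrite ltr0n.
have s0 : 0 <= s * N.+1%:R by rewrite mulr_ge0 ?max0.
have /andP[k1 k2] := Num.Theory.truncn_itv s0.
rewrite -/(k N t) in k1 k2.
apply: Hd => /=; last by rewrite in_itv/= andbT divr_ge0.
have h1 : (k N t)%:R / N.+1%:R <= s by rewrite ler_pdivrMr.
rewrite ger0_norm ?subr_ge0//; apply: le_lt_trans Ndl.
by rewrite lerBlDr -mulrDl addrC natr1 ler_pdivlMr// ltW.
Qed.

End JointMeasurability.

(** * Discounted occupation of unit windows by drifted Brownian motion *)

Section Occupation.
Context {R : realType}.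
Variables (nu c r : R).
Hypotheses (c0 : c != 0) (r0 : 0 < r).
Local Notation mu := lebesgue_measure.

Definition green_disc : R := Num.sqrt (nu ^+ 2 + 2 * r * c ^+ 2).
Local Notation q := green_disc.
(** The positive root p of c^2 p^2 / 2 + nu p = r: the rate at which the discounted occupation
    density of nu t + c W_t decays at +oo. *)
Definition green_rate : R := (q - nu) / c ^+ 2.
Local Notation p := green_rate.

Lemma sqr_c_gt0 : 0 < c ^+ 2. Proof. by rewrite exprn_even_gt0. Qed.

Lemma green_disc_sqr : q ^+ 2 = nu ^+ 2 + 2 * r * c ^+ 2.
Proof.
rewrite sqr_sqrtr//; apply: addr_ge0; first exact: sqr_ge0.
by apply: mulr_ge0; [apply: mulr_ge0 => //; exact: ltW|exact: sqr_ge0].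
Qed.

Lemma green_disc_gt : `|nu| < q.
Proof.
rewrite -sqrtr_sqr ltr_sqrt; last first.
  by rewrite ltr_wpDl ?sqr_ge0// mulr_gt0 ?sqr_c_gt0// mulr_gt0.
by rewrite ltrDl mulr_gt0 ?sqr_c_gt0// mulr_gt0.
Qed.

Lemma green_disc_gt0 : 0 < q.
Proof. exact: le_lt_trans green_disc_gt. Qed.

Lemma green_rate_gt0 : 0 < p.
Proof.
by rewrite divr_gt0 ?sqr_c_gt0// subr_gt0 (le_lt_trans (ler_norm _))// green_disc_gt.
Qed.

Lemma normal_window (a b : R) : a <= b ->
  mu [set z | a <= c * z < b] = ((b - a) / `|c|)%:E.
Proof.
move=> ab; have cn : 0 < `|c| by rewrite normr_gt0.
have [cp|cn'|/eqP] := ltgtP 0 c; last by rewrite eq_sym (negbTE c0).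
  rewrite (_ : [set z | _] = `[a / c, b / c[%classic).
    rewrite lebesgue_measure_itv/= lte_fin ltr_pM2r ?invr_gt0//.
    rewrite gtr0_norm// -EFinB -mulrBl; case: ltP => // ba.
    by rewrite (_ : b = a) ?subrr ?mul0r//; lra.
  apply/seteqP; split => z /=; rewrite in_itv/= ler_pdivrMr// ltr_pdivlMr// mulrC.
    by [].
  by [].
rewrite (_ : [set z | _] = `]b / c, a / c]%classic).
  rewrite lebesgue_measure_itv/= lte_fin ltr_nM2r ?invr_lt0//.
  rewrite ltr0_norm// -EFinB -mulrBl invrN mulrN -mulNr opprB; case: ltP => // ba.
  by rewrite (_ : b = a) ?subrr ?mul0r//; lra.
by apply/seteqP; split => z /=; rewrite in_itv/= ltr_ndivrMr// ler_ndivlMr// mulrC andbC.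
Qed.

(** The most favourable time for the height k: by the identity stated below, the exponential part of
    the discounted density at y is largest when q t = y. *)
Definition occ_time (k : nat) : R := k%:R / q.
(** One factor for each loss: exp(-p) for the unit width of the window, the second exponential for
    |y - q t| <= (sqrt q + q) sqrt t, 1 + sqrt q for t <= (1 + sqrt q) k / q, and |c| for the length
    of the window in the normal variable. *)
Definition occ_const : R := expR (- p) * expR (- ((Num.sqrt q + q) ^+ 2 / (2 * c ^+ 2))) /
  (`|c| * Num.sqrt ((1 + Num.sqrt q) * (pi *+ 2))).

Lemma occ_const_gt0 : 0 < occ_const.
Proof.
apply: divr_gt0; first by rewrite mulr_gt0 ?expR_gt0.
apply: mulr_gt0; first by rewrite normr_gt0.
rewrite sqrtr_gt0; apply: mulr_gt0; first by have := sqrtr_ge0 q; lra.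
by rewrite mulrn_wgt0// pi_gt0.
Qed.

(* (y - nu t)^2 / (2 c^2 t) + r t = (y - q t)^2 / (2 c^2 t) + p y, so the
   discounted density of nu t + c W_t at y is of order exp(-p y) / sqrt t while
   |y - q t| is of order sqrt t. *)
Lemma normal_occupation (k : nat) (t : R) : (0 < k)%N ->
  occ_time k <= t -> t <= occ_time k + Num.sqrt (occ_time k) ->
  ((occ_const * expR (- (p * k%:R)) / Num.sqrt (occ_time k))%:E <=
   (expR (- (r * t)))%:E *
   normal_prob 0 (Num.sqrt t) [set z | (k%:R <= nu * t + c * z < k.+1%:R)%R])%E.
Proof.
move=> k0 tk1 tk2; set tk := occ_time k in tk1 tk2 *.
have q0 := green_disc_gt0.
have k1 : 1 <= k%:R :> R by rewrite (ler_nat R 1 k).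
have tkq : 1 <= tk * q by rewrite /tk /occ_time divfK// gt_eqF.
have tk0 : 0 < tk by rewrite divr_gt0//; lra.
have t0 : 0 < t by lra.
have st0 : 0 < Num.sqrt t by rewrite sqrtr_gt0.
have sq2 : Num.sqrt q ^+ 2 = q by rewrite sqr_sqrtr// ltW.
have stk2 : Num.sqrt tk ^+ 2 = tk by rewrite sqr_sqrtr// ltW.
have stt2 : Num.sqrt t ^+ 2 = t by rewrite sqr_sqrtr// ltW.
have stk0 : 0 < Num.sqrt tk by rewrite sqrtr_gt0.
have sqq0 : 0 < Num.sqrt q by rewrite sqrtr_gt0.
have stt : Num.sqrt tk <= Num.sqrt t by rewrite ler_wsqrtr.
(* Here k >= 1 matters: q tk = k, so the width 1 of the window is at most sqrt (q tk). *)
have one_le : 1 <= Num.sqrt q * Num.sqrt tk.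
  by rewrite -(sqrtrM _ (ltW q0)) -[leLHS]sqrtr1 ler_wsqrtr// mulrC.
have tle : t <= tk * (1 + Num.sqrt q).
  apply: (le_trans tk2); rewrite mulrDr mulr1 lerD2l.
  by rewrite -{2}stk2 expr2 -mulrA ler_peMr// mulrC.
set B := [set z | _].
have BE : B = [set z | k%:R - nu * t <= c * z < k.+1%:R - nu * t].
  by apply/seteqP; split => z /=; rewrite lerBlDl ltrBrDl.
have mB : measurable B.
  have mf : measurable_fun setT (fun z : R => nu * t + c * z).
    by apply: measurable_funD => //; exact: measurable_funM.
  have -> : B = setT `&` (fun z : R => nu * t + c * z) @^-1` `[k%:R, k.+1%:R[.
    by rewrite setTI; apply/seteqP; split => z /=; rewrite in_itv.
  by apply: mf => //; exact: measurable_itv.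
pose lb := expR (- p) * expR (- ((Num.sqrt q + q) ^+ 2 / (2 * c ^+ 2))) *
  expR (- (p * k%:R)) / (Num.sqrt tk * Num.sqrt ((1 + Num.sqrt q) * (pi *+ 2))).
have D0 : 0 < Num.sqrt ((1 + Num.sqrt q) * (pi *+ 2)).
  rewrite sqrtr_gt0; apply: mulr_gt0; first by lra.
  by rewrite mulrn_wgt0// pi_gt0.
rewrite /normal_prob -ge0_integralZl//=; last 2 first.
- by apply/measurable_EFinP; apply: measurable_funTS; exact: measurable_normal_pdf.
- by move=> z _; rewrite lee_fin normal_pdf_ge0.
apply: (@le_trans _ _ (\int[mu]_(z in B) (cst lb%:E z))%E).
  rewrite integral_cst// BE [X in (_ * X)%E](_ : _ =
    ((k.+1%:R - nu * t - (k%:R - nu * t)) / `|c|)%:E); last first.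
    by apply: normal_window; rewrite lerB// ler_nat.
  rewrite -EFinM lee_fin le_eqVlt; apply/orP; left; apply/eqP.
  rewrite opprB addrA subrK -natr1 addrAC subrr add0r /lb /occ_const.
  by field; rewrite ?(gt_eqF stk0) ?(gt_eqF D0) normr_eq0 c0.
apply: ge0_le_integral => //=.
- by move=> z _; rewrite lee_fin /lb; apply: divr_ge0; rewrite ?mulr_ge0 ?expR_ge0 ?sqrtr_ge0.
- apply/measurable_EFinP; apply: measurable_funM => //.
  by apply: measurable_funTS; exact: measurable_normal_pdf.
move=> z; rewrite /B /= => /andP[y1 y2]; set y := nu * t + c * z in y1 y2.
rewrite lee_fin normal_pdfE ?gt_eqF//= /normal_peak /normal_fun subr0 stt2.
rewrite [leRHS]mulrCA -expRD.
have zE : z = (y - nu * t) / c by rewrite /y; field.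
have -> : - (r * t) + - z ^+ 2 / (t *+ 2) =
    - (p * y) - (y - q * t) ^+ 2 / (2 * c ^+ 2 * t).
  have e : r = (q ^+ 2 - nu ^+ 2) / (2 * c ^+ 2) by rewrite green_disc_sqr; field.
  by rewrite zE e /p -[t *+ 2]mulr_natl; field; rewrite c0 gt_eqF.
have pdfle : (Num.sqrt tk * Num.sqrt ((1 + Num.sqrt q) * (pi *+ 2)))^-1 <=
    (Num.sqrt (t * pi *+ 2))^-1.
  rewrite lef_pV2 ?posrE ?mulr_gt0//; last first.
    by rewrite sqrtr_gt0 mulrn_wgt0// mulr_gt0// pi_gt0.
  rewrite -(sqrtrM _ (ltW tk0)) ler_wsqrtr// -mulrnAr mulrA ler_wpM2r//.
  by rewrite mulrn_wge0// pi_ge0.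
rewrite /lb mulrC; apply: ler_pM; [|by rewrite !mulr_ge0 ?expR_ge0|exact: pdfle|].
  by rewrite invr_ge0; apply: mulr_ge0; exact: sqrtr_ge0.
rewrite -!expRD ler_expR.
have p0 := green_rate_gt0.
have h1 : p * y <= p * k%:R + p.
  by rewrite -[X in _ + X]mulr1 -mulrDr natr1 ler_wpM2l// ltW.
have h2 : (y - q * t) ^+ 2 / (2 * c ^+ 2 * t) <= (Num.sqrt q + q) ^+ 2 / (2 * c ^+ 2).
  rewrite invfM mulrA mulrAC ler_wpM2r//.
    by rewrite invr_ge0 mulr_ge0// sqr_ge0.
  rewrite ler_pdivrMr// -{2}stt2 -exprMn -(real_normK (num_real (y - _))).
  have n1 : 0 <= (Num.sqrt q + q) * Num.sqrt t.
    by apply: mulr_ge0; [apply: addr_ge0; exact: ltW|exact: ltW].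
  rewrite lerXn2r ?nnegrE//.
  have kq : k%:R = q * tk by rewrite /tk /occ_time mulrC divfK// gt_eqF.
  have -> : y - q * t = (y - k%:R) - q * (t - tk) by rewrite kq; ring.
  apply: (le_trans (ler_normB _ _)).
  rewrite (ger0_norm (_ : 0 <= y - k%:R)) ?subr_ge0//.
  rewrite (ger0_norm (_ : 0 <= q * (t - tk))); last by rewrite mulr_ge0 ?subr_ge0// ltW.
  rewrite mulrDl; apply: lerD.
    have : y - k%:R <= 1 by move: y2; rewrite -natr1; lra.
    have : Num.sqrt q * Num.sqrt tk <= Num.sqrt q * Num.sqrt t by rewrite ler_wpM2l// ltW.
    lra.
  by apply: ler_wpM2l; [exact: ltW|lra].
lra.
Qed.

End Occupation.

Section GreenSum.
Context {R : realType} {d : measure_display} {T : measurableType d}.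
Variables (P : probability T R) (W : R -> T -> R).
Hypothesis hW : brownian_motion P W.
Local Notation mu := lebesgue_measure.
Variables (nu c r : R).
Hypotheses (c0 : c != 0) (r0 : 0 < r).
Local Notation L t w := (nu * t + c * (W t w - W 0 w)).
Local Notation p := (green_rate nu c r).

(** At most one window contains y. The bound is truncated at the end of the last window so that the
    induction can add the next one. *)
Lemma sum_windows_le (phi : R -> R) (K : nat) y :
  {homo phi : x y / x <= y} -> (forall x, 0 <= phi x) ->
  \sum_(k < K) phi k.+1%:R * \1_(`[k.+1%:R, k.+2%:R[%classic : set R) y <=
  (if y < K.+1%:R then phi y else 0).
Proof.
move=> ndphi phi0; elim: K => [|K ih].
  by rewrite big_ord0; case: ifP.
rewrite big_ord_recr /= indicE.
have lt1 : K.+1%:R < K.+2%:R :> R by rewrite ltr_nat.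
have memE : (y \in (`[K.+1%:R, K.+2%:R[%classic : set R)) = (K.+1%:R <= y) && (y < K.+2%:R).
  by apply/idP/idP; rewrite inE /= in_itv.
rewrite memE; move: ih; case: (ltP y K.+1%:R) => [yK|Ky] ih /=.
  by rewrite mulr0 addr0 (lt_trans yK lt1).
case: (ltP y K.+2%:R) => yK; last by rewrite mulr0 addr0.
by rewrite mulr1 -[leRHS]add0r lerD// ndphi.
Qed.

(** At a time in [J k] the path is in its window with a discounted probability bounded below by
    [normal_occupation], and the length of [J k] cancels the square root in that bound. The
    intervals [J k] may overlap in time, but the windows are disjoint in space, so along each path
    the sum stays below |psi|; exchanging the integrals then compares it with the given
    expectation. *)
Lemma green_sum_bound (phi psi : R -> R) :
  {homo phi : x y / x <= y} -> (forall x, 0 <= phi x) ->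
  measurable_fun setT psi -> (forall x, phi x <= `|psi x|) ->
  (\int[P]_w \int[mu]_(t in `[0%R, +oo[) (expR (- (r * t)) * `|psi (L t w)|)%:E < +oo)%E ->
  exists M : R, forall K, \sum_(k < K) phi k.+1%:R * expR (- (p * k.+1%:R)) <= M.
Proof.
move=> ndphi phi0 mpsi phipsi fin.
pose V t w := L t w.
have mV t : 0 <= t -> measurable_fun setT (V t).
  move=> t0; apply: measurable_funD => //; apply: measurable_funM => //.
  exact: (inc_meas hW (lexx 0) t0).
have cV w : {within `[0, +oo[, continuous (fun t => V t w)}.
  have [_ _ cW _ _] := hW.
  apply/subspace_continuousP => x x0; apply: cvgD; apply: cvgMr.
    by apply: cvg_within_filter; exact: cvg_id.
  apply: cvgB; last exact: cvg_cst.
  by have /subspace_continuousP := cW w; exact.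
have mVp := joint_measurable mV cV.
pose f (z : T * R) : R := \1_(`[0, +oo[%classic : set R) z.2 * (expR (- (r * z.2)) *
  `|psi (V (Num.max z.2 0) z.1)|).
have f0 z : 0 <= f z by rewrite !mulr_ge0// expR_ge0.
have mf : measurable_fun setT (EFin \o f).
  apply/measurable_EFinP; apply: measurable_funM.
    have mi : measurable_fun setT (\1_(`[0, +oo[%classic : set R) : R -> R).
      by apply: measurable_indic; exact: measurable_itv.
    exact: (measurableT_comp mi (@measurable_snd _ _ T (measurableTypeR R))).
  apply: measurable_funM.
    apply: measurableT_comp => //; apply: measurableT_comp => //.
    by apply: measurable_funM => //.
  by apply: measurableT_comp => //; apply: measurableT_comp.
have finE : (\int[P]_w \int[mu]_(t in `[0%R, +oo[) (expR (- (r * t)) * `|psi (L t w)|)%:E =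
    \int[P]_w \int[mu]_t (f (w, t))%:E)%E.
  apply: eq_integral => w _; rewrite [LHS]integral_mkcond; apply: eq_integral => t _.
  rewrite patchE /f /= indicE.
  case: ifPn => t0; last by rewrite mul0r.
  rewrite mul1r; move: t0; rewrite inE /= in_itv/= andbT => t0.
  by rewrite max_l.
have swap := fubini_tonelli (m1 := P) (m2 := mu) (EFin \o f) mf (fun z => f0 z).
rewrite finE {finE} /= swap in fin.
set I := (\int[mu]_y _)%E in fin.
have I0 : (0 <= I)%E.
  by apply: integral_ge0 => t _; apply: integral_ge0 => w _; rewrite lee_fin.
have oc0 := occ_const_gt0 nu r c0.
exists ((occ_const nu c r)^-1 * fine I) => K.
rewrite ler_pdivlMl// -lee_fin fineK; last by rewrite ge0_fin_numE.
pose tk k := occ_time nu c r k.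
pose J k : set R := `[tk k.+1, tk k.+1 + Num.sqrt (tk k.+1)]%classic.
pose m k := phi k.+1%:R * (occ_const nu c r * expR (- (p * k.+1%:R)) / Num.sqrt (tk k.+1)).
have tk0 k : 0 < tk k.+1 by rewrite divr_gt0// green_disc_gt0.
have m0 k : 0 <= m k.
  apply: mulr_ge0 => //; apply: divr_ge0; last exact: sqrtr_ge0.
  by apply: mulr_ge0; [exact: ltW|exact: expR_ge0].
have mJ k : measurable (J k) by exact: measurable_itv.
have -> : ((occ_const nu c r * \sum_(k < K) phi k.+1%:R * expR (- (p * k.+1%:R)))%:E =
    \int[mu]_t (\sum_(k < K) (m k)%:E * (\1_(J k) t)%:E))%E.
  rewrite ge0_integral_sum//=; last 2 first.
  - by move=> k; apply: emeasurable_funM => //; apply/measurable_EFinP; exact: measurable_indic (mJ _).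
  - by move=> k t _; rewrite -EFinM lee_fin mulr_ge0.
  rewrite mulr_sumr -sumEFin; apply: eq_bigr => k _.
  rewrite ge0_integralZl//=; [|by apply/measurable_EFinP; exact: measurable_indic (mJ _)|by rewrite lee_fin].
  rewrite (integral_indic mu measurableT (mJ k)) setIT /J /= lebesgue_measure_itv/= lte_fin ltrDl sqrtr_gt0 tk0.
  rewrite -EFinD addrC addKr -EFinM /m; congr EFin.
  have := tk0 k; rewrite -sqrtr_gt0 => /gt_eqF/negbT s0.
  by field.
apply: ge0_le_integral => //=.
- by move=> t _; apply: sume_ge0 => k _; rewrite -EFinM lee_fin mulr_ge0.
- apply: emeasurable_sum => k; apply: emeasurable_funM => //.
  by apply/measurable_EFinP; exact: measurable_indic (mJ _).
- exact: (measurable_fun_fubini_tonelli_G (m1 := P) (EFin \o f) mf (fun z => f0 z)).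
move=> t _.
have [tneg|t0] := leP t 0.
  rewrite big1; first by apply: integral_ge0 => w _; rewrite lee_fin.
  move=> k _; rewrite indicE (_ : (t \in J k) = false) ?mule0//.
  apply/negbTE; rewrite notin_setE /J /= in_itv/= => /andP[h _].
  by have := tk0 k; lra.
pose B k : set R := [set z | k.+1%:R <= nu * t + c * z < k.+2%:R].
have mB k : measurable (B k).
  have mfz : measurable_fun setT (fun z : R => nu * t + c * z).
    by apply: measurable_funD => //; exact: measurable_funM.
  have -> : B k = setT `&` (fun z : R => nu * t + c * z) @^-1` `[k.+1%:R, k.+2%:R[.
    by rewrite setTI; apply/seteqP; split => z /=; rewrite in_itv.
  by apply: mfz => //; exact: measurable_itv.
pose A k : set T := (fun w => W t w - W 0 w) @^-1` (B k).
have mA k : measurable (A k).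
  by rewrite -[X in measurable X]setTI; apply: (inc_meas hW (lexx 0) (ltW t0)).
have PA k : (\int[P]_w (\1_(A k) w)%:E = normal_prob 0 (Num.sqrt t) (B k))%E.
  rewrite (integral_indic P measurableT (mA k)) setIT.
  by have [_ _ _ /(_ 0 t (lexx 0) t0 _ (mB k)) + _] := hW; rewrite subr0.
pose a k : R := \1_(J k) t * (phi k.+1%:R * expR (- (r * t))).
have a0 k : 0 <= a k by rewrite !mulr_ge0// expR_ge0.
apply: (@le_trans _ _ (\int[P]_w (\sum_(k < K) (a k)%:E * (\1_(A k) w)%:E))%E).
  rewrite ge0_integral_sum//=; last 2 first.
  - by move=> k; apply: emeasurable_funM => //; apply/measurable_EFinP; exact: measurable_indic (mA _).
  - by move=> k w _; rewrite -EFinM lee_fin mulr_ge0.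
  apply: lee_sum => k _.
  rewrite ge0_integralZl//=; [|by apply/measurable_EFinP; exact: measurable_indic (mA _)|by rewrite lee_fin].
  rewrite PA /a indicE.
  have [|_] := boolP (t \in J k); last by rewrite mule0 mul0r mul0e.
  rewrite inE /J /= in_itv/= => /andP[t1 t2].
  rewrite mule1 mul1r /m !EFinM -!muleA; apply: lee_wpmul2l; first by rewrite lee_fin.
  have := @normal_occupation _ nu c r c0 r0 k.+1 t isT t1 t2.
  by rewrite !EFinM -!muleA.
apply: ge0_le_integral => //=.
- by move=> w _; apply: sume_ge0 => k _; rewrite -EFinM lee_fin mulr_ge0.
- apply: emeasurable_sum => k; apply: emeasurable_funM => //.
  by apply/measurable_EFinP; exact: measurable_indic (mA _).
- exact: (measurable_fun_pair1 t mf).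
move=> w _; under eq_bigr do rewrite -EFinM.
rewrite sumEFin lee_fin /f /= max_l ?(ltW t0)//.
rewrite indicE (_ : t \in _) ?mul1r; last by rewrite inE /= in_itv/= ltW.
apply: (@le_trans _ _ (expR (- (r * t)) * \sum_(k < K) phi k.+1%:R *
    \1_(`[k.+1%:R, k.+2%:R[%classic : set R) (V t w))).
  rewrite mulr_sumr; apply: ler_sum => k _.
  have -> : \1_(`[k.+1%:R, k.+2%:R[%classic : set R) (V t w) = \1_(A k) w :> R.
    by rewrite !indicE; congr (nat_of_bool _)%:R; apply/idP/idP; rewrite !inE /A /B /= in_itv.
  rewrite /a.
  have : \1_(J k) t <= 1 :> R by rewrite indicE; case: (_ \in _).
  have : 0 <= phi k.+1%:R * expR (- (r * t)) * \1_(A k) w by rewrite !mulr_ge0// expR_ge0.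
  set u := phi _; set v := expR _; set x := \1_(A k) w; set y := \1_(J k) t.
  have -> : v * (u * x) = u * v * x by ring.
  have -> : y * (u * v) * x = y * (u * v * x) by ring.
  by move=> h1 h2; rewrite ler_piMl.
rewrite ler_wpM2l ?expR_ge0//; apply: (le_trans (sum_windows_le K _ ndphi phi0)).
by case: ifP.
Qed.

End GreenSum.

(** * From sums over exponential shells to weighted integrals *)

Section IntegrableBigcup.
Context {R : realType}.
Local Notation mu := (@lebesgue_measure R).

Lemma integrable_bigcup_bound (F : nat -> set R) (f : R -> R) (B l : nat -> R) (M : R) :
  (forall k, measurable (F k)) -> trivIset setT F ->
  measurable_fun (\bigcup_k F k) f ->
  (forall k s, F k s -> `|f s| <= B k) -> (forall k, (mu (F k) <= (l k)%:E)%E) ->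
  (forall k, 0 <= B k) -> (forall K, \sum_(k < K) B k * l k <= M) ->
  mu.-integrable (\bigcup_k F k) (EFin \o f).
Proof.
move=> mF tF mf fB Fl B0 BM; apply/integrableP; split; first exact/measurable_EFinP.
have mfF k : measurable_fun (F k) f.
  apply: measurable_funS mf; first by apply: bigcup_measurable => j _; exact: mF.
  by move=> s Fs; exists k.
rewrite ge0_integral_bigcup//=; last first.
  by apply/measurable_EFinP; apply: measurableT_comp.
apply: (@le_lt_trans _ _ M%:E); last by rewrite ltry.
apply: lime_le; first by apply: is_cvg_ereal_nneg_natsum => k _; apply: integral_ge0 => s _;
    rewrite lee_fin.
apply: nearW => K; apply: (@le_trans _ _ (\sum_(0 <= k < K) (B k * l k)%:E)%E).
  apply: lee_sum => k _; apply: (@le_trans _ _ (\int[mu]_(s in F k) (cst (B k)%:E s))%E).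
    apply: ge0_le_integral => //=; first exact: mF.
    - by apply/measurable_EFinP; apply: measurableT_comp => //; exact: mfF.
    - by move=> s Fs; rewrite lee_fin; exact: fB Fs.
  rewrite integral_cst//=; last exact: mF.
  by rewrite EFinM; apply: lee_wpmul2l; [rewrite lee_fin|exact: Fl].
by rewrite sumEFin lee_fin big_mkord.
Qed.

Lemma geometric_sum_bound (p c : R) : 0 < p -> 0 <= c ->
  exists M : R, forall K, \sum_(k < K) c * expR (- (p * k.+1%:R)) <= M.
Proof.
move=> p0 c0; set a := expR (- p).
have a1 : a < 1 by rewrite -expR0 ltr_expR; lra.
have a0 : 0 < a by exact: expR_gt0.
exists (c * (a / (1 - a))) => K.
rewrite -mulr_sumr ler_wpM2l// ler_pdivlMr; last by lra.
rewrite (eq_bigr (fun k : 'I_K => a ^+ k.+1)); last first.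
  by move=> k _; rewrite mulrC -mulrN expRM_natl.
elim: K => [|K ih]; first by rewrite big_ord0 mul0r ltW.
have : \sum_(k < K.+1) a ^+ k.+1 * (1 - a) <= a - a ^+ K.+2.
  elim: K.+1 => [|j ihj]; first by rewrite big_ord0 expr1 subrr.
  rewrite big_ord_recr /= [a ^+ j.+2]exprS; rewrite exprS in ihj *.
  have := exprn_gt0 j a0; nra.
rewrite -mulr_suml; have := exprn_gt0 K.+2 a0; lra.
Qed.

Lemma powR_expR (x y : R) : 0 < x -> x `^ y = expR (y * ln x).
Proof. by move=> x0; rewrite /powR gt_eqF. Qed.

Lemma trivIset_shells (F : nat -> set R) (i : R -> nat) :
  (forall k s, F k s -> i s = k) -> trivIset setT F.
Proof. by move=> Fi j k _ _ [s [/Fi <- /Fi <-]]. Qed.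

Variables (p : R) (phi : R -> R) (M x : R).
Hypotheses (p0 : 0 < p) (phi0 : forall y, 0 <= phi y) (x0 : 0 < x).
Hypothesis phiM : forall K, \sum_(k < K) phi k.+1%:R * expR (- (p * k.+1%:R)) <= M.

(** On the shell from x e^k to x e^(k+1) the weight times the length is at most a constant times
    e^(-p (k+1)), so the shell contributes a multiple of one term of the sum bounded in [phiM]. *)
Lemma weight_integrable_oo (f : R -> R) : measurable_fun `[x, +oo[ f ->
  (forall k s, x * expR k%:R <= s -> s < x * expR k.+1%:R -> `|f s| <= phi k.+1%:R) ->
  mu.-integrable `[x, +oo[ (EFin \o (fun s => s `^ (- p - 1) * f s)).
Proof.
move=> mf fphi; have p1 := p0.
pose F k : set R := `[x * expR k%:R, x * expR k.+1%:R[%classic.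
have xe k : 0 < x * expR k by rewrite mulr_gt0 ?expR_gt0.
have Fi k s : F k s -> Num.truncn (ln (s / x)) = k.
  rewrite /F /= in_itv/= => /andP[s1 s2]; have s0 : 0 < s by exact: lt_le_trans s1.
  have l1 : k%:R <= ln (s / x).
    by rewrite -ler_expR lnK ?posrE ?divr_gt0// ler_pdivlMr// mulrC.
  apply/eqP; rewrite Num.Theory.truncn_eq; last exact: le_trans l1.
  by rewrite l1 -ltr_expR lnK ?posrE ?divr_gt0// ltr_pdivrMr// mulrC.
have UF : `[x, +oo[%classic = \bigcup_k F k.
  apply/seteqP; split => s /=; rewrite in_itv/= andbT.
    move=> xs; have s0 : 0 < s by exact: lt_le_trans x0 xs.
    have l0 : 0 <= ln (s / x).
      by rewrite -ln1 ler_ln ?posrE ?divr_gt0// ler_pdivlMr// mul1r.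
    have /andP[k1 k2] := Num.Theory.truncn_itv l0.
    exists (Num.truncn (ln (s / x))) => //; rewrite /F /= in_itv/=.
    rewrite -ler_expR lnK ?posrE ?divr_gt0// ler_pdivlMr// in k1.
    rewrite -ltr_expR lnK ?posrE ?divr_gt0// ltr_pdivrMr// in k2.
    by rewrite mulrC k1 mulrC.
  move=> [k _]; rewrite /F /= in_itv/= => /andP[+ _]; apply: le_trans.
  by apply: ler_peMr; [exact: ltW|rewrite -expR0 ler_expR].
rewrite UF; apply: (@integrable_bigcup_bound F _
  (fun k => x `^ (- p - 1) * expR (- (k%:R * (p + 1))) * phi k.+1%:R)
  (fun k => x * expR k.+1%:R) (x `^ (- p - 1) * x * expR (p + 1) * M)).
- by move=> k; exact: measurable_itv.
- exact: trivIset_shells Fi.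
- rewrite -UF; apply: measurable_funM => //.
  by apply: measurable_funTS; exact: measurable_powR.
- move=> k s; rewrite /F /= in_itv/= => /andP[s1 s2].
  have s0 : 0 < s by exact: lt_le_trans s1.
  rewrite normrM ger0_norm ?powR_ge0//; apply: ler_pM; rewrite ?powR_ge0//; last exact: fphi.
  rewrite !powR_expR// -expRD ler_expR.
  have : ln x + k%:R <= ln s by rewrite -ler_expR expRD !lnK ?posrE.
  move=> h; have : 0 <= (p + 1) * (ln s - ln x - k%:R).
    by apply: mulr_ge0; lra.
  by move=> ?; lra.
- move=> k; rewrite /F lebesgue_measure_itv/=; case: ifP => _.
    by rewrite -EFinB lee_fin gerBl ltW.
  by rewrite lee_fin ltW.
- by move=> k; rewrite !mulr_ge0 ?powR_ge0 ?expR_ge0.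
- move=> K; have C0 : 0 <= x `^ (- p - 1) * x * expR (p + 1).
    by rewrite !mulr_ge0 ?powR_ge0 ?expR_ge0// ltW.
  apply: le_trans (ler_wpM2l C0 (phiM K)); rewrite mulr_sumr; apply: ler_sum => k _.
  have -> : expR (- (k%:R * (p + 1))) = expR (p + 1) * expR (- (p * k.+1%:R)) * expR (- k.+1%:R).
    rewrite -!expRD; congr expR; rewrite (_ : k.+1%:R = k%:R + 1); last by rewrite natr1.
    by ring.
  have e : expR (- k.+1%:R) * expR k.+1%:R = 1 :> R by rewrite mulrC expRxMexpNx_1.
  rewrite [leLHS](_ : _ = x `^ (- p - 1) * x * expR (p + 1) *
    (phi k.+1%:R * expR (- (p * k.+1%:R))) * (expR (- k.+1%:R) * expR k.+1%:R)); last by ring.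
  by rewrite e mulr1.
Qed.

(** The mirror image, on shells shrinking to 0. The exponent p - 1 may have either sign, which costs
    the summand 1 in [expR (1 - k%:R * (p - 1))]. *)
Lemma weight_integrable_0 (f : R -> R) : measurable_fun `]0, x] f ->
  (forall k s, x * expR (- k.+1%:R) < s -> s <= x * expR (- k%:R) -> `|f s| <= phi k.+1%:R) ->
  mu.-integrable `]0, x] (EFin \o (fun s => s `^ (p - 1) * f s)).
Proof.
move=> mf fphi; have p1 := p0.
pose F k : set R := `]x * expR (- k.+1%:R), x * expR (- k%:R)]%classic.
have xe k : 0 < x * expR k by rewrite mulr_gt0 ?expR_gt0.
have lnxs s : 0 < s -> ln (x / s) = - ln (s / x).
  by move=> s0; rewrite -lnV ?posrE ?divr_gt0// invf_div.
have Fi k s : F k s -> Num.truncn (ln (x / s)) = k.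
  rewrite /F /= in_itv/= => /andP[s1 s2]; have s0 : 0 < s by exact: lt_trans s1.
  have l1 : k%:R <= ln (x / s).
    rewrite lnxs// lerNr -ler_expR lnK ?posrE ?divr_gt0// ler_pdivrMr// mulrC//.
  apply/eqP; rewrite Num.Theory.truncn_eq; last exact: le_trans l1.
  by rewrite l1 lnxs// ltrNl -ltr_expR lnK ?posrE ?divr_gt0// ltr_pdivlMr// mulrC.
have UF : `]0, x]%classic = \bigcup_k F k.
  apply/seteqP; split => s /=; rewrite in_itv/=.
    move=> /andP[s0 sx].
    have l0 : 0 <= ln (x / s).
      by rewrite -ln1 ler_ln ?posrE ?divr_gt0// ler_pdivlMr// mul1r.
    have /andP[k1 k2] := Num.Theory.truncn_itv l0.
    exists (Num.truncn (ln (x / s))) => //; rewrite /F /= in_itv/=.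
    rewrite {2}lnxs// lerNr -ler_expR lnK ?posrE ?divr_gt0// ler_pdivrMr// in k1.
    rewrite lnxs// ltrNl -ltr_expR lnK ?posrE ?divr_gt0// ltr_pdivlMr// -lnxs// in k2.
    by rewrite mulrC k2 mulrC.
  move=> [k _]; rewrite /F /= in_itv/= => /andP[s1 s2].
  rewrite (lt_trans _ s1)//=; apply: (le_trans s2).
  by apply: ler_piMr; [exact: ltW|rewrite -expR0 ler_expR oppr_le0].
rewrite UF; apply: (@integrable_bigcup_bound F _
  (fun k => x `^ (p - 1) * expR (1 - k%:R * (p - 1)) * phi k.+1%:R)
  (fun k => x * expR (- k%:R)) (x `^ (p - 1) * x * expR (p + 1) * M)).
- by move=> k; exact: measurable_itv.
- exact: trivIset_shells Fi.
- rewrite -UF; apply: measurable_funM => //.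
  by apply: measurable_funTS; exact: measurable_powR.
- move=> k s; rewrite /F /= in_itv/= => /andP[s1 s2].
  have s0 : 0 < s by exact: lt_trans s1.
  rewrite normrM ger0_norm ?powR_ge0//; apply: ler_pM; rewrite ?powR_ge0//; last exact: fphi.
  rewrite !powR_expR// -expRD ler_expR.
  have h1 : ln s <= ln x - k%:R by rewrite -ler_expR expRD !lnK ?posrE.
  have h2 : ln x - k.+1%:R <= ln s by rewrite -ler_expR expRD !lnK ?posrE// ltW.
  move: h2; rewrite -natr1 => h2.
  have : 0 <= p * (ln x - k%:R - ln s) by apply: mulr_ge0; lra.
  by move=> ?; lra.
- move=> k; rewrite /F lebesgue_measure_itv/=; case: ifP => _.
    by rewrite -EFinB lee_fin gerBl ltW.
  by rewrite lee_fin ltW.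
- by move=> k; rewrite !mulr_ge0 ?powR_ge0 ?expR_ge0.
- move=> K; have C0 : 0 <= x `^ (p - 1) * x * expR (p + 1).
    by rewrite !mulr_ge0 ?powR_ge0 ?expR_ge0// ltW.
  apply: le_trans (ler_wpM2l C0 (phiM K)); rewrite mulr_sumr; apply: ler_sum => k _.
  have -> : expR (1 - k%:R * (p - 1)) = expR (p + 1) * expR (- (p * k.+1%:R)) * expR k%:R.
    rewrite -!expRD; congr expR; rewrite (_ : k.+1%:R = k%:R + 1); last by rewrite natr1.
    by ring.
  have e : expR k%:R * expR (- k%:R) = 1 :> R by rewrite expRxMexpNx_1.
  rewrite [leLHS](_ : _ = x `^ (p - 1) * x * expR (p + 1) *
    (phi k.+1%:R * expR (- (p * k.+1%:R))) * (expR k%:R * expR (- k%:R))); last by ring.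
  by rewrite e mulr1.
Qed.

End IntegrableBigcup.

Section PayoffWeights.
Context {R : realType} {d : measure_display} {T : measurableType d}.
Variables (P : probability T R) (W : R -> T -> R) (b sg r : R) (h : R -> R).
Hypotheses (hW : brownian_motion P W) (hsg : sg != 0) (hr : 0 < r).
Hypotheses (hh : increasing_pos h) (hint : payoff_integrable P b sg r h W).
Local Notation mu := (@lebesgue_measure R).
Local Notation nu := (b - sg ^+ 2).
Local Notation c := (Num.sqrt 2 * sg).

Lemma volatility_sqr : c ^+ 2 = 2 * sg ^+ 2.
Proof. by rewrite exprMn sqr_sqrtr. Qed.

Lemma volatility_neq0 : c != 0.
Proof. by rewrite mulf_neq0// gt_eqF// sqrtr_gt0. Qed.

Lemma green_rate_root_n : green_rate nu c r = root_n b sg r.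
Proof.
rewrite /green_rate /green_disc /root_n volatility_sqr opprB addrC.
by congr ((_ + Num.sqrt _) / _); ring.
Qed.

(** Reversing the sign of the log-process exchanges 0 and +oo, and with them the roles of n and
    -m. *)
Lemma green_rate_root_m : green_rate (- nu) (- c) r = - root_m b sg r.
Proof.
rewrite /green_rate /green_disc /root_m !sqrrN volatility_sqr.
rewrite (_ : nu ^+ 2 + 2 * r * (2 * sg ^+ 2) = nu ^+ 2 + 4 * sg ^+ 2 * r); last by ring.
by field.
Qed.

Lemma payoff_measurable : measurable_fun (`]0, +oo[%classic : set R) h.
Proof.
have mg : measurable_fun setT (fun y => h (expR y)).
  have nd : {homo (fun y => h (expR y)) : y z / y <= z}.
    by move=> y z yz; apply: hh; [exact: expR_gt0|rewrite ler_expR].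
  exact: nondecreasing_measurable nd.
apply: (@eq_measurable_fun _ _ _ _ _ (fun s => h (expR (ln s)))).
  by move=> s; rewrite inE /= in_itv/= andbT => s0; rewrite lnK.
apply: measurable_funTS.
exact: (measurableT_comp mg (@measurable_ln R)).
Qed.

(** The positive part of h is nondecreasing in the log-process, the negative part in the reflected
    log-process, so one bound covers both ends of (0, oo). *)
Lemma payoff_green_sums x : 0 < x ->
  (exists M, forall K, \sum_(k < K) Num.max (h (x * expR k.+1%:R)) 0 *
     expR (- (root_n b sg r * k.+1%:R)) <= M) /\
  (exists M, forall K, \sum_(k < K) Num.max (- h (x * expR (- k.+1%:R))) 0 *
     expR (- (- root_m b sg r * k.+1%:R)) <= M).
Proof.
move=> x0; have x1 := x0; have fin := hint x0 (gbm_is_solution hW b sg x0).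
have ndpsi : {homo (fun y => h (x * expR y)) : y z / y <= z}.
  move=> y z yz; apply: hh; first by rewrite mulr_gt0 ?expR_gt0.
  by rewrite ler_pM2l// ler_expR.
have mpsi : measurable_fun setT (fun y => h (x * expR y)).
  exact: nondecreasing_measurable ndpsi.
split.
  rewrite -green_rate_root_n.
  apply: (@green_sum_bound _ _ _ _ _ hW _ _ _ volatility_neq0 hr
    (fun y => Num.max (h (x * expR y)) 0) (fun y => h (x * expR y))) => //.
  - by move=> y z yz; rewrite ge_max !le_max lexx orbT andbT ndpsi.
  - by move=> y; rewrite le_max lexx orbT.
  - by move=> y; rewrite ge_max normr_ge0 ler_norm.
rewrite -green_rate_root_m.
have cN : - c != 0 by rewrite oppr_eq0 volatility_neq0.
apply: (@green_sum_bound _ _ _ _ _ hW _ _ _ cN hr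
  (fun y => Num.max (- h (x * expR (- y))) 0) (fun y => h (x * expR (- y)))).
- move=> y z yz; rewrite ge_max !le_max lexx orbT andbT lerN2.
  by rewrite (ndpsi (- z) (- y)) ?lerN2.
- by move=> y; rewrite le_max lexx orbT.
- have mN : measurable_fun setT (fun y : R => - y) by exact: measurableT_comp.
  exact: (measurableT_comp mpsi mN).
- by move=> y; rewrite ge_max normr_ge0 -normrN ler_norm.
apply: le_lt_trans fin; rewrite le_eqVlt; apply/orP; left; apply/eqP.
apply: eq_integral => w _; apply: eq_integral => t _; congr (_ * `|h (x * expR _)|)%:E.
by ring.
Qed.

(** By monotonicity |h s + q| on a shell is at most the relevant part of h at the outer end plus the
    constant |h x| + |q|, whose share is a geometric sum. *)
Lemma payoff_weights x q : 0 < x ->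
  mu.-integrable `[x, +oo[ (EFin \o (fun s => s `^ (- root_n b sg r - 1) * (h s + q))) /\
  mu.-integrable `]0, x] (EFin \o (fun s => s `^ (- root_m b sg r - 1) * (h s + q))).
Proof.
move=> x0; have x1 := x0; have [[M1 H1] [M2 H2]] := payoff_green_sums x0.
have n0 : 0 < root_n b sg r by rewrite -green_rate_root_n green_rate_gt0// volatility_neq0.
have m0 : 0 < - root_m b sg r.
  by rewrite -green_rate_root_m green_rate_gt0// oppr_eq0 volatility_neq0.
have C0 : 0 <= `|h x| + `|q| by rewrite addr_ge0.
have [G1 HG1] := geometric_sum_bound n0 C0.
have [G2 HG2] := geometric_sum_bound m0 C0.
have maxl (y : R) : y <= Num.max y 0 by rewrite le_max lexx.
have maxr (y : R) : 0 <= Num.max y 0 by rewrite le_max lexx orbT.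
split.
  apply: (@weight_integrable_oo _ _
    (fun y => Num.max (h (x * expR y)) 0 + (`|h x| + `|q|)) (M1 + G1)) => //.
  - by move=> y; rewrite addr_ge0.
  - move=> K; under eq_bigr do rewrite mulrDl.
    by rewrite big_split; exact: (lerD (H1 K) (HG1 K)).
  - apply: measurable_funD => //; apply: measurable_funS payoff_measurable => //.
    by move=> s /=; rewrite !in_itv/= !andbT; exact: lt_le_trans.
  move=> k s s1 s2; have xs : x <= s.
    apply: le_trans s1; apply: ler_peMr; first exact: ltW.
    by rewrite -expR0 ler_expR.
  have h1 : h x <= h s by exact: hh.
  have h2 : h s <= h (x * expR k.+1%:R) by apply: hh; [lra|exact: ltW].
  apply: (le_trans (ler_normD _ _)); rewrite addrA lerD2r.
  have := maxl (h (x * expR k.+1%:R)); have := maxr (h (x * expR k.+1%:R)).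
  have := ler_norm (- h x); have := ler_norm (h x); rewrite normrN.
  by move=> *; rewrite ler_norml; apply/andP; split; lra.
apply: (@weight_integrable_0 _ _
  (fun y => Num.max (- h (x * expR (- y))) 0 + (`|h x| + `|q|)) (M2 + G2)) => //.
- by move=> y; rewrite addr_ge0.
- move=> K; under eq_bigr do rewrite mulrDl.
  by rewrite big_split; exact: (lerD (H2 K) (HG2 K)).
- apply: measurable_funD => //; apply: measurable_funS payoff_measurable => //.
  by move=> s /=; rewrite !in_itv/= !andbT => /andP[].
move=> k s s1 s2; have xs : s <= x.
  apply: (le_trans s2); apply: ler_piMr; first exact: ltW.
  by rewrite -expR0 ler_expR oppr_le0.
have e0 : 0 < x * expR (- k.+1%:R) by rewrite mulr_gt0 ?expR_gt0.
have h1 : h s <= h x by apply: hh => //; exact: lt_trans s1.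
have h2 : h (x * expR (- k.+1%:R)) <= h s by apply: hh => //; exact: ltW.
apply: (le_trans (ler_normD _ _)); rewrite addrA lerD2r.
have := maxl (- h (x * expR (- k.+1%:R))); have := maxr (- h (x * expR (- k.+1%:R))).
have := ler_norm (- h x); have := ler_norm (h x); rewrite normrN.
by move=> *; rewrite ler_norml; apply/andP; split; lra.
Qed.

End PayoffWeights.

(** * Weighted averages of the payoff *)

Section PowerIntegrals.
Context {R : realType}.
Local Notation mu := (@lebesgue_measure R).
Implicit Types (p a c x : R) (rho : R -> R).

Lemma powR_continuous_at p x : 0 < x -> {for x, continuous (fun s : R => s `^ p)}.
Proof.
move=> x0; apply/differentiable_continuous/derivable1_diffP.
exact: (@ex_derive _ _ _ _ _ _ _ (is_derive1_powR p x0)).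
Qed.

Lemma powR_within_continuous p a (i : interval R) :
  0 < a -> {subset i <= `[a, +oo[} -> {within [set` i], continuous (fun s : R => s `^ p)}.
Proof.
move=> a0 ia; apply: continuous_in_subspaceT => s; rewrite inE /= => /ia.
by rewrite in_itv/= andbT => as_; apply: powR_continuous_at; exact: lt_le_trans as_.
Qed.

Lemma powR_integrable p a c : 0 < a -> a <= c ->
  mu.-integrable `]a, c] (EFin \o (fun s => s `^ p)).
Proof.
move=> a0 ac; apply: (@integrableS _ _ _ mu `[a, c]%classic) => //.
  by move=> s /=; rewrite !in_itv/= => /andP[/ltW -> ->].
apply: continuous_compact_integrable; first exact: segment_compact.
by apply: (powR_within_continuous a0) => s; rewrite !in_itv/= => /andP[-> _].
Qed.

Lemma Rintegral_powR p a c : p != 0 -> 0 < a -> a <= c ->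
  \int[mu]_(s in `]a, c]) s `^ (- p - 1) = (a `^ (- p) - c `^ (- p)) / p.
Proof.
move=> p0 a0; rewrite le_eqVlt => /predU1P[<-|ac].
  by rewrite set_itvoc0// Rintegral_set0 subrr mul0r.
rewrite Rintegral_itv_obnd_cbnd; last exact: powR_integrable a0 (ltW ac).
pose F (s : R) := - s `^ (- p) / p.
have dF (s : R) : 0 < s -> is_derive s 1 F (s `^ (- p - 1)).
  move=> s0; have h := is_derive1_powR (- p) s0.
  have -> : F = (- p^-1) *: (fun s : R => s `^ (- p)).
    by apply/funext => t; rewrite /F scalrfctE /GRing.scale /=; ring.
  apply: is_derive_eq; rewrite /GRing.scale /=.
  by field.
have cf : {within `[a, c], continuous (fun s : R => s `^ (- p - 1))}.
  by apply: (powR_within_continuous a0) => s; rewrite !in_itv/= => /andP[-> _].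
rewrite /Rintegral (continuous_FTC2 ac cf (F := F)).
- by rewrite -EFinB /= /F; field.
- have cF (s : R) : 0 < s -> {for s, continuous F}.
    move=> s0; apply/differentiable_continuous/derivable1_diffP.
    exact: (@ex_derive _ _ _ _ _ _ _ (dF _ s0)).
  split.
  + move=> s; rewrite in_itv/= => /andP[as_ _].
    by apply: (@ex_derive _ _ _ _ _ _ _ (dF _ _)); exact: lt_trans as_.
  + by apply: cvg_at_right_filter; exact: cF.
  + by apply: cvg_at_left_filter; apply: cF; exact: lt_trans ac.
- move=> s; rewrite in_itv/= => /andP[as_ _].
  by rewrite derive1E (@derive_val _ _ _ _ _ _ _ (dF _ _))//; exact: lt_trans as_.
Qed.

End PowerIntegrals.

Lemma integrable_union d (T : measurableType d) (R : realType)
    (mu : {measure set T -> \bar R}) (A B : set T) (f : T -> R) :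
  measurable A -> measurable B -> [disjoint A & B] ->
  mu.-integrable A (EFin \o f) -> mu.-integrable B (EFin \o f) ->
  mu.-integrable (A `|` B) (EFin \o f).
Proof.
move=> mA mB AB /integrableP[fA iA] /integrableP[fB iB].
have mf : measurable_fun (A `|` B) (EFin \o f) by exact/measurable_funU.
apply/integrableP; split => //.
rewrite ge0_integral_setU//; first exact: lte_add_pinfty.
exact: measurableT_comp.
Qed.

(** * Paired weighted integrals and their comparison *)

Section PrimitivePairs.
Context {R : realType}.
Local Notation mu := (@lebesgue_measure R).
Variables m n : R.
Implicit Types (p a c x : R) (rho MM NN : R -> R).

(* [MM] and [NN] are primitives, up to sign, of [s^(-m-1) rho] and [s^(-n-1) rho] *)
Definition primitive_pair rho MM NN a c :=
  [/\ mu.-integrable `]a, c] (EFin \o rho),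
      MM c - MM a = - m * \int[mu]_(s in `]a, c]) (s `^ (- m - 1) * rho s)
    & NN a - NN c = n * \int[mu]_(s in `]a, c]) (s `^ (- n - 1) * rho s)].

Lemma weighted_integrable p rho a c : 0 < a -> mu.-integrable `]a, c] (EFin \o rho) ->
  mu.-integrable `]a, c] (EFin \o (fun s => s `^ p * rho s)).
Proof.
move=> a0 irho; have [ca|ac] := ltP c a.
  by rewrite set_itv_ge ?bnd_simp -?leNgt ?(ltW ca)//; exact: integrable_set0.
have [B HB] : exists B : R, forall s, s \in `[a, c] -> `|s `^ p| <= B.
  have cp : {within `[a, c], continuous (fun s : R => s `^ p)}.
    by apply: (powR_within_continuous a0) => s; rewrite !in_itv/= => /andP[-> _].
  have [B [_ HB]] := compact_bounded (continuous_compact cp (@segment_compact _ a c)).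
  exists (B + 1) => s sac; apply: (HB (B + 1)); first by rewrite ltrDl.
  by exists s.
have mp : measurable_fun `]a, c] (fun s : R => s `^ p).
  by apply: measurable_funTS; exact: measurable_powR.
have bp : [bounded s `^ p | s in `]a, c]%classic].
  exists B; split; first exact: num_real.
  move=> C BC s /=; rewrite in_itv/= => /andP[as_ sc].
  by apply: le_trans (ltW BC); apply: HB; rewrite in_itv/= (ltW as_).
pose g (s : R) := s `^ p.
have : mu.-integrable `]a, c] ((EFin \o rho) \* (EFin \o g))%E.
  by apply: integrableMl => //; exact: bp.
by apply: eq_integrable => // s _; rewrite /= -EFinM mulrC.
Qed.

(** Only increments enter, so both primitives may be shifted by constants, and the value of the rate
    at the end point c is immaterial. *)
Lemma primitive_pair_ext rho rho' MM NN MM' NN' a c km kn : 0 < a ->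
  (forall s, a < s -> s < c -> rho s = rho' s) ->
  mu.-integrable `]a, c] (EFin \o rho') ->
  MM' c = MM c + km -> MM' a = MM a + km -> NN' c = NN c + kn -> NN' a = NN a + kn ->
  primitive_pair rho MM NN a c -> primitive_pair rho' MM' NN' a c.
Proof.
move=> a0 rr' ir' e1 e2 e3 e4 [ir eM eN].
have ext p : \int[mu]_(s in `]a, c]) (s `^ p * rho s) = \int[mu]_(s in `]a, c]) (s `^ p * rho' s).
  have sub f : mu.-integrable `]a, c] (EFin \o f) ->
      mu.-integrable `]a, c[ (EFin \o f).
    apply: integrableS => // s /=.
    by rewrite !in_itv/= => /andP[-> /ltW ->].
  rewrite -!Rintegral_itv_bndo_bndc; try (apply: sub; exact: weighted_integrable).
  apply: eq_Rintegral => s; rewrite inE /= in_itv/= => /andP[as_ sc].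
  by rewrite rr'.
split => //.
- by rewrite e1 e2 -ext -eM; ring.
- by rewrite e3 e4 -ext -eN; ring.
Qed.

Lemma primitive_pair_cat rho MM NN a b c : 0 < a -> a <= b -> b <= c ->
  primitive_pair rho MM NN a b -> primitive_pair rho MM NN b c ->
  primitive_pair rho MM NN a c.
Proof.
move=> a0 ab bc [i1 M1 N1] [i2 M2 N2].
have U : `]a, c]%classic = `]a, b]%classic `|` `]b, c]%classic.
  by rewrite -itv_bndbnd_setU// bnd_simp.
have ir : mu.-integrable `]a, c] (EFin \o rho).
  rewrite U; apply: integrable_union => //; try exact: measurable_itv.
  apply/disj_setPS => s [] /=; rewrite !in_itv/= => /andP[_ sb] /andP[bs _].
  by move: (lt_le_trans bs sb); rewrite ltxx.
have split_int p : \int[mu]_(s in `]a, c]) (s `^ p * rho s) =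
    \int[mu]_(s in `]a, b]) (s `^ p * rho s) + \int[mu]_(s in `]b, c]) (s `^ p * rho s).
  rewrite -(@Rintegral_itvB _ _ (BRight a) (BRight c) b) ?bnd_simp//; first by rewrite addrC subrK.
  exact: weighted_integrable.
split; first exact: ir.
- by rewrite split_int mulrDr -M1 -M2; ring.
- by rewrite split_int mulrDr -N1 -N2; ring.
Qed.

Lemma primitive_pair_scale k rho MM NN a c : 0 < a -> primitive_pair rho MM NN a c ->
  primitive_pair (fun s => k * rho s) (fun x => k * MM x) (fun x => k * NN x) a c.
Proof.
move=> a0 [ir M1 N1].
have sc p : \int[mu]_(s in `]a, c]) (s `^ p * (k * rho s)) =
    k * \int[mu]_(s in `]a, c]) (s `^ p * rho s).
  rewrite -RintegralZl//; last exact: weighted_integrable.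
  by apply: eq_Rintegral => s _; rewrite mulrCA.
split.
- by apply: eq_integrable (integrableZl _ k ir).
- by rewrite sc mulrCA -M1; ring.
- by rewrite sc mulrCA -N1; ring.
Qed.

Hypotheses (m0 : m < 0) (n0 : 0 < n).

Lemma primitive_pair_cst q a c : 0 < a -> a <= c ->
  primitive_pair (fun=> q) (fun x => q * x `^ (- m)) (fun x => q * x `^ (- n)) a c.
Proof.
move=> a0 ac.
have one : primitive_pair (fun=> 1) (fun x => x `^ (- m)) (fun x => x `^ (- n)) a c.
  split.
  - have := powR_integrable 0 a0 ac.
    by apply: eq_integrable => // s _; rewrite /= powRr0.
  - rewrite (_ : \int[mu]_(s in _) _ = \int[mu]_(s in `]a, c]) s `^ (- m - 1)).
      by rewrite Rintegral_powR// ?lt_eqF//; field; rewrite lt_eqF.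
    by apply: eq_Rintegral => s _; rewrite mulr1.
  - rewrite (_ : \int[mu]_(s in _) _ = \int[mu]_(s in `]a, c]) s `^ (- n - 1)).
      by rewrite Rintegral_powR// ?gt_eqF//; field; rewrite gt_eqF.
    by apply: eq_Rintegral => s _; rewrite mulr1.
have := primitive_pair_scale q a0 one.
apply: (@primitive_pair_ext _ _ _ _ _ _ _ _ 0 0) => //; rewrite ?addr0//.
  by move=> s _ _; rewrite mulr1.
by case: (primitive_pair_scale q a0 one) => + _ _; apply: eq_integrable => // s _; rewrite /= mulr1.
Qed.

Lemma primitive_pair_add rho MM NN rho' MM' NN' a c : 0 < a ->
  primitive_pair rho MM NN a c -> primitive_pair rho' MM' NN' a c ->
  primitive_pair (fun s => rho s + rho' s) (fun x => MM x + MM' x) (fun x => NN x + NN' x) a c.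
Proof.
move=> a0 [i1 M1 N1] [i2 M2 N2].
have sp p : \int[mu]_(s in `]a, c]) (s `^ p * (rho s + rho' s)) =
    \int[mu]_(s in `]a, c]) (s `^ p * rho s) + \int[mu]_(s in `]a, c]) (s `^ p * rho' s).
  rewrite -RintegralD//; try exact: weighted_integrable.
  by apply: eq_Rintegral => s _; rewrite mulrDr.
split.
- by apply: eq_integrable (integrableD _ i1 i2).
- by rewrite sp mulrDr -M1 -M2; ring.
- by rewrite sp mulrDr -N1 -N2; ring.
Qed.

(* s^(-m-1) = s^(n-m) s^(-n-1), and s^(n-m) lies between its values at a and c. *)
Lemma primitive_pair_ge0 rho MM NN a c : 0 < a -> a <= c -> primitive_pair rho MM NN a c ->
  (forall s, a < s -> s < c -> 0 <= rho s) ->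
  [/\ 0 <= NN a - NN c,
      a `^ (n - m) * (- m / n * (NN a - NN c)) <= MM c - MM a
    & MM c - MM a <= c `^ (n - m) * (- m / n * (NN a - NN c))].
Proof.
move=> a0 ac [ir -> ->] r0; have m1 := m0; have n1 := n0.
have sub f : mu.-integrable `]a, c] (EFin \o f) -> mu.-integrable `]a, c[ (EFin \o f).
  by apply: integrableS => // s /=; rewrite !in_itv/= => /andP[-> /ltW ->].
have iw p := sub _ (weighted_integrable p a0 ir).
rewrite -!Rintegral_itv_bndo_bndc//.
set I := \int[mu]_(s in _) (s `^ (- n - 1) * _).
set J := \int[mu]_(s in _) (s `^ (- m - 1) * _).
have I0 : 0 <= I.
  apply: Rintegral_ge0 => s /=; rewrite in_itv/= => /andP[as_ sc].
  by rewrite mulr_ge0 ?powR_ge0// r0.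
have e s : 0 < s -> s `^ (- m - 1) = s `^ (n - m) * s `^ (- n - 1).
  move=> s0; rewrite -powRD; first by congr (_ `^ _); ring.
  by rewrite (gt_eqF s0) implybT.
have nm : 0 <= n - m by lra.
have pmono s t : 0 < s -> s <= t -> s `^ (n - m) <= t `^ (n - m).
  by move=> s0 st; apply: ge0_ler_powR => //; rewrite nnegrE; lra.
have h1 : a `^ (n - m) * I <= J.
  rewrite -RintegralZl//; apply: le_Rintegral => //.
    by apply: eq_integrable (integrableZl _ (a `^ (n - m)) (iw (- n - 1))).
  move=> s /=; rewrite in_itv/= => /andP[as_ sc]; have s0 : 0 < s by exact: lt_trans as_.
  rewrite e// -mulrA; apply: ler_wpM2r; first by rewrite mulr_ge0 ?powR_ge0// r0.
  exact: pmono (ltW as_).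
have h2 : J <= c `^ (n - m) * I.
  rewrite -RintegralZl//; apply: le_Rintegral => //.
    by apply: eq_integrable (integrableZl _ (c `^ (n - m)) (iw (- n - 1))).
  move=> s /=; rewrite in_itv/= => /andP[as_ sc]; have s0 : 0 < s by exact: lt_trans as_.
  rewrite e// -mulrA; apply: ler_wpM2r; first by rewrite mulr_ge0 ?powR_ge0// r0.
  exact: pmono s0 (ltW sc).
have nI : - m / n * (n * I) = - m * I by field; rewrite gt_eqF.
rewrite nI; split.
- by rewrite mulr_ge0// ltW.
- by rewrite mulrCA ler_wpM2l//; lra.
- by rewrite [leRHS]mulrCA ler_wpM2l//; lra.
Qed.

End PrimitivePairs.

Section RealLemmas.
Context {R : realType}.

(** The route to continuity wherever f is a composite with an implicit function obtained by choice:
    only increments of f and g are compared. *)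
Lemma continuous_dominated (A : set R) (f g : R -> R) (C : R) :
  {within A, continuous g} ->
  (forall x y, A x -> A y -> `|f x - f y| <= C * `|g x - g y|) ->
  {within A, continuous f}.
Proof.
move=> /subspace_continuousP cg fg; apply/subspace_continuousP => x Ax.
apply/cvgrPdist_le => e e0.
pose C' := `|C| + 1; have C'0 : 0 < C' by rewrite ltr_wpDl.
have := cg x Ax => /cvgrPdist_le /(_ (e / C')) /(_ (divr_gt0 e0 C'0)).
rewrite !near_withinE; apply: filterS => y h Ay.
apply: (le_trans (fg _ _ Ax Ay)).
apply: (@le_trans _ _ (C' * `|g x - g y|)).
  by rewrite ler_wpM2r// /C' ler_wpDr// ler_norm.
by rewrite mulrC -ler_pdivlMr// h.
Qed.

Lemma powR_large (p B a : R) : 0 < p -> exists x, [/\ 0 < x, a < x & B < x `^ p].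
Proof.
move=> p0; pose y := `|B| + 1; have y0 : 0 < y by rewrite ltr_wpDl.
pose x := `|a| + 1 + y `^ p^-1; exists x.
have yp0 : 0 < y `^ p^-1 by exact: powR_gt0.
have x0 : 0 < x by rewrite /x; have := normr_ge0 a; lra.
split => //; first by rewrite /x; have := ler_norm a; lra.
apply: (@lt_le_trans _ _ ((y `^ p^-1) `^ p)).
  by rewrite -powRrM mulVf ?gt_eqF// powRr1 ?ltW// /y; have := ler_norm B; lra.
apply: ge0_ler_powR; rewrite ?nnegrE ?powR_ge0 ?ltW//.
by rewrite /x; have := normr_ge0 a; lra.
Qed.

Lemma powRN_large (p B a : R) : 0 < p -> 0 < a ->
  exists x, [/\ 0 < x, x < a & B < x `^ (- p)].
Proof.
move=> p0 a0; have [y [y0 ay By]] := powR_large B a^-1 p0.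
exists y^-1; split; first by rewrite invr_gt0.
  by rewrite -[ltRHS]invrK ltf_pV2 ?posrE ?invr_gt0.
by rewrite powR_expR ?invr_gt0// lnV ?posrE// mulrNN -powR_expR.
Qed.

Lemma powR_gt0_mono (p a c : R) : 0 < p -> 0 < a -> a < c -> a `^ p < c `^ p.
Proof. by move=> p0 a0 ac; apply: gt0_ltr_powR; rewrite ?nnegrE//; lra. Qed.

Lemma powRN_mono (p a c : R) : 0 < p -> 0 < a -> a < c -> c `^ (- p) < a `^ (- p).
Proof.
move=> p0 a0 ac; have c0 : 0 < c by lra.
by rewrite !powR_expR// ltr_expR !mulNr ltrN2 ltr_pM2l// ltr_ln ?posrE.
Qed.

Lemma powRN_cvg_pinfty (p : R) : 0 < p -> x `^ (- p) @[x --> +oo] --> (0 : R).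
Proof.
move=> p0; apply/cvgrPdist_lt => e e0.
have [y [y0 _ By]] := powR_large e^-1 0 p0.
near=> x.
have yx : y < x by near: x; apply: nbhs_pinfty_gt; exact: num_real.
rewrite sub0r normrN ger0_norm ?powR_ge0//.
apply: lt_trans (powRN_mono p0 y0 yx) _.
by rewrite powRN -[ltRHS]invrK ltf_pV2 ?posrE ?powR_gt0 ?invr_gt0.
Unshelve. all: by end_near. Qed.

End RealLemmas.

Section ZeroTail.
Context {R : realType}.
Local Notation mu := (@lebesgue_measure R).

Lemma integrable_closed_left (f : R -> R) (a c : R) : a <= c ->
  mu.-integrable `]a, c] (EFin \o f) -> mu.-integrable `[a, c] (EFin \o f).
Proof.
move=> ac fi; rewrite -(setU1itv false); last by rewrite bnd_simp.
apply: integrable_union => //.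
  apply/disj_setPS => s [] /= ->; rewrite in_itv/= => /andP[].
  by rewrite ltxx.
apply/integrableP; split; last by rewrite integral_set1 ltry.
exact: measurable_fun_set1.
Qed.

Lemma Rintegral_at0 (f : R -> R) (c : R) : 0 < c -> mu.-integrable `]0, c] (EFin \o f) ->
  \int[mu]_(s in `]0, y]) f s @[y --> 0^'+] --> (0 : R).
Proof.
move=> c0 fi; have fi' := integrable_closed_left (ltW c0) fi.
have /cvg_at_right_filter h := parameterized_integral_cvg_left c0 fi'.
apply: cvg_trans h; apply: near_eq_cvg; near=> y.
have y0 : 0 < y by near: y; exact: nbhs_right_gt.
have yc : y <= c by near: y; exact: nbhs_right_le.
rewrite /parameterized_integral Rintegral_itv_obnd_cbnd//.
apply: integrableS fi => // s /=; rewrite !in_itv/= => /andP[-> sy].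
exact: le_trans yc.
Unshelve. all: by end_near. Qed.

End ZeroTail.

Section Averages.
Context {R : realType}.
Local Notation mu := (@lebesgue_measure R).
Variables (m n : R) (h : R -> R).
Hypotheses (m0 : m < 0) (n0 : 0 < n) (hh : payoff_regular h).
Hypothesis (hoo : forall x q, 0 < x ->
  mu.-integrable `[x, +oo[ (EFin \o (fun s => s `^ (- n - 1) * (h s + q)))).
Hypothesis (hzero : forall x q, 0 < x ->
  mu.-integrable `]0, x] (EFin \o (fun s => s `^ (- m - 1) * (h s + q)))).

(** The contribution of q is written as an explicit power, so that changing q is a ring identity at
    every x. Equality with the integral of the payoff plus q is [wint_m0E], and [wint_n_ooE] for
    [Nq]. *)
Definition Mq (q x : R) : R := - m * wint m h 0 0 x + q * x `^ (- m).
Definition Nq (q x : R) : R := n * wint_oo n h 0 x + q * x `^ (- n).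

Lemma payoff_incr x y : 0 < x -> x <= y -> h x <= h y.
Proof. by case: hh => _ hi _; exact: hi. Qed.

Lemma payoff_unbounded (q a : R) : exists x, [/\ 0 < x, a < x & q < h x].
Proof.
have [_ _ /cvgryPgt /(_ q) [B [_ HB]]] := hh.
exists (`|B| + `|a| + 1).
have ha := ler_norm a; have hb := ler_norm B; have ha' := normr_ge0 a; have hb' := normr_ge0 B.
split; [lra|lra|apply: HB; lra].
Qed.

Lemma payoff_integrable_itv a c : 0 < a -> mu.-integrable `]a, c] (EFin \o h).
Proof.
move=> a0; pose B := `|h a| + `|h c|.
apply: measurable_bounded_integrable => //.
- rewrite /= lebesgue_measure_itv/=; case: ifP => _; last by rewrite ltry.
  by rewrite -EFinB ltry.
- have mh : measurable_fun (`]0, +oo[%classic : set R) h.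
    by case: hh => _ hi _; exact: payoff_measurable hi.
  apply: measurable_funS mh => // s /=; rewrite !in_itv/= andbT => /andP[as_ _].
  exact: lt_trans as_.
exists B; split; first exact: num_real.
move=> C BC s /=; rewrite in_itv/= => /andP[as_ sc]; apply: le_trans (ltW BC).
have h1 := payoff_incr a0 (ltW as_).
have h2 := payoff_incr (lt_trans a0 as_) sc.
have := ler_norm (h c); have := ler_norm (- h a); rewrite normrN.
have := normr_ge0 (h a); have := normr_ge0 (h c).
by rewrite /B ler_norml => *; apply/andP; split; lra.
Qed.

Lemma Mq_Nq_primitive_pair q a c : 0 < a -> a <= c ->
  primitive_pair m n (fun s => h s + q) (Mq q) (Nq q) a c.
Proof.
move=> a0 ac; have c0 : 0 < c by lra.
apply: primitive_pair_add => //; last exact: primitive_pair_cst.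
have ze p : (fun s : R => s `^ p * (h s + 0)) = (fun s => s `^ p * h s).
  by apply/funext => s; rewrite addr0.
split.
- exact: payoff_integrable_itv.
- have := hzero 0 c0; rewrite /wint ze => iz.
  rewrite -mulrBr (@Rintegral_itvB _ _ (BRight 0) (BRight c) a)// bnd_simp//.
  exact: ltW.
- have := hoo 0 a0; rewrite /wint_oo ze => io.
  have io' : mu.-integrable `]a, +oo[ (EFin \o (fun s => s `^ (- n - 1) * h s)).
    by apply: integrableS io => // s /=; rewrite !in_itv/= !andbT => /ltW.
  have := @Rintegral_itvB _ _ (BRight a) +oo%O c io'; rewrite !bnd_simp => /(_ ac isT) <-.
  by ring.
Qed.

Lemma wint_mE q a c : 0 < a -> a <= c -> m * wint m h q a c = Mq q a - Mq q c.
Proof.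
move=> a0 ac; have [_ e _] := Mq_Nq_primitive_pair q a0 ac.
by rewrite -[RHS]opprB e mulNr opprK.
Qed.

Lemma wint_nE q a c : 0 < a -> a <= c -> n * wint n h q a c = Nq q a - Nq q c.
Proof. by move=> a0 ac; have [_ _ e] := Mq_Nq_primitive_pair q a0 ac. Qed.

Lemma powR_tail_integrals (x : R) : 0 < x ->
  (mu.-integrable `]0, x] (EFin \o (fun s => s `^ (- m - 1))) /\
   - m * \int[mu]_(s in `]0, x]) s `^ (- m - 1) = x `^ (- m)) /\
  (mu.-integrable `]x, +oo[ (EFin \o (fun s => s `^ (- n - 1))) /\
   n * \int[mu]_(s in `]x, +oo[) s `^ (- n - 1) = x `^ (- n)).
Proof.
move=> x0; have m1 := m0; have n1 := n0.
(* The bare power is the difference of the weighted integrands for q = 1 and q = 0. *)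
have iz y : 0 < y -> mu.-integrable `]0, y] (EFin \o (fun s => s `^ (- m - 1))).
  move=> y0; have := integrableB _ (hzero 1 y0) (hzero 0 y0).
  by move=> /(_ (measurable_itv _)); apply: eq_integrable => // s _; rewrite /= -EFinB; congr EFin; ring.
have io y : 0 < y -> mu.-integrable `[y, +oo[ (EFin \o (fun s => s `^ (- n - 1))).
  move=> y0; have := integrableB _ (hoo 1 y0) (hoo 0 y0).
  by move=> /(_ (measurable_itv _)); apply: eq_integrable => // s _; rewrite /= -EFinB; congr EFin; ring.
split; split; first exact: iz.
(* The difference of the two sides does not change when x is replaced by a smaller y, and it tends
   to 0 as y does. *)
- pose J (y : R) := \int[mu]_(s in `]0, y]) s `^ (- m - 1).
  have JE y : 0 < y -> y <= x -> - m * J x - x `^ (- m) = - m * J y - y `^ (- m).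
    move=> y0 yx; have := @Rintegral_itvB _ _ (BRight 0) (BRight x) y (iz _ x0).
    rewrite !bnd_simp => /(_ (ltW y0) yx); rewrite -/(J x) -/(J y) Rintegral_powR ?lt_eqF// => e.
    have -> : J x = J y + (y `^ (- m) - x `^ (- m)) / m by rewrite -e; ring.
    by field; rewrite lt_eqF.
  have lim : (- m * J y - y `^ (- m)) @[y --> 0^'+] --> (- m * 0 - 0 : R).
    apply: cvgB; last by apply: powR_cvg0; lra.
    apply: cvgMr.
    exact: (Rintegral_at0 x0 (iz _ x0)).
  have lim' : (- m * J y - y `^ (- m)) @[y --> 0^'+] --> (- m * J x - x `^ (- m) : R).
    apply: cvg_near_cst; near=> y.
    have y0 : 0 < y by near: y; exact: nbhs_right_gt.
    have yx : y <= x by near: y; exact: nbhs_right_le.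
    by rewrite -JE.
  have e : - m * J x - x `^ (- m) = - m * 0 - 0 by exact: (cvg_unique _ lim' lim).
  by rewrite -/(J x); lra.
- by apply: integrableS (io _ x0) => // s /=; rewrite !in_itv/= !andbT => /ltW.
- rewrite Rintegral_itv_obnd_cbnd; last first.
    by apply: integrableS (io _ x0) => // s /=; rewrite !in_itv/= !andbT => /ltW.
  pose F (s : R) := - s `^ (- n) / n.
  have dF (s : R) : 0 < s -> is_derive s 1 F (s `^ (- n - 1)).
    move=> s0; have hd := is_derive1_powR (- n) s0.
    have -> : F = (- n^-1) *: (fun s : R => s `^ (- n)).
      by apply/funext => t; rewrite /F scalrfctE /GRing.scale /=; ring.
    by apply: is_derive_eq; rewrite /GRing.scale /=; field; rewrite gt_eqF.
  rewrite (@Rintegral_ge0_continuous_FTC2y _ _ F _ 0).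
  + by rewrite sub0r /F; field; rewrite gt_eqF.
  + by move=> s xs; exact: powR_ge0.
  + by apply: (powR_within_continuous x0) => s; rewrite !in_itv.
  + rewrite (_ : (0 : R) = - 0 / n); last by rewrite oppr0 mul0r.
    by apply: cvgMl; apply: cvgN; exact: powRN_cvg_pinfty.
  + move=> s xs; apply: (@ex_derive _ _ _ _ _ _ _ (dF _ _)); exact: lt_trans xs.
  + apply: cvg_at_right_filter; apply/differentiable_continuous/derivable1_diffP.
    exact: (@ex_derive _ _ _ _ _ _ _ (dF _ x0)).
  + move=> s; rewrite in_itv/= andbT => xs.
    by rewrite derive1E (@derive_val _ _ _ _ _ _ _ (dF _ _))//; exact: lt_trans xs.
Unshelve. all: by end_near. Qed.

Lemma wint_m0E q c : 0 < c -> - m * wint m h q 0 c = Mq q c.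
Proof.
move=> c0; have [[iz ez] _] := powR_tail_integrals c0.
rewrite /Mq -ez [q * _]mulrCA -mulrDr; congr (_ * _).
rewrite -RintegralZl// -RintegralD//.
- by apply: eq_Rintegral => s _; ring.
- exact: hzero.
- by apply: eq_integrable (integrableZl _ q iz).
Qed.

Lemma wint_n_ooE q a : 0 < a -> n * wint_oo n h q a = Nq q a.
Proof.
move=> a0; have [_ [iz ez]] := powR_tail_integrals a0.
rewrite /Nq -ez [q * _]mulrCA -mulrDr; congr (_ * _).
rewrite -RintegralZl// -RintegralD//.
- by apply: eq_Rintegral => s _; ring.
- by apply: integrableS (hoo 0 a0) => // s /=; rewrite !in_itv/= !andbT => /ltW.
- by apply: eq_integrable (integrableZl _ q iz).
Qed.

Lemma Mq_shift q q' x : Mq q' x = Mq q x + (q' - q) * x `^ (- m).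
Proof. by rewrite /Mq; ring. Qed.

Lemma Nq_shift q q' x : Nq q' x = Nq q x + (q' - q) * x `^ (- n).
Proof. by rewrite /Nq; ring. Qed.

(** c^m M q c is the average of h + q over (0, c] for the probability weight -m c^m s^(-m-1), and h
    is at most h c there. [Nq_ge] is the mirror statement on (a, oo). *)
Lemma Mq_le q c : 0 < c -> Mq q c <= (h c + q) * c `^ (- m).
Proof.
move=> c0; have [[iz ez] _] := powR_tail_integrals c0; have m1 := m0.
rewrite -wint_m0E// -ez mulrCA ler_wpM2l//; first lra.
rewrite -RintegralZl//; apply: le_Rintegral => //.
- exact: hzero.
- by apply: eq_integrable (integrableZl _ (h c + q) iz).
move=> s /=; rewrite in_itv/= => /andP[s0 sc].
by rewrite mulrC ler_wpM2r ?powR_ge0// lerD2r payoff_incr.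
Qed.

Lemma Nq_ge q a : 0 < a -> (h a + q) * a `^ (- n) <= Nq q a.
Proof.
move=> a0; have [_ [iz ez]] := powR_tail_integrals a0; have n1 := n0.
rewrite -wint_n_ooE// -ez mulrCA ler_wpM2l//; first lra.
rewrite -RintegralZl//; apply: le_Rintegral => //.
- by apply: eq_integrable (integrableZl _ (h a + q) iz).
- by apply: integrableS (hoo q a0) => // s /=; rewrite !in_itv/= !andbT => /ltW.
move=> s /=; rewrite in_itv/= andbT => as_.
by rewrite [leRHS]mulrC ler_wpM2r ?powR_ge0// lerD2r payoff_incr// ltW.
Qed.

Lemma Mq_small q c e : 0 < c -> 0 < e -> exists x, [/\ 0 < x, x < c & `|Mq q x| < e].
Proof.
move=> c0 e0.
have lim : - m * wint m h q 0 y @[y --> 0^'+] --> (- m * 0 : R).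
  by apply: cvgMr; exact: (Rintegral_at0 c0 (hzero q c0)).
have [x [x0 xc xe]] : exists x, [/\ 0 < x, x < c & `|- m * wint m h q 0 x| < e].
  have : \forall y \near (0 : R)^'+, [/\ 0 < y, y < c & `|- m * wint m h q 0 y| < e].
    near=> y; split; first by near: y; exact: nbhs_right_gt.
      by near: y; exact: nbhs_right_lt.
    rewrite -normrN -[X in `|X|]sub0r -{1}(mulr0 (- m)); near: y.
    by have /cvgrPdist_lt := lim; exact.
  by move=> /filter_ex.
by exists x; split => //; rewrite -wint_m0E.
Unshelve. all: by end_near. Qed.

Local Notation mun := (- m / n).

Lemma Mq_Nq_up q a c : 0 < a -> a <= c -> (forall s, a < s -> s < c -> 0 <= h s + q) ->
  [/\ 0 <= Nq q a - Nq q c,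
      a `^ (n - m) * (mun * (Nq q a - Nq q c)) <= Mq q c - Mq q a
    & Mq q c - Mq q a <= c `^ (n - m) * (mun * (Nq q a - Nq q c))].
Proof.
by move=> a0 ac hq; exact: (primitive_pair_ge0 m0 n0 a0 ac (Mq_Nq_primitive_pair q a0 ac) hq).
Qed.

Lemma Mq_Nq_down q a c : 0 < a -> a <= c -> (forall s, a < s -> s < c -> h s + q <= 0) ->
  [/\ 0 <= Nq q c - Nq q a,
      a `^ (n - m) * (mun * (Nq q c - Nq q a)) <= Mq q a - Mq q c
    & Mq q a - Mq q c <= c `^ (n - m) * (mun * (Nq q c - Nq q a))].
Proof.
move=> a0 ac hq.
have pp := primitive_pair_scale (-1) a0 (Mq_Nq_primitive_pair q a0 ac).
have hq' s : a < s -> s < c -> 0 <= -1 * (h s + q).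
  by move=> as_ sc; have := hq s as_ sc; lra.
have := primitive_pair_ge0 m0 n0 a0 ac pp hq'.
by rewrite !mulN1r !opprK ![- _ + _]addrC.
Qed.

(** Shifting q to -h a leaves a nonnegative integrand, and the positive rest h a + q multiplies the
    strict change of a power. Strictness thus does not have to come from h, which may be flat. *)
Lemma Mq_Nq_up_strict q a c : 0 < a -> a < c -> 0 < h a + q ->
  Nq q c < Nq q a /\ Mq q a < Mq q c.
Proof.
move=> a0 ac hq; have m1 := m0; have n1 := n0.
have [|h1 h2 _] := @Mq_Nq_up (- h a) a c a0 (ltW ac).
  by move=> s as_ _; have := payoff_incr a0 (ltW as_); lra.
rewrite (Mq_shift (- h a) q a) (Mq_shift (- h a) q c).
rewrite (Nq_shift (- h a) q a) (Nq_shift (- h a) q c).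
have p1 : a `^ (- m) < c `^ (- m) by apply: powR_gt0_mono => //; lra.
have p2 := powRN_mono n1 a0 ac.
have h3 : 0 <= Mq (- h a) c - Mq (- h a) a.
  apply: le_trans h2; apply: mulr_ge0; first exact: powR_ge0.
  by apply: mulr_ge0 => //; apply: divr_ge0; lra.
by split; nra.
Qed.

Lemma Mq_Nq_down_strict q a c : 0 < a -> a < c -> h c + q < 0 ->
  Nq q a < Nq q c /\ Mq q c < Mq q a.
Proof.
move=> a0 ac hq; have m1 := m0; have n1 := n0.
have [|h1 h2 _] := @Mq_Nq_down (- h c) a c a0 (ltW ac).
  by move=> s as_ sc; have := payoff_incr (lt_trans a0 as_) (ltW sc); lra.
rewrite (Mq_shift (- h c) q a) (Mq_shift (- h c) q c).
rewrite (Nq_shift (- h c) q a) (Nq_shift (- h c) q c).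
have p1 : a `^ (- m) < c `^ (- m) by apply: powR_gt0_mono => //; lra.
have p2 := powRN_mono n1 a0 ac.
have h3 : 0 <= Mq (- h c) a - Mq (- h c) c.
  apply: le_trans h2; apply: mulr_ge0; first exact: powR_ge0.
  by apply: mulr_ge0 => //; apply: divr_ge0; lra.
by split; nra.
Qed.

Lemma Mq_unbounded q B a : exists x, [/\ 0 < x, a < x & B < Mq q x].
Proof.
have m1 := m0; have [y [y0 _ hy]] := payoff_unbounded (1 - q) 0.
have mp : 0 < - m by lra.
have [x [x0 ax Bx]] := powR_large (B - Mq q y + y `^ (- m)) (`|a| + y) mp.
have na := ler_norm a; have na' := normr_ge0 a.
exists x; split => //; first lra.
have yx : y <= x by lra.
have [|h1 h2 _] := @Mq_Nq_up (q - (h y + q)) y x y0 yx.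
  by move=> s ys _; have := payoff_incr y0 (ltW ys); lra.
have h3 : 0 <= Mq (q - (h y + q)) x - Mq (q - (h y + q)) y.
  apply: le_trans h2; apply: mulr_ge0; first exact: powR_ge0.
  by apply: mulr_ge0 => //; apply: divr_ge0; have n1 := n0; lra.
move: h3; rewrite (Mq_shift q (q - (h y + q)) x) (Mq_shift q (q - (h y + q)) y) => h3.
have p1 : y `^ (- m) <= x `^ (- m) by apply: ge0_ler_powR; rewrite ?nnegrE; lra.
have h4 : 0 <= (h y + q - 1) * (x `^ (- m) - y `^ (- m)) by apply: mulr_ge0; lra.
lra.
Qed.

(** Below a the integrand is at most h a + q < 0 times s^(-n-1), and the resulting multiple of
    x^(-n) is unbounded as x tends to 0. *)
Lemma Nq_neg_near0 q a : 0 < a -> h a + q < 0 -> exists x, [/\ 0 < x, x < a & Nq q x < 0].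
Proof.
move=> a0 hq; have m1 := m0; have n1 := n0.
have [x [x0 xa Bx]] := powRN_large (Nq q a / - (h a + q) + a `^ (- n)) n1 a0.
exists x; split => //.
have [|h1 _ _] := @Mq_Nq_down (- h a) x a x0 (ltW xa).
  by move=> s xs sa; have := payoff_incr (lt_trans x0 xs) (ltW sa); lra.
have h2 : Nq q a < (x `^ (- n) - a `^ (- n)) * - (h a + q).
  by rewrite -ltr_pdivrMr; lra.
move: h1; rewrite (Nq_shift q (- h a) x) (Nq_shift q (- h a) a) => h1.
by lra.
Qed.

(** On [a, c] increments of M and N are bounded by those of x^(-m) and x^(-n), times a bound of |h +
    q|. *)
Lemma Mq_Nq_continuous q a c : 0 < a -> a <= c ->
  {within `[a, c], continuous (Mq q)} /\ {within `[a, c], continuous (Nq q)}.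
Proof.
move=> a0 ac; have m1 := m0; have n1 := n0.
have cp p : {within `[a, c], continuous (fun s : R => s `^ p)}.
  by apply: (powR_within_continuous a0) => s; rewrite !in_itv/= => /andP[-> _].
have key x y : a <= x -> x <= y -> y <= c ->
    `|Mq q x - Mq q y| <= (`|h a + q| + `|h c + q|) * `|x `^ (- m) - y `^ (- m)| /\
    `|Nq q x - Nq q y| <= (`|h a + q| + `|h c + q|) * `|x `^ (- n) - y `^ (- n)|.
  move=> ax xy yc; have x0 : 0 < x by lra.
  have ha : h a <= h x by exact: payoff_incr.
  have hc : h y <= h c by apply: payoff_incr => //; lra.
  have [|u1 u2 _] := @Mq_Nq_up (- h x) x y x0 xy.
    by move=> s xs _; have := payoff_incr x0 (ltW xs); lra.
  have [|d1 d2 _] := @Mq_Nq_down (- h y) x y x0 xy.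
    by move=> s xs sy; have := payoff_incr (lt_trans x0 xs) (ltW sy); lra.
  have mn0 : 0 <= - m / n by apply: divr_ge0; lra.
  have u3 : 0 <= Mq (- h x) y - Mq (- h x) x.
    by apply: le_trans u2; apply: mulr_ge0; [exact: powR_ge0|exact: mulr_ge0].
  have d3 : 0 <= Mq (- h y) x - Mq (- h y) y.
    by apply: le_trans d2; apply: mulr_ge0; [exact: powR_ge0|exact: mulr_ge0].
  move: u1 u3 d1 d3.
  rewrite !(Mq_shift q (- h x)) !(Mq_shift q (- h y)) !(Nq_shift q (- h x)) !(Nq_shift q (- h y)).
  have pm : x `^ (- m) <= y `^ (- m) by apply: ge0_ler_powR; rewrite ?nnegrE; lra.
  have pn : y `^ (- n) <= x `^ (- n).
    by move: xy; rewrite le_eqVlt => /predU1P[->//|xy]; apply/ltW/powRN_mono.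
  have b1 := ler_norm (h c + q); have b2 := ler_norm (- (h a + q)); rewrite normrN in b2.
  have b3 := normr_ge0 (h c + q); have b4 := normr_ge0 (h a + q).
  move=> u1 u3 d1 d3.
  rewrite (ler0_norm (_ : x `^ (- m) - y `^ (- m) <= 0)); last by lra.
  rewrite (ger0_norm (_ : 0 <= x `^ (- n) - y `^ (- n))); last by lra.
  set B := `|h a + q| + `|h c + q|.
  have hxy : h x <= h y by exact: payoff_incr.
  have hB1 : h y + q <= B by rewrite /B; lra.
  have hB2 : - B <= h x + q by rewrite /B; lra.
  have hm1 : 0 <= (B - (h y + q)) * (y `^ (- m) - x `^ (- m)) by apply: mulr_ge0; lra.
  have hm2 : 0 <= (h x + q + B) * (y `^ (- m) - x `^ (- m)) by apply: mulr_ge0; lra.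
  have hn1 : 0 <= (B - (h y + q)) * (x `^ (- n) - y `^ (- n)) by apply: mulr_ge0; lra.
  have hn2 : 0 <= (h x + q + B) * (x `^ (- n) - y `^ (- n)) by apply: mulr_ge0; lra.
  by split; rewrite ler_norml; apply/andP; split; lra.
split.
  apply: (continuous_dominated (C := `|h a + q| + `|h c + q|) (cp (- m))).
  move=> x y /=; rewrite !in_itv/= => /andP[x1 x2] /andP[y1 y2].
  by have [xy|/ltW yx] := leP x y; [have [] := key x y x1 xy y2|
    rewrite distrC [`|_ - y `^ _|]distrC; have [] := key y x y1 yx x2].
apply: (continuous_dominated (C := `|h a + q| + `|h c + q|) (cp (- n))).
move=> x y /=; rewrite !in_itv/= => /andP[x1 x2] /andP[y1 y2].
by have [xy|/ltW yx] := leP x y; [have [] := key x y x1 xy y2|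
  rewrite distrC [`|_ - y `^ _|]distrC; have [] := key y x y1 yx x2].
Qed.

End Averages.

(** * The algebraic system *)

(* [M q c] stands for the integral -m int_0^c s^(-m-1) [h(s)+q] ds and [N q a] for
   n int_a^oo s^(-n-1) [h(s)+q] ds. *)
Record averages {R : realType} (m n : R) (h : R -> R) (M N : R -> R -> R) : Prop := {
  av_m0 : m < 0;
  av_n0 : 0 < n;
  av_incr : forall x y, 0 < x -> x <= y -> h x <= h y;
  av_unb : forall q a, exists x, [/\ 0 < x, a < x & q < h x];
  av_Mshift : forall q q' x, M q' x = M q x + (q' - q) * x `^ (- m);
  av_Nshift : forall q q' x, N q' x = N q x + (q' - q) * x `^ (- n);
  av_Mle : forall q c, 0 < c -> M q c <= (h c + q) * c `^ (- m);
  av_Nge : forall q a, 0 < a -> (h a + q) * a `^ (- n) <= N q a;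
  av_Msmall : forall q c e, 0 < c -> 0 < e -> exists x, [/\ 0 < x, x < c & `|M q x| < e];
  av_up : forall q a c, 0 < a -> a <= c -> (forall s, a < s -> s < c -> 0 <= h s + q) ->
    [/\ 0 <= N q a - N q c,
        a `^ (n - m) * (- m / n * (N q a - N q c)) <= M q c - M q a
      & M q c - M q a <= c `^ (n - m) * (- m / n * (N q a - N q c))];
  av_down : forall q a c, 0 < a -> a <= c -> (forall s, a < s -> s < c -> h s + q <= 0) ->
    [/\ 0 <= N q c - N q a,
        a `^ (n - m) * (- m / n * (N q c - N q a)) <= M q a - M q c
      & M q a - M q c <= c `^ (n - m) * (- m / n * (N q c - N q a))];
  av_ups : forall q a c, 0 < a -> a < c -> 0 < h a + q -> N q c < N q a /\ M q a < M q c;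
  av_downs : forall q a c, 0 < a -> a < c -> h c + q < 0 -> N q a < N q c /\ M q c < M q a;
  av_Munb : forall q B a, exists x, [/\ 0 < x, a < x & B < M q x];
  av_Nneg : forall q a, 0 < a -> h a + q < 0 -> exists x, [/\ 0 < x, x < a & N q x < 0];
  av_cont : forall q a c, 0 < a -> a <= c ->
    {within `[a, c], continuous (M q)} /\ {within `[a, c], continuous (N q)}
}.

Section Algebra.
Context {R : realType}.
Implicit Types (m n k q x y a c : R) (h : R -> R) (M N : R -> R -> R).

Lemma powR_split m n x : 0 < x -> x `^ (n - m) * x `^ (- n) = x `^ (- m).
Proof.
by move=> x0; rewrite -powRD ?(gt_eqF x0) ?implybT//; congr (_ `^ _); ring.
Qed.

(** The sign at x0 itself is left open: the comparisons over an interval use the sign of h + q only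
    at interior points. *)
Lemma payoff_threshold m n h M N q : averages m n h M N ->
  (exists2 x, 0 < x & h x + q < 0) ->
  exists x0, [/\ 0 < x0, forall s, 0 < s -> s < x0 -> h s + q < 0
    & forall s, x0 < s -> 0 <= h s + q].
Proof.
move=> H [x x0 hx]; pose A : set R := [set s | 0 < s /\ h s + q < 0].
have [B [B0 _ hB]] := av_unb H (- q) 0.
have supA : has_sup A.
  split; first by exists x.
  exists B => s [s0 hs]; rewrite leNgt; apply/negP => Bs.
  by have := av_incr H B0 (ltW Bs); lra.
exists (sup A); split.
- by apply: (lt_le_trans x0); apply: ub_le_sup => //; exact: supA.2.
- move=> s s0 /(sup_gt (ex_intro _ _ (conj x0 hx))) [t [t0 ht] st].
  by have := av_incr H s0 (ltW st); lra.
- move=> s As; rewrite leNgt; apply/negP => hs.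
  have A0 : 0 < sup A by apply: (lt_le_trans x0); apply: ub_le_sup => //; exact: supA.2.
  have : s <= sup A by apply: ub_le_sup; [exact: supA.2|split => //; lra].
  lra.
Qed.

Definition switch_sol M N k k1 (b a : R) :=
  [/\ 0 < b, b < a, M k b = M (- k1) a & N k b = N (- k1) a].

(** If h + k were nonnegative from b on, then N k b >= N k a = N (- k1) a + (k + k1) a^(-n), against
    the second equation. If h stayed below k1 on (b, a), then M (- k1) could not increase there,
    while the first equation makes it grow by (k + k1) b^(-m). *)
Lemma switch_sol_signs m n h M N k k1 b a : averages m n h M N ->
  switch_sol M N k k1 b a -> 0 < k + k1 ->
  h b + k < 0 /\ exists s, [/\ b < s, s < a & k1 < h s].
Proof.
move=> H [b0 ba eM eN] k0; have a0 : 0 < a by lra.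
have pa := powR_gt0 (- n) a0; have pb := powR_gt0 (- m) b0.
split.
  rewrite ltNge; apply/negP => hb.
  have [|u1 _ _] := av_up H (q := k) b0 (ltW ba).
    by move=> s bs _; have := av_incr H b0 (ltW bs); lra.
  have : 0 < (k + k1) * a `^ (- n) by exact: mulr_gt0.
  by move: u1; rewrite eN (av_Nshift H (- k1) k a); lra.
apply: contrapT => nos.
have [|d1 d2 _] := av_down H (q := - k1) b0 (ltW ba).
  move=> s bs sa; rewrite subr_le0 leNgt; apply/negP => hs.
  by apply: nos; exists s.
have d3 : 0 <= M (- k1) b - M (- k1) a.
  apply: le_trans d2; apply: mulr_ge0; first exact: powR_ge0.
  by apply: mulr_ge0 => //; apply: divr_ge0; have := av_m0 H; have := av_n0 H; lra.
have : 0 < (k + k1) * b `^ (- m) by exact: mulr_gt0.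
by move: d3; rewrite -eM (av_Mshift H k (- k1) b); lra.
Qed.

(** For k + k1 <= 0 the equations give M (- k1) a <= M (- k1) b and N (- k1) b >= N (- k1) a. But h
    - k1 changes sign from negative to positive at some x, and the factor between increments of M
    and N is at most (-m/n) x^(n-m) before x and at least that after x; so M (- k1) grows by more
    than that factor times a nonnegative number. The lemma supplies the positivity of k + k1 for the
    pair defining K0_star. *)
Lemma switch_sol_gap m n h M N k k1 b a s : averages m n h M N ->
  switch_sol M N k k1 b a -> b < s -> s < a -> k1 < h s -> 0 < k + k1.
Proof.
move=> H [b0 ba eM eN] bs sa hs; rewrite ltNge; apply/negP => kk.
have m0 := av_m0 H; have n0 := av_n0 H.
have pbn := powR_gt0 (- n) b0; have pbm := powR_gt0 (- m) b0.
have eM' : M (- k1) a - M (- k1) b = (k + k1) * b `^ (- m).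
  by rewrite -eM (av_Mshift H k (- k1) b); ring.
have eN' : N (- k1) b - N (- k1) a = - (k + k1) * b `^ (- n).
  by rewrite -eN (av_Nshift H k (- k1) b); ring.
have neM : M (- k1) a - M (- k1) b <= 0 by rewrite eM' mulr_le0_ge0// ltW.
have neN : 0 <= N (- k1) b - N (- k1) a.
  by rewrite eN'; apply: mulr_ge0; [lra|exact: ltW].
have s0 : 0 < s by lra.
have hs' : 0 < h s + - k1 by lra.
have [hb|hb] := leP 0 (h b + - k1).
  have [|u1 u2 _] := av_up H (q := - k1) b0 (ltW bs).
    by move=> t bt _; have := av_incr H b0 (ltW bt); lra.
  have [_ u3] := av_ups H s0 sa hs'.
  have : 0 <= b `^ (n - m) * (- m / n * (N (- k1) b - N (- k1) s)).
    by apply: mulr_ge0; [exact: powR_ge0|apply: mulr_ge0 => //; apply: divr_ge0; lra].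
  lra.
have [x [x0 xlo xhi]] := payoff_threshold H (ex_intro2 _ _ b b0 hb).
have bx : b <= x by rewrite leNgt; apply/negP => /xhi; lra.
have xs : x <= s by rewrite leNgt; apply/negP => /(xlo _ s0); lra.
(* Beyond t the factor is at least t^(n-m), which is strictly more than x^(n-m); this gives the
   strict inequality. *)
pose t := (s + a) / 2; have st : s < t by rewrite /t; lra.
have ta : t < a by rewrite /t; lra.
have ht : 0 < h t + - k1 by have := av_incr H s0 (ltW st); lra.
have t0 : 0 < t by lra.
have [|d1 _ d3] := av_down H (q := - k1) b0 bx.
  by move=> v bv vx; apply/ltW/xlo => //; lra.
have [||u1 u2 _] := av_up H (q := - k1) x0 (_ : x <= t); first lra.
  by move=> v xv _; exact: xhi.
have [|v1 v2 _] := av_up H (q := - k1) t0 (ltW ta).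
  by move=> v tv _; apply: xhi; lra.
have [v3 _] := av_ups H t0 ta ht.
have pxt : x `^ (n - m) < t `^ (n - m) by apply: powR_gt0_mono; lra.
set X := x `^ (n - m) in d3 u2 pxt; set T := t `^ (n - m) in v2 pxt.
have mn : 0 < - m / n by apply: divr_gt0; lra.
have X0 : 0 < X by exact: powR_gt0.
have w1 : X * (- m / n * (N (- k1) t - N (- k1) a)) < T * (- m / n * (N (- k1) t - N (- k1) a)).
  by rewrite ltr_pM2r// mulr_gt0//; lra.
have w2 : 0 <= X * (- m / n * (N (- k1) b - N (- k1) a)).
  by apply: mulr_ge0; [exact: ltW|apply: mulr_ge0 => //; exact: ltW].
lra.
Qed.

(** In other words a increases strictly with k; k' = k gives uniqueness, and the order will place K0
    relative to K0_star. If b < b', the equations make M k decrease over (b, b') by at least as much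
    as M (- k1) increases over (a', a), while N changes no more on the first interval than on the
    second. But the factor between M and N is at most that of b' on the first and at least that of
    a' > b' on the second. *)
Lemma switch_sol_mono m n h M N k k' k1 b a b' a' : averages m n h M N ->
  switch_sol M N k k1 b a -> switch_sol M N k' k1 b' a' -> 0 < k + k1 ->
  k <= k' -> a' <= a -> [/\ k' = k, b' = b & a' = a].
Proof.
move=> H S S' kk1 kk' aa'; have k'k1 : 0 < k' + k1 by lra.
have [hb [s [bs sa hs]]] := switch_sol_signs H S kk1.
have [hb' [s' [bs' sa' hs']]] := switch_sol_signs H S' k'k1.
have [b0 ba eM eN] := S; have [b'0 ba' eM' eN'] := S'.
have m0 := av_m0 H; have n0 := av_n0 H; have a'0 : 0 < a' by lra.
have mn : 0 < - m / n by apply: divr_gt0; lra.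
have ha' t : a' < t -> 0 < h t + - k1.
  move=> at_; have s'0 : 0 < s' by lra.
  have st : s' <= t by lra.
  by have := av_incr H s'0 st; lra.
have [|u1 u2 _] := av_up H (q := - k1) a'0 aa'.
  by move=> t at_ _; exact/ltW/ha'.
have pb' := powR_gt0 (- m) b'0; have pbn' := powR_gt0 (- n) b'0.
set y := N (- k1) a' - N (- k1) a in u1 u2.
have D0 : 0 <= (k' - k) * b' `^ (- m) by apply: mulr_ge0; [lra|exact: ltW].
have eMk : M k b - M k b' = M (- k1) a - M (- k1) a' + (k' - k) * b' `^ (- m).
  by rewrite eM -eM' (av_Mshift H k k' b'); ring.
have y0' : 0 <= a' `^ (n - m) * (- m / n * y).
  by apply: mulr_ge0; [exact: powR_ge0|apply: mulr_ge0 => //; exact: ltW].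
have [bb'|b'b|bb'] := ltgtP b b'.
- have [|_ _ d3] := av_down H (q := k) b0 (ltW bb').
    by move=> t bt tb'; have := av_incr H (lt_trans b0 bt) (ltW tb'); lra.
  have hb'k : h b' + k < 0 by lra.
  have [d1 _] := av_downs H (q := k) b0 bb' hb'k.
  have eNk : N k b' - N k b = y - (k' - k) * b' `^ (- n).
    by rewrite /y eN -eN' (av_Nshift H k k' b'); ring.
  rewrite eNk in d3.
  have e : b' `^ (n - m) * (- m / n * (y - (k' - k) * b' `^ (- n))) =
    b' `^ (n - m) * (- m / n * y) - - m / n * ((k' - k) * b' `^ (- m)).
    by rewrite -(powR_split m n b'0); ring.
  rewrite e eMk in d3.
  have E0 : 0 <= - m / n * ((k' - k) * b' `^ (- m)) by apply: mulr_ge0 => //; exact: ltW.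
  have pp : b' `^ (n - m) < a' `^ (n - m) by apply: powR_gt0_mono; lra.
  have y00 : y <= 0.
    rewrite leNgt; apply/negP => yp.
    have : b' `^ (n - m) * (- m / n * y) < a' `^ (n - m) * (- m / n * y).
      by rewrite ltr_pM2r// mulr_gt0.
    lra.
  have : (k' - k) * b' `^ (- n) < 0 by lra.
  by rewrite pmulr_llt0//; lra.
- have [_ d2] := av_downs H b'0 b'b hb; lra.
- have kE : k' = k.
    have : (k' - k) * b' `^ (- m) <= 0 by move: eMk; rewrite bb' subrr; lra.
    by rewrite pmulr_lle0//; lra.
  split => //; apply/eqP; rewrite eq_le aa' /= leNgt; apply/negP => a'a.
  pose t := (a' + a) / 2; have a't : a' < t by rewrite /t; lra.
  have ta : t < a by rewrite /t; lra.
  have t0 : 0 < t by lra.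
  have [_ v1] := av_ups H t0 ta (ha' _ a't).
  have [|w1 w2 _] := av_up H (q := - k1) a'0 (ltW a't).
    by move=> v av_ _; exact/ltW/ha'.
  have w3 : 0 <= a' `^ (n - m) * (- m / n * (N (- k1) a' - N (- k1) t)).
    by apply: mulr_ge0; [exact: powR_ge0|apply: mulr_ge0 => //; exact: ltW].
  move: eMk; rewrite bb' kE !subrr mul0r; lra.
Qed.

Lemma switch_sol_unique m n h M N k k1 b a b' a' : averages m n h M N ->
  switch_sol M N k k1 b a -> switch_sol M N k k1 b' a' -> 0 < k + k1 ->
  b' = b /\ a' = a.
Proof.
move=> H S S' kk; have [aa|/ltW aa] := leP a' a.
  by have [_ -> ->] := switch_sol_mono H S S' kk (lexx k) aa.
by have [_ -> ->] := switch_sol_mono H S' S kk (lexx k) aa.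
Qed.

Lemma IVT_dec (f : R -> R) a c : a <= c -> {within `[a, c], continuous f} ->
  0 <= f a -> f c <= 0 -> exists2 x, a <= x <= c & f x = 0.
Proof.
move=> ac cf fa fc; have [|x + fx] := IVT ac cf (_ : _ <= 0 <= _).
  by rewrite ge_min le_max fa fc orbT.
by rewrite in_itv => xac; exists x.
Qed.

Lemma IVT_inc (f : R -> R) a c : a <= c -> {within `[a, c], continuous f} ->
  f a <= 0 -> 0 <= f c -> exists2 x, a <= x <= c & f x = 0.
Proof.
move=> ac cf fa fc; have [|x + fx] := IVT ac cf (_ : _ <= 0 <= _).
  by rewrite ge_min le_max fa fc orbT.
by rewrite in_itv => xac; exists x.
Qed.

Lemma within_continuousB (f g : R -> R) (A : set R) : {within A, continuous f} ->
  {within A, continuous g} -> {within A, continuous (fun x => f x - g x)}.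
Proof.
move=> /subspace_continuousP cf /subspace_continuousP cg; apply/subspace_continuousP.
by move=> x Ax; apply: cvgB; [exact: cf|exact: cg].
Qed.

Lemma within_continuous_cst (v : R) (A : set R) : {within A, continuous (fun=> v)}.
Proof. by apply/subspace_continuousP => x Ax; exact: cvg_cst. Qed.

(** For each a >= a0 the intermediate value theorem gives b = B a with N k b = N (- k1) a, and a
    second use of it, in a, meets the equation for M. Only M k (B a) has to be continuous in a; it
    is, because on [z, b0] increments of M k are dominated by those of N k, which along B are
    increments of N (- k1). *)
Lemma switch_sol_exists m n h M N k k1 : averages m n h M N -> 0 < k + k1 ->
  (exists2 x, 0 < x & h x + k < 0) -> exists b a, switch_sol M N k k1 b a.
Proof.
move=> H kk [x x0 hx]; have m0 := av_m0 H; have n0 := av_n0 H.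
have mn : 0 < - m / n by apply: divr_gt0; lra.
have [b0 [b00 blo bhi]] := payoff_threshold H (ex_intro2 _ _ x x0 hx).
have hx1 : h x + - k1 < 0 by lra.
have [a0 [a00 alo ahi]] := payoff_threshold H (ex_intro2 _ _ x x0 hx1).
have ba0 : b0 <= a0.
  by rewrite leNgt; apply/negP => ab; have := ahi ((a0 + b0) / 2); have := blo ((a0 + b0) / 2); lra.
have [z [z0 zx zN]] := av_Nneg H x0 hx.
have zb0 : z < b0.
  rewrite ltNge; apply/negP => bz; have : 0 <= h x + k by apply: bhi; lra.
  lra.
have Npos a : a0 <= a -> 0 <= N (- k1) a.
  move=> aa; have [t [t0 at_ kt]] := av_unb H k1 a.
  have [||u1 _ _] := av_up H (q := - k1) (_ : 0 < a) (ltW at_); first lra.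
    by move=> s as_ _; apply: ahi; lra.
  have := av_Nge H (- k1) t0; have := powR_gt0 (- n) t0.
  have : 0 < (h t + - k1) * t `^ (- n) by apply: mulr_gt0; [lra|exact: powR_gt0].
  lra.
have ex a : a0 <= a -> exists2 b, z <= b <= b0 & N k b = N (- k1) a.
  move=> aa; have a_0 : 0 < a by lra.
  have [_ cN] := av_cont H k z0 (ltW zb0).
  have cd := within_continuousB cN (@within_continuous_cst (N (- k1) a) _).
  have [||b bz bE] := IVT_inc (ltW zb0) cd.
  - by have := Npos a aa; lra.
  - have [||u1 _ _] := av_up H (q := k) b00 (_ : b0 <= a); first lra.
      by move=> s bs _; exact: bhi.
    have : 0 < (k + k1) * a `^ (- n) by apply: mulr_gt0 => //; exact: powR_gt0.
    by move: u1; rewrite (av_Nshift H (- k1) k a); lra.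
  - by exists b => //; lra.
(* The value 0 for a < a0 only makes the choice function total. *)
have exb a : exists b, a0 <= a -> z <= b <= b0 /\ N k b = N (- k1) a.
  have [aa|aa] := leP a0 a; last by exists 0; lra.
  by have [b ? ?] := ex a aa; exists b.
have [B HB] := choice exb.
(* At A1 the first equation fails in the other direction: M (- k1) A1 > 0, while M k (B A1) <= 0
   since M k does not increase on (0, b0) and is small near 0. *)
have [A1 [A10 aA1 MA1]] := av_Munb H (- k1) 0 a0.
have [cM cN] := av_cont H (- k1) a00 (ltW aA1).
have cMB : {within `[a0, A1], continuous (fun a => M k (B a))}.
  apply: (continuous_dominated (C := b0 `^ (n - m) * (- m / n)) cN).
  have key u v : z <= u -> u <= v -> v <= b0 ->
      `|M k u - M k v| <= b0 `^ (n - m) * (- m / n) * `|N k u - N k v|.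
    move=> zu uv vb; have u0 : 0 < u by lra.
    have [|d1 d2 d3] := av_down H (q := k) u0 uv.
      by move=> s us sv; apply/ltW/blo; lra.
    have pu : 0 <= u `^ (n - m) * (- m / n * (N k v - N k u)).
      by apply: mulr_ge0; [exact: powR_ge0|apply: mulr_ge0 => //; exact: ltW].
    rewrite (ger0_norm (_ : 0 <= M k u - M k v)); last by lra.
    rewrite (ler0_norm (_ : N k u - N k v <= 0)); last by lra.
    rewrite opprB -mulrA; apply: (le_trans d3); apply: ler_wpM2r.
      by apply: mulr_ge0 => //; exact: ltW.
    by apply: ge0_ler_powR; rewrite ?nnegrE; lra.
  move=> u v /=; rewrite !in_itv/= => /andP[u1 u2] /andP[v1 v2].
  have [/andP[bu1 bu2] eu] := HB u u1; have [/andP[bv1 bv2] ev] := HB v v1.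
  rewrite -eu -ev; have [uv|/ltW vu] := leP (B u) (B v); first exact: key.
  by rewrite distrC [`|N k _ - _|]distrC; exact: key.
have [||a /andP[a1 a2] aE] := IVT_dec (ltW aA1) (within_continuousB cMB cM).
- have [/andP[b1 b2] eN] := HB a0 (lexx a0).
  have B0 : 0 < B a0 by lra.
  have [||d1 d2 _] := av_down H (q := - k1) B0 (_ : B a0 <= a0); first lra.
    by move=> s bs sa; apply/ltW/alo; lra.
  have pu : 0 <= B a0 `^ (n - m) * (- m / n * (N (- k1) a0 - N (- k1) (B a0))).
    by apply: mulr_ge0; [exact: powR_ge0|apply: mulr_ge0 => //; exact: ltW].
  have : 0 < (k + k1) * B a0 `^ (- m) by apply: mulr_gt0 => //; exact: powR_gt0.
  by rewrite (av_Mshift H (- k1) k (B a0)); lra.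
- have [/andP[b1 b2] eN] := HB A1 (ltW aA1).
  have B0 : 0 < B A1 by lra.
  have : M k (B A1) <= 0.
    rewrite leNgt; apply/negP => e0.
    have [v [v0 vB vM]] := av_Msmall H k B0 e0.
    have [|d1 d2 _] := av_down H (q := k) v0 (ltW vB).
      by move=> s vs sB; apply/ltW/blo; lra.
    have : 0 <= v `^ (n - m) * (- m / n * (N k (B A1) - N k v)).
      by apply: mulr_ge0; [exact: powR_ge0|apply: mulr_ge0 => //; exact: ltW].
    by have := ler_norm (M k v); lra.
  lra.
have [/andP[b1 b2] eN] := HB a a1.
have Ba : B a <= a by lra.
exists (B a), a; split; [lra| |by lra|by []].
rewrite lt_neqAle Ba andbT; apply/eqP => e.
have : 0 < (k + k1) * a `^ (- m) by apply: mulr_gt0 => //; apply: powR_gt0; lra.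
move: aE; rewrite e (av_Mshift H (- k1) k a); lra.
Qed.

End Algebra.

(** * The pair (delta, gamma) and the critical level *)

Section EntryAlgebra.
Context {R : realType}.
Implicit Types (m n k q x y a c : R) (h : R -> R) (M N : R -> R -> R).

(** Splitting at the midpoint: on the right half the comparison factor strictly exceeds that of
    a. *)
Lemma av_down_lt m n h M N q a c : averages m n h M N -> 0 < a -> a < c -> h c + q < 0 ->
  a `^ (n - m) * (- m / n * (N q c - N q a)) < M q a - M q c.
Proof.
move=> H a0 ac hc; have m0 := av_m0 H; have n0 := av_n0 H.
pose t := (a + c) / 2; have at_ : a < t by rewrite /t; lra.
have tc : t < c by rewrite /t; lra.
have t0 : 0 < t by lra.
have hle s : 0 < s -> s < c -> h s + q <= 0.
  by move=> s0 sc; have := av_incr H s0 (ltW sc); lra.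
have [|_ d2 _] := av_down H (q := q) a0 (ltW at_).
  by move=> s as_ st; apply: hle; lra.
have [|_ e2 _] := av_down H (q := q) t0 (ltW tc).
  by move=> s as_ st; apply: hle; lra.
have [e3 _] := av_downs H t0 tc hc.
have pp : a `^ (n - m) < t `^ (n - m) by apply: powR_gt0_mono; lra.
have : a `^ (n - m) * (- m / n * (N q c - N q t)) < t `^ (n - m) * (- m / n * (N q c - N q t)).
  by rewrite ltr_pM2r// mulr_gt0 ?divr_gt0//; lra.
lra.
Qed.

Definition entry_sol M N k k0 (b d g : R) :=
  [/\ 0 < d, d < g, g < b, M k d = M k0 g & N k d + N k0 b = N k0 g].

(** Increments over (d, g) are compared for h + k0 with the factor at d, and for h + k with the
    factor at g. Since x^(-n) is decreasing, it follows that the d of any solution is at most the g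
    of any other. *)
Lemma entry_sol_bounds m n h M N k k0 (b d g : R) : averages m n h M N -> k < k0 ->
  h b + k0 < 0 -> entry_sol M N k k0 b d g ->
  - m / n * N k0 b <= (k0 - k) * (1 + - m / n) * d `^ (- n) /\
  (k0 - k) * (1 + - m / n) * g `^ (- n) <= - m / n * N k0 b.
Proof.
move=> H kk hb [d0 dg gb eM eN]; have m0 := av_m0 H; have n0 := av_n0 H.
have g0 : 0 < g by lra.
have hle s : 0 < s -> s < b -> h s + k0 <= 0.
  by move=> s0 sb; have := av_incr H s0 (ltW sb); lra.
split.
  have [|_ d2 _] := av_down H (q := k0) d0 (ltW dg).
    by move=> s ds sg; apply: hle; lra.
  rewrite -(ler_pM2l (powR_gt0 (n - m) d0)).
  have e := powR_split m n d0.
  have -> : d `^ (n - m) * ((k0 - k) * (1 + - m / n) * d `^ (- n)) =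
    (k0 - k) * d `^ (- m) + - m / n * ((k0 - k) * d `^ (- m)) by rewrite -e; ring.
  move: d2; rewrite (av_Mshift H k k0 d) (av_Nshift H k k0 d) eM -eN.
  have -> : d `^ (n - m) * (- m / n * (N k d + N k0 b - (N k d + (k0 - k) * d `^ (- n)))) =
    d `^ (n - m) * (- m / n * N k0 b) - - m / n * ((k0 - k) * d `^ (- m)) by rewrite -e; ring.
  lra.
have [|_ _ d3] := av_down H (q := k) d0 (ltW dg).
  by move=> s ds sg; have := hle s; lra.
rewrite -(ler_pM2l (powR_gt0 (n - m) g0)).
have e := powR_split m n g0.
have -> : g `^ (n - m) * ((k0 - k) * (1 + - m / n) * g `^ (- n)) =
  (k0 - k) * g `^ (- m) + - m / n * ((k0 - k) * g `^ (- m)) by rewrite -e; ring.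
move: d3; rewrite (av_Mshift H k0 k g) (av_Nshift H k0 k g) eM -eN.
have -> : g `^ (n - m) * (- m / n * (N k d + N k0 b + (k - k0) * g `^ (- n) - N k d)) =
  g `^ (n - m) * (- m / n * N k0 b) - - m / n * ((k0 - k) * g `^ (- m)) by rewrite -e; ring.
lra.
Qed.

(** The equations equate the change of M k over (d, d') with that of M k0 over (g, g'), and likewise
    for N. If g < g', the factor between M and N is at most that of d' on the first interval and
    effectively more than that of g on the second, although d' <= g. *)
Lemma entry_sol_unique m n h M N k k0 (b d g d' g' : R) : averages m n h M N -> k < k0 ->
  h b + k0 < 0 -> entry_sol M N k k0 b d g -> entry_sol M N k k0 b d' g' ->
  d' = d /\ g' = g.
Proof.
move=> H kk hb; have m0 := av_m0 H; have n0 := av_n0 H.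
have mn : 0 < - m / n by apply: divr_gt0; lra.
wlog gg : d g d' g' / g <= g'.
  move=> W S S'; have [gg|/ltW gg] := leP g g'; first exact: W.
  by have [-> ->] := W _ _ _ _ gg S' S.
move=> S S'; have [_ B2] := entry_sol_bounds H kk hb S.
have [B1 _] := entry_sol_bounds H kk hb S'.
have [d0 dg gb eM eN] := S; have [d'0 dg' gb' eM' eN'] := S'.
have hlt s : 0 < s -> s < b -> h s + k0 < 0.
  by move=> s0 sb; have := av_incr H s0 (ltW sb); lra.
have K0 : 0 < (k0 - k) * (1 + - m / n) by apply: mulr_gt0; lra.
have d'g : d' <= g.
  rewrite leNgt; apply/negP => gd.
  have g0 : 0 < g by lra.
  have pp := powRN_mono n0 g0 gd.
  have : (k0 - k) * (1 + - m / n) * d' `^ (- n) < (k0 - k) * (1 + - m / n) * g `^ (- n).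
    by rewrite ltr_pM2l.
  lra.
have inj u v : 0 < u -> u < b -> 0 < v -> v < b -> M k u <= M k v -> v <= u.
  move=> u0 ub v0 vb Mle; rewrite leNgt; apply/negP => uv.
  have hvk : h v + k < 0 by have := hlt v v0 vb; lra.
  by have [_] := av_downs H u0 uv hvk; lra.
move: gg; rewrite le_eqVlt => /predU1P[ge|gg].
  split=> //; apply/eqP; rewrite eq_le.
  have eMM : M k d = M k d' by rewrite eM eM' ge.
  by apply/andP; split; apply: inj; rewrite ?eMM//; lra.
exfalso; have g0 : 0 < g by lra.
have hg' : h g' + k0 < 0 by apply: hlt; lra.
have z1 := av_down_lt H g0 gg hg'.
have [_ Mg] := av_downs H g0 gg hg'.
have dd : d <= d' by apply: inj; lra.
have [|_ _ z3] := av_down H (q := k) d0 dd.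
  by move=> s ds sd; have := hlt s; lra.
have vE : N k0 g' - N k0 g = N k d' - N k d by lra.
rewrite vE in z1.
have pp : d' `^ (n - m) <= g `^ (n - m) by apply: ge0_ler_powR; rewrite ?nnegrE; lra.
have [|v0 _ _] := av_down H (q := k0) g0 (ltW gg).
  by move=> s gs sg; apply/ltW/hlt; lra.
have : d' `^ (n - m) * (- m / n * (N k d' - N k d)) <= g `^ (n - m) * (- m / n * (N k d' - N k d)).
  apply: ler_wpM2r => //; apply: mulr_ge0; first exact: ltW.
  by rewrite -vE.
lra.
Qed.

(** The negative number M k0 g lies strictly between M k g and the limit 0 of M k at 0. *)
Lemma entry_level m n h M N k k0 (g : R) : averages m n h M N -> k < k0 -> 0 < g ->
  h g + k0 < 0 -> exists d, [/\ 0 < d, d < g & M k d = M k0 g].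
Proof.
move=> H kk g0 hg.
have Mg : M k0 g < 0.
  have := av_Mle H k0 g0; have := powR_gt0 (- m) g0; nra.
have Mg' : 0 < - M k0 g by lra.
have [x [x0 xg xM]] := av_Msmall H k g0 Mg'.
have [cM _] := av_cont H k x0 (ltW xg).
have Mlt : M k g < M k0 g.
  by rewrite (av_Mshift H k k0 g) ltrDl mulr_gt0 ?powR_gt0//; lra.
have cd : {within `[x, g], continuous (fun s => M k s - M k0 g)} := within_continuousB cM (@within_continuous_cst _ (M k0 g) _).
have [||d /andP[d1 d2] dE] := IVT_dec (ltW xg) cd.
- have := ler_norm (- M k x); rewrite normrN; lra.
- lra.
exists d; split; [lra| |lra].
by rewrite lt_neqAle d2 andbT; apply/eqP => e; move: dE; rewrite e; lra.
Qed.

(** The point e is the partner of gamma = beta, for which the equation for N would read N k e = 0.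
    For e <= g the argument is that of uniqueness, with (e, b) in place of the second solution; for
    g < e the bounds above decide. *)
Lemma entry_sol_critical m n h M N k k0 (b d g e : R) : averages m n h M N -> k < k0 ->
  h b + k0 < 0 -> entry_sol M N k k0 b d g ->
  0 < e -> e < b -> M k e = M k0 b -> 0 < N k e.
Proof.
move=> H kk hb S e0 eb eMe; have m0 := av_m0 H; have n0 := av_n0 H.
have mn : 0 < - m / n by apply: divr_gt0; lra.
have [_ B2] := entry_sol_bounds H kk hb S.
have [d0 dg gb eM eN] := S; have g0 : 0 < g by lra.
have hlt s : 0 < s -> s < b -> h s + k0 < 0.
  by move=> s0 sb; have := av_incr H s0 (ltW sb); lra.
have K0 : 0 < (k0 - k) * (1 + - m / n) by apply: mulr_gt0; lra.
have [eg|ge] := leP e g.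
  have z1 := av_down_lt H g0 gb hb.
  have [Nb Mb] := av_downs H g0 gb hb.
  have de : d <= e.
    rewrite leNgt; apply/negP => ed.
    have hdk : h d + k < 0 by have := hlt d d0; lra.
    by have [_] := av_downs H e0 ed hdk; lra.
  have [|v0 _ z3] := av_down H (q := k) d0 de.
    by move=> s ds sd; have := hlt s; lra.
  have pp : e `^ (n - m) <= g `^ (n - m) by apply: ge0_ler_powR; rewrite ?nnegrE; lra.
  have w : e `^ (n - m) * (- m / n * (N k e - N k d)) <= g `^ (n - m) * (- m / n * (N k e - N k d)).
    by apply: ler_wpM2r => //; apply: mulr_ge0 => //; exact: ltW.
  have : g `^ (n - m) * (- m / n * (N k0 b - N k0 g)) < g `^ (n - m) * (- m / n * (N k e - N k d)) by lra.
  rewrite ltr_pM2l ?powR_gt0// ltr_pM2l//; lra.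
have pp := powRN_mono n0 g0 ge.
have w : (k0 - k) * (1 + - m / n) * e `^ (- n) < (k0 - k) * (1 + - m / n) * g `^ (- n).
  by rewrite ltr_pM2l.
have [|_ d2 _] := av_down H (q := k0) e0 (ltW eb).
  by move=> s ds sg; apply/ltW/hlt; lra.
have ee := powR_split m n e0.
move: d2; rewrite (av_Mshift H k k0 e) (av_Nshift H k k0 e) eMe.
have -> : e `^ (n - m) * (- m / n * (N k0 b - (N k e + (k0 - k) * e `^ (- n)))) =
  e `^ (n - m) * (- m / n * (N k0 b - N k e) - - m / n * ((k0 - k) * e `^ (- n))) by ring.
have -> : M k0 b + (k0 - k) * e `^ (- m) - M k0 b = e `^ (n - m) * ((k0 - k) * e `^ (- n)).
  by rewrite -ee; ring.
rewrite ler_pM2l ?powR_gt0// => d2.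
have : 0 < - m / n * N k e by lra.
by rewrite pmulr_rgt0.
Qed.

(** Intermediate value theorem in g, with d = D g determined by the equation for M. At g = b the
    equation for N has the positive defect N k e. *)
Lemma entry_sol_exists m n h M N k k0 (b e : R) : averages m n h M N -> k < k0 ->
  h b + k0 < 0 -> 0 < e -> e < b -> M k e = M k0 b -> 0 < N k e ->
  exists d g, entry_sol M N k k0 b d g.
Proof.
move=> H kk hb e0 eb eMe Ne; have m0 := av_m0 H; have n0 := av_n0 H.
have mn : 0 < - m / n by apply: divr_gt0; lra.
have b0 : 0 < b by lra.
have hlt s : 0 < s -> s <= b -> h s + k0 < 0.
  by move=> s0 sb; have := av_incr H s0 sb; lra.
(* z is so small that (k0 - k) z^(-n) exceeds N k0 b, which makes the defect at z nonpositive. *)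
have [z [z0 zb zN]] := powRN_large (N k0 b / (k0 - k)) n0 b0.
have zN' : N k0 b < (k0 - k) * z `^ (- n) by rewrite mulrC -ltr_pdivrMr//; lra.
have exd g : exists d, z <= g -> g <= b -> [/\ 0 < d, d < g & M k d = M k0 g].
  have [zg|zg] := leP z g; last by exists 0; lra.
  have [gb|gb] := leP g b; last by exists 0; lra.
  have g0 : 0 < g by lra.
  by have [d Hd] := entry_level H kk g0 (hlt g g0 gb); exists d.
have [D HD] := choice exd.
have inj u v : 0 < u -> u <= b -> 0 < v -> v <= b -> M k u <= M k v -> v <= u.
  move=> u0 ub v0 vb Mle; rewrite leNgt; apply/negP => uv.
  have hvk : h v + k < 0 by have := hlt v v0 vb; lra.
  by have [_] := av_downs H u0 uv hvk; lra.
have [Dz0 Dz1 DzM] := HD z (lexx z) (ltW zb).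
have [cM cN] := av_cont H k0 z0 (ltW zb).
have DleM g g' : z <= g -> g <= g' -> g' <= b -> D g <= D g'.
  move=> zg gg gb.
  have [|d1 d2 dM] := HD g zg; first lra.
  have zg' : z <= g' by lra.
  have [e1 e2 eM] := HD g' zg' gb.
  have g0 : 0 < g by lra.
  apply: inj; try lra; rewrite dM eM.
  have [|v0 v1 _] := av_down H (q := k0) g0 gg.
    by move=> s gs sg; apply/ltW/hlt; lra.
  suff : 0 <= M k0 g - M k0 g' by lra.
  apply: le_trans v1; apply: mulr_ge0; first exact: powR_ge0.
  by apply: mulr_ge0 => //; exact: ltW.
have cND : {within `[z, b], continuous (fun g => N k (D g))}.
  (* This time N is dominated by M, so the lower comparison factor is inverted; it is smallest at D
     z because D is nondecreasing. *)
  pose C := (D z `^ (n - m) * (- m / n))^-1.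
  have C'0 : 0 < D z `^ (n - m) * (- m / n) by apply: mulr_gt0 => //; exact: powR_gt0.
  apply: (continuous_dominated (C := C) cM).
  have key u v : z <= u -> u <= v -> v <= b ->
      `|N k (D u) - N k (D v)| <= C * `|M k0 u - M k0 v|.
    move=> zu uv vb.
    have [|d1 d2 dM] := HD u zu; first lra.
    have zv : z <= v by lra.
    have [e1 e2 eM] := HD v zv vb.
    have duv := DleM u v zu uv vb; have dzu := DleM z u (lexx z) zu ltac:(lra).
    have [|v0 v1 _] := av_down H (q := k) d1 duv.
      by move=> s us sv; have := hlt s; lra.
    rewrite -dM -eM.
    have v2 : 0 <= D u `^ (n - m) * (- m / n * (N k (D v) - N k (D u))).
      by apply: mulr_ge0; [exact: powR_ge0|apply: mulr_ge0 => //; exact: ltW].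
    rewrite (ger0_norm (_ : 0 <= M k (D u) - M k (D v))); last by lra.
    rewrite (ler0_norm (_ : N k (D u) - N k (D v) <= 0)); last by lra.
    rewrite opprB /C ler_pdivlMl// -mulrA; apply: le_trans v1; apply: ler_wpM2r.
      by apply: mulr_ge0 => //; exact: ltW.
    by apply: ge0_ler_powR; rewrite ?nnegrE; lra.
  move=> u v /=; rewrite !in_itv/= => /andP[u1 u2] /andP[v1 v2].
  have [uv|/ltW vu] := leP u v; first exact: key.
  by rewrite distrC [`|M k0 _ - _|]distrC; exact: key.
have cPhi : {within `[z, b], continuous (fun g => N k (D g) - N k0 g - (- N k0 b))} := within_continuousB (within_continuousB cND cN)
  (@within_continuous_cst _ (- N k0 b) _).
have [||g /andP[g1 g2] gE] := IVT_inc (ltW zb) cPhi.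
- have zb' : h z + k <= 0 by have := hlt z z0; lra.
  have [|v0 _ _] := av_down H (q := k) Dz0 (ltW Dz1).
    by move=> s us sv; have := hlt s; lra.
  by move: zN'; rewrite (av_Nshift H k k0 z); lra.
- have [|f1 f2 fM] := HD b (ltW zb) ; first exact: lexx.
  have De : D b = e.
    have eMM : M k (D b) = M k e by rewrite fM eMe.
    by apply/eqP; rewrite eq_le; apply/andP; split; apply: inj; rewrite ?eMM//; lra.
  by rewrite De; lra.
have [f1 f2 fM] := HD g g1 g2.
exists (D g), g; split => //; last lra.
rewrite lt_neqAle g2 andbT; apply/eqP => ge.
have De : D g = e.
  have eMM : M k (D g) = M k e by rewrite fM eMe ge.
  by apply/eqP; rewrite eq_le; apply/andP; split; apply: inj; rewrite ?eMM//; lra.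
by move: gE; rewrite De ge; lra.
Qed.

Definition dagger_sol M N k k1 (d a : R) :=
  [/\ 0 < d, d < a, N k d = 0 & M k d = M (- k1) a].

Lemma N_root_sign m n h M N k d : averages m n h M N -> 0 < d -> N k d = 0 -> h d + k < 0.
Proof.
move=> H d0 Nd; rewrite ltNge; apply/negP => hd.
have [t [t0 dt kt]] := av_unb H (- k) d.
have [|u1 _ _] := av_up H (q := k) d0 (ltW dt).
  by move=> s ds _; have := av_incr H d0 (ltW ds); lra.
have := av_Nge H k t0.
have : 0 < (h t + k) * t `^ (- n) by apply: mulr_gt0; [lra|exact: powR_gt0].
lra.
Qed.

Lemma dagger_sol_signs m n h M N k k1 d a : averages m n h M N -> 0 < k + k1 ->
  dagger_sol M N k k1 d a ->
  [/\ h d + k < 0, exists s, [/\ d < s, s < a & k1 < h s] & 0 < N (- k1) a].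
Proof.
move=> H kk [d0 da Nd eM]; have m0 := av_m0 H; have n0 := av_n0 H.
have [s [ds sa hs]] : exists s, [/\ d < s, s < a & k1 < h s].
  apply: contrapT => nos.
  have [|d1 d2 _] := av_down H (q := - k1) d0 (ltW da).
    move=> s bs sa; rewrite subr_le0 leNgt; apply/negP => hs.
    by apply: nos; exists s.
  have d3 : 0 <= M (- k1) d - M (- k1) a.
    apply: le_trans d2; apply: mulr_ge0; first exact: powR_ge0.
    by apply: mulr_ge0 => //; apply: divr_ge0; lra.
  have : 0 < (k + k1) * d `^ (- m) by apply: mulr_gt0 => //; exact: powR_gt0.
  by move: d3; rewrite -eM (av_Mshift H k (- k1) d); lra.
split; [exact: N_root_sign H d0 Nd|by exists s|].
have s0 : 0 < s by lra.
have a0 : 0 < a by lra.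
apply: lt_le_trans (av_Nge H (- k1) a0); apply: mulr_gt0; last exact: powR_gt0.
by have := av_incr H s0 (ltW sa); lra.
Qed.

Lemma dagger_sol_unique m n h M N k k1 d a d' a' : averages m n h M N -> 0 < k + k1 ->
  dagger_sol M N k k1 d a -> dagger_sol M N k k1 d' a' -> d' = d /\ a' = a.
Proof.
move=> H kk; wlog dd : d a d' a' / d <= d'.
  move=> W S S'; have [gg|/ltW gg] := leP d d'; first exact: W.
  by have [-> ->] := W _ _ _ _ gg S' S.
move=> S S'; have [hd [s [ds sa hs]] _] := dagger_sol_signs H kk S.
have [hd' [s' [ds' sa' hs']] _] := dagger_sol_signs H kk S'.
have [d0 da Nd eM] := S; have [d'0 da' Nd' eM'] := S'.
have dE : d' = d.
  apply/eqP; rewrite eq_le dd andbT leNgt; apply/negP => dlt.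
  by have [] := av_downs H d0 dlt hd'; lra.
have Maa : M (- k1) a = M (- k1) a' by rewrite -eM -eM' dE.
split => //; have inc t u : s <= t \/ s' <= t -> t < u -> M (- k1) t < M (- k1) u.
  move=> st tu; have ht : 0 < h t + - k1.
    case: st => st.
      have s0 : 0 < s by lra.
      by have := av_incr H s0 st; lra.
    have s0 : 0 < s' by lra.
    by have := av_incr H s0 st; lra.
  have t0 : 0 < t by case: st; lra.
  by have [] := av_ups H t0 tu ht.
have [aa|aa|//] := ltgtP a' a.
  by have := inc a' a (or_intror (ltW sa')) aa; lra.
by have := inc a a' (or_introl (ltW sa)) aa; lra.
Qed.

Lemma dagger_sol_exists m n h M N k k1 : averages m n h M N -> 0 < k + k1 ->
  (exists2 x, 0 < x & h x + k < 0) -> exists d a, dagger_sol M N k k1 d a.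
Proof.
move=> H kk [x x0 hx].
have [z [z0 zx zN]] := av_Nneg H x0 hx.
have [t [t0 xt kt]] := av_unb H (- k) x.
have zt : z <= t by lra.
have [_ cN] := av_cont H k z0 zt.
have [||d /andP[d1 d2] dE] := IVT_inc zt cN; first exact: ltW.
  apply: le_trans (av_Nge H k t0); apply: mulr_ge0; [lra|exact: powR_ge0].
have d0 : 0 < d by lra.
have [B [B0 dB MB]] := av_Munb H (- k1) (M k d) d.
have [cM _] := av_cont H (- k1) d0 (ltW dB).
have cd : {within `[d, B], continuous (fun s => M (- k1) s - M k d)} := within_continuousB cM (@within_continuous_cst _ (M k d) _).
have Md : M (- k1) d < M k d.
  by rewrite (av_Mshift H (- k1) k d) ltrDl mulr_gt0 ?powR_gt0//; lra.
have [||a /andP[a1 a2] aE] := IVT_inc (ltW dB) cd; try lra.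
exists d, a; split => //; last lra.
by rewrite lt_neqAle a1 andbT; apply/eqP => e; move: aE; rewrite -e; lra.
Qed.

(** Solving M k x = M (- k1) a for k gives [hat_level], and solving N k x = N (- k1) a gives the
    same formula with n and N; [hat_eq] vanishes when the two values agree. For a = alpha_dagger the
    root is xhat and the level is r K0_star. *)
Definition hat_eq m n M N k1 (x a : R) :=
  x `^ m * (M (- k1) x - M (- k1) a) - x `^ n * (N (- k1) x - N (- k1) a).
Definition hat_level m M k1 (x a : R) := - k1 - x `^ m * (M (- k1) x - M (- k1) a).

Lemma hat_switch_sol m n h M N k1 x a : averages m n h M N -> 0 < x -> x < a ->
  hat_eq m n M N k1 x a = 0 -> switch_sol M N (hat_level m M k1 x a) k1 x a.
Proof.
move=> H x0 xa e.
have em p : x `^ p * x `^ (- p) = 1.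
  by rewrite -powRD ?subrr ?powRr0// (gt_eqF x0) implybT.
split => //.
- rewrite (av_Mshift H (- k1) _ x) /hat_level.
  have -> : (- k1 - x `^ m * (M (- k1) x - M (- k1) a) - - k1) * x `^ (- m) =
    - (x `^ m * x `^ (- m)) * (M (- k1) x - M (- k1) a) by ring.
  by rewrite em; ring.
- rewrite (av_Nshift H (- k1) _ x).
  have -> : hat_level m M k1 x a - - k1 = - (x `^ n * (N (- k1) x - N (- k1) a)).
    by rewrite /hat_level; move: e; rewrite /hat_eq; lra.
  have -> : - (x `^ n * (N (- k1) x - N (- k1) a)) * x `^ (- n) =
    - (x `^ n * x `^ (- n)) * (N (- k1) x - N (- k1) a) by ring.
  by rewrite em; ring.
Qed.

(** At d the equations for (d, a) reduce the expression to d^n N (- k1) a > 0; at a point s with h s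
    > k1 both of its terms are negative. *)
Lemma hat_exists m n h M N k k1 d a : averages m n h M N -> 0 < k + k1 ->
  dagger_sol M N k k1 d a -> exists x, [/\ d < x, x < a & hat_eq m n M N k1 x a = 0].
Proof.
move=> H kk S; have [hd [s [ds sa hs]] Na] := dagger_sol_signs H kk S.
have [d0 da Nd eM] := S; have m0 := av_m0 H; have n0 := av_n0 H.
have s0 : 0 < s by lra.
have [cM cN] := av_cont H (- k1) d0 (ltW ds).
have cp p : {within `[d, s], continuous (fun x : R => x `^ p)}.
  by apply: (powR_within_continuous d0) => t; rewrite !in_itv/= => /andP[-> _].
have cmul (f g : R -> R) (A : set R) : {within A, continuous f} ->
    {within A, continuous g} -> {within A, continuous (fun x => f x * g x)}.
  move=> /subspace_continuousP cf /subspace_continuousP cg; apply/subspace_continuousP.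
  by move=> x Ax; apply: cvgM; [exact: cf|exact: cg].
have cE : {within `[d, s], continuous (fun x => hat_eq m n M N k1 x a)}.
  apply: within_continuousB; apply: cmul => //; apply: within_continuousB => //;
    exact: within_continuous_cst.
have em p : d `^ p * d `^ (- p) = 1.
  by rewrite -powRD ?subrr ?powRr0// (gt_eqF d0) implybT.
have Ed : 0 < hat_eq m n M N k1 d a.
  rewrite /hat_eq -eM (av_Mshift H k (- k1) d) (av_Nshift H k (- k1) d) Nd.
  have -> : d `^ m * (M k d + (- k1 - k) * d `^ (- m) - M k d) -
    d `^ n * (0 + (- k1 - k) * d `^ (- n) - N (- k1) a) =
    (- k1 - k) * (d `^ m * d `^ (- m)) - (- k1 - k) * (d `^ n * d `^ (- n))
    + d `^ n * N (- k1) a by ring.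
  rewrite !em subrr add0r; apply: mulr_gt0 => //; exact: powR_gt0.
have Es : hat_eq m n M N k1 s a < 0.
  have hs' : 0 < h s + - k1 by lra.
  have [v1 v2] := av_ups H s0 sa hs'.
  have p1 : 0 < s `^ m * (M (- k1) a - M (- k1) s) by apply: mulr_gt0; [exact: powR_gt0|lra].
  have p2 : 0 < s `^ n * (N (- k1) s - N (- k1) a) by apply: mulr_gt0; [exact: powR_gt0|lra].
  by rewrite /hat_eq; lra.
have [||x /andP[x1 x2] xE] := IVT_dec (ltW ds) cE; try exact: ltW.
exists x; split => //; last lra.
by rewrite lt_neqAle x1 andbT; apply/eqP => e; move: Ed; rewrite e xE ltxx.
Qed.

(** [switch_sol_gap] asks for a point right of x where h exceeds k1; a point between a and the
    larger of s and x serves. *)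
Lemma hat_signs m n h M N k k1 d a x : averages m n h M N -> 0 < k + k1 ->
  dagger_sol M N k k1 d a -> d < x -> x < a -> hat_eq m n M N k1 x a = 0 ->
  0 < hat_level m M k1 x a + k1.
Proof.
move=> H kk S dx xa e; have [hd [s [ds sa hs]] Na] := dagger_sol_signs H kk S.
have [d0 da Nd eM] := S; have x0 : 0 < x by lra.
have SS := hat_switch_sol H x0 xa e.
pose t := (Num.max s x + a) / 2.
have mx : s <= Num.max s x /\ x <= Num.max s x by rewrite !le_max !lexx orbT.
have ma : Num.max s x < a by rewrite gt_max sa xa.
have ht : k1 < h t.
  have s0 : 0 < s by lra.
  have st : s <= t by rewrite /t; lra.
  by have := av_incr H s0 st; lra.
by apply: (switch_sol_gap H SS (s := t)) => //; rewrite /t; lra.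
Qed.

(** Both roots belong to the same a, so monotonicity in the level, applied in the order of the two
    levels, identifies them. *)
Lemma hat_unique m n h M N k k1 d a x x' : averages m n h M N -> 0 < k + k1 ->
  dagger_sol M N k k1 d a -> d < x -> x < a -> hat_eq m n M N k1 x a = 0 ->
  d < x' -> x' < a -> hat_eq m n M N k1 x' a = 0 -> x' = x.
Proof.
move=> H kk S dx xa e dx' xa' e'; have [d0 _ _ _] := S.
have x0 : 0 < x by lra.
have x'0 : 0 < x' by lra.
have s1 := hat_signs H kk S dx xa e; have s2 := hat_signs H kk S dx' xa' e'.
have S1 := hat_switch_sol H x0 xa e; have S2 := hat_switch_sol H x'0 xa' e'.
have [ll|/ltW ll] := leP (hat_level m M k1 x a) (hat_level m M k1 x' a).
  by have [] := switch_sol_mono H S1 S2 s1 ll (lexx a).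
by have [] := switch_sol_mono H S2 S1 s2 ll (lexx a).
Qed.

(** Were the level at most k, then M at that level would be at most M k d at the point d, and it
    equals M k d at x; this contradicts its strict decrease on (d, x). *)
Lemma hat_level_gt m n h M N k k1 d a x : averages m n h M N -> 0 < k + k1 ->
  dagger_sol M N k k1 d a -> d < x -> x < a -> hat_eq m n M N k1 x a = 0 ->
  k < hat_level m M k1 x a /\ h x + hat_level m M k1 x a < 0.
Proof.
move=> H kk S dx xa e; have [d0 da Nd eM] := S; have x0 : 0 < x by lra.
have s1 := hat_signs H kk S dx xa e; have S1 := hat_switch_sol H x0 xa e.
have [hx _] := switch_sol_signs H S1 s1; split => //.
rewrite ltNge; apply/negP => lk; have [_ _ eM1 _] := S1.
have [_] := av_downs H d0 dx hx; rewrite eM1 -eM.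
have : 0 <= (k - hat_level m M k1 x a) * d `^ (- m).
  by apply: mulr_ge0; [lra|exact: powR_ge0].
by rewrite (av_Mshift H (hat_level m M k1 x a) k d); lra.
Qed.

(** The chain is: k0 below the level, al < a, M k et < M k d, d < et, 0 < N k et, solvability. The
    first link is monotonicity of al in k0, the second the equations M k et = M (- k1) al and M k d
    = M (- k1) a, the fourth N k d = 0. *)
Lemma entry_criterion m n h M N k k0 k1 d a x (b al : R) : averages m n h M N ->
  0 < k + k1 -> k < k0 -> dagger_sol M N k k1 d a ->
  d < x -> x < a -> hat_eq m n M N k1 x a = 0 -> switch_sol M N k0 k1 b al ->
  (exists d' g', entry_sol M N k k0 b d' g') <-> k0 < hat_level m M k1 x a.
Proof.
move=> H kk kk0 S dx xa e SS; have [d0 da Nd eM] := S; have x0 : 0 < x by lra.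
have s1 := hat_signs H kk S dx xa e; have S1 := hat_switch_sol H x0 xa e.
have k01 : 0 < k0 + k1 by lra.
have [hb [s [bs sal hs]]] := switch_sol_signs H SS k01.
have [hx [s' [xs' sa' hs']]] := switch_sol_signs H S1 s1.
have [hd _ _] := dagger_sol_signs H kk S.
have [b0 bal eMb eNb] := SS.
have [et [e0 eb eMe]] := entry_level H kk0 b0 hb.
have het : h et + k < 0 by have := av_incr H e0 (ltW eb); lra.
have inc s2 t u : 0 < s2 -> k1 < h s2 -> s2 <= t -> t < u -> M (- k1) t < M (- k1) u.
  move=> s20 hs2 st tu; have ht : 0 < h t + - k1 by have := av_incr H s20 st; lra.
  have t0 : 0 < t by lra.
  by have [] := av_ups H t0 tu ht.
split=> [[d' [g' E]]|k0lt].
  have Ne := entry_sol_critical H kk0 hb E e0 eb eMe.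
  have de : d < et.
    rewrite ltNge; apply/negP; rewrite le_eqVlt => /predU1P[ed|ed]; first by move: Ne; rewrite ed Nd ltxx.
    by have [] := av_downs H e0 ed hd; lra.
  have [_ Mlt] := av_downs H d0 de het.
  rewrite ltNge; apply/negP => lk.
  have [|ala] := leP al a => [ala|]; last first.
    have s'0 : 0 < s' by lra.
    by have := inc s' a al s'0 hs' (ltW sa') ala; lra.
  have [_ _ ea] := switch_sol_mono H S1 SS s1 lk ala.
  by move: Mlt; rewrite eMe eMb ea -eM ltxx.
apply: (entry_sol_exists H kk0 hb e0 eb eMe).
have ala : al < a.
  rewrite ltNge; apply/negP => ala.
  by have [lk _ _] := switch_sol_mono H SS S1 k01 (ltW k0lt) ala; lra.
have s0 : 0 < s by lra.
have Mlt : M k et < M k d by rewrite eMe eMb eM; exact: inc s0 hs (ltW sal) ala.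
have de : d < et.
  rewrite ltNge; apply/negP; rewrite le_eqVlt => /predU1P[ed|ed]; first by move: Mlt; rewrite ed ltxx.
  by have [] := av_downs H e0 ed hd; lra.
by have [] := av_downs H d0 de het; lra.
Qed.

End EntryAlgebra.

(** * Green potentials *)

Section Potential.
Context {R : realType}.
Implicit Types (m n p a c x : R) (rho MM NN u v w : R -> R).

(** The potentials are differentiated through estimates of their increments, for which this form is
    suited. *)
Lemma is_derive_distP (f : R -> R) (x l : R) : is_derive x 1 f l <->
  forall e, 0 < e -> \forall y \near x, `|f y - f x - l * (y - x)| <= e * `|y - x|.
Proof.
split=> [df e e0|H].
  have /cvgrPdist_le/(_ _ e0) : (h^-1 *: ((f \o shift x) (h *: 1) - f x)) @[h --> 0^'] --> l.
    by rewrite -(@derive_val _ _ _ _ _ _ _ df); exact: (@ex_derive _ _ _ _ _ _ _ df).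
  rewrite /dnbhs /within /= -nbhs_nearE => /nbhs_ballP[d /= d0 Hd].
  apply/nbhs_ballP; exists d => //= y; rewrite /ball/= => xy.
  have [->|yx] := eqVneq y x; first by rewrite !subrr mulr0 subrr normr0 mulr0.
  have yx0 : y - x != 0 by rewrite subr_eq0.
  have := Hd (y - x); rewrite /ball/= sub0r normrN distrC => /(_ xy yx0).
  rewrite /GRing.scale/= mulr1 subrK => H.
  have -> : f y - f x - l * (y - x) = - (l - (y - x)^-1 * (f y - f x)) * (y - x) by field.
  by rewrite normrM normrN (distrC x y) ler_wpM2r.
have L : (h^-1 *: ((f \o shift x) (h *: 1) - f x)) @[h --> 0^'] --> l.
  apply/cvgrPdist_le => e e0; have /nbhs_ballP[d /= d0 Hd] := H e e0.
  rewrite /dnbhs /within /= -nbhs_nearE; apply/nbhs_ballP; exists d => //= k.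
  rewrite /ball/= sub0r normrN => kd k0.
  have := Hd (k + x); rewrite /ball/= opprD addrCA subrr addr0 normrN => /(_ kd).
  rewrite /GRing.scale/= mulr1 addrK => H1.
  have kp : 0 < `|k| by rewrite normr_gt0.
  rewrite -(ler_pM2r kp); apply: le_trans H1.
  rewrite -normrM distrC mulrBl; rewrite le_eqVlt; apply/orP; left; apply/eqP.
  by rewrite mulrAC mulVf// mul1r.
split; first by apply/cvg_ex; exists l.
exact/cvg_lim.
Qed.

Lemma is_derive_dominated (f g : R -> R) (x C : R) : f x = 0 -> g x = 0 ->
  is_derive x 1 g 0 -> (\forall y \near x, `|f y| <= C * `|g y|) -> is_derive x 1 f 0.
Proof.
move=> fx gx /is_derive_distP dg H; apply/is_derive_distP => e e0.
have C0 : 0 < `|C| + 1 by rewrite ltr_wpDl.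
have := dg (e / (`|C| + 1)); rewrite divr_gt0// => /(_ isT) dg'.
near=> y.
rewrite fx mul0r !subr0; have : `|f y| <= C * `|g y| by near: y.
have : `|g y| <= e / (`|C| + 1) * `|y - x|.
  by near: y; apply: filterS dg' => z; rewrite gx mul0r !subr0.
move=> g1 f1; apply: (le_trans f1); apply: (@le_trans _ _ ((`|C| + 1) * `|g y|)).
  by rewrite ler_wpM2r// (le_trans (ler_norm C))// lerDl.
by rewrite -ler_pdivlMl// mulrA (mulrC _^-1).
Unshelve. all: by end_near. Qed.

Lemma is_derive_proportional (f g : R -> R) (x l c : R) : f x = 0 -> g x = 0 ->
  is_derive x 1 g l ->
  (forall e, 0 < e -> \forall y \near x, `|f y - c * g y| <= e * `|g y|) ->
  is_derive x 1 f (c * l).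
Proof.
move=> fx gx /is_derive_distP dg H; apply/is_derive_distP => e e0.
have C0 : 0 < `|l| + 1 by rewrite ltr_wpDl.
have c0 : 0 < `|c| + 1 by rewrite ltr_wpDl.
have e1 : 0 < e / 2 / (`|l| + 1) by rewrite !divr_gt0.
have e2 : 0 < e / 2 / (`|c| + 1) by rewrite !divr_gt0.
have H1 := H _ e1; have H2 := dg _ e2; have H3 := dg _ ltr01.
near=> y.
have A1 : `|f y - c * g y| <= e / 2 / (`|l| + 1) * `|g y| by near: y.
have A2 : `|g y - g x - l * (y - x)| <= e / 2 / (`|c| + 1) * `|y - x| by near: y.
have A3 : `|g y - g x - l * (y - x)| <= 1 * `|y - x| by near: y.
rewrite gx subr0 in A2 A3; rewrite fx subr0.
have A4 : `|g y| <= (`|l| + 1) * `|y - x|.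
  have := ler_normD (g y - l * (y - x)) (l * (y - x)); rewrite subrK normrM => h.
  by apply: (le_trans h); rewrite mulrDl [leRHS]addrC lerD2r.
have A5 : `|f y - c * g y| <= e / 2 * `|y - x|.
  apply: (le_trans A1); rewrite -mulrA ler_pM2l ?divr_gt0//.
  by rewrite ler_pdivrMl.
have A6 : `|c * (g y - l * (y - x))| <= e / 2 * `|y - x|.
  rewrite normrM; apply: (@le_trans _ _ ((`|c| + 1) * (e / 2 / (`|c| + 1) * `|y - x|))).
    by apply: ler_pM => //; rewrite lerDl.
  by rewrite mulrA (mulrC (`|c| + 1)) divfK// gt_eqF.
have -> : f y - c * l * (y - x) = (f y - c * g y) + c * (g y - l * (y - x)) by ring.
apply: (le_trans (ler_normD _ _)); rewrite [e in leRHS]splitr mulrDl; exact: lerD.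
Unshelve. all: by end_near. Qed.

Lemma le_of_derive (u v : R -> R) a c : a <= c ->
  (forall x, a <= x -> x <= c -> is_derive x 1 u (v x)) ->
  (forall x, a < x -> x < c -> 0 <= v x) -> u a <= u c.
Proof.
rewrite le_eqVlt => /predU1P[->//|ac] du v0.
have cu : {within `[a, c], continuous u}.
  apply: continuous_in_subspaceT => s; rewrite inE /= in_itv/= => /andP[as_ sc].
  apply/differentiable_continuous/derivable1_diffP.
  exact: (@ex_derive _ _ _ _ _ _ _ (du _ as_ sc)).
have [|z + e] := @MVT _ u v a c ac _ cu.
  by move=> x; rewrite in_itv/= => /andP[ax xc]; apply: du; exact: ltW.
rewrite in_itv/= => /andP[az zc].
by rewrite -subr_ge0 e; apply: mulr_ge0; [exact: v0|rewrite subr_ge0 ltW].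
Qed.

Lemma is_derive_eq_pos (u v : R -> R) x l : 0 < x -> (forall y, 0 < y -> u y = v y) ->
  is_derive x 1 u l -> is_derive x 1 v l.
Proof.
move=> x0 uv; apply: near_eq_is_derive.
by near=> y; apply: uv; near: y; exact: lt_nbhsr.
Unshelve. all: by end_near. Qed.


(** Variation of parameters: formally MM' = -m x^(-m-1) rho and NN' = -n x^(-n-1) rho, whose
    contributions rho / x and -rho / x to the derivative cancel and leave [potential']. *)
Definition potential m n k MM NN x :=
  k * (- (x `^ m * MM x) / m + x `^ n * NN x / n).
Definition potential' m n k MM NN x :=
  k * (x `^ (n - 1) * NN x - x `^ (m - 1) * MM x).

Variables m n : R.
Hypotheses (m0 : m < 0) (n0 : 0 < n).
Variables (rho MM NN : R -> R).
Hypothesis PP : forall a c, 0 < a -> a <= c -> primitive_pair m n rho MM NN a c.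

(* [pE] and [pF] are the parts of the increments of [potential] and [potential']
   from x to y that come from the increments of MM and NN.  Both are linear in the
   rate and vanish at y = x; for the constant rate 1 they are explicit, and
   [pE] is o(y - x). *)
Let pE (M N : R -> R) x y := - (y `^ m * (M y - M x)) / m + y `^ n * (N y - N x) / n.
Let pF (M N : R -> R) x y := y `^ (n - 1) * (N y - N x) - y `^ (m - 1) * (M y - M x).

Lemma increments_right rh (M N : R -> R) x y : 0 < x -> x <= y ->
  primitive_pair m n rh M N x y -> (forall s, x < s -> s < y -> 0 <= rh s) ->
  pE M N x y <= 0 /\ pF M N x y <= 0.
Proof.
move=> x0 xy Q r0; have m1 := m0; have n1 := n0; have y0 : 0 < y by lra.
have [N0 Ml Mu] := primitive_pair_ge0 m0 n0 x0 xy Q r0.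
have yn : y `^ n = y `^ m * y `^ (n - m).
  by rewrite -powRD ?(gt_eqF y0) ?implybT//; congr (_ `^ _); ring.
split.
  have -> : pE M N x y = y `^ m / (- m) * (M y - M x - y `^ (n - m) * (- m / n * (N x - N y))).
    by rewrite /pE yn; field; rewrite ?oppr_eq0 ?(lt_eqF m0) ?(gt_eqF n0).
  apply: mulr_ge0_le0; last lra.
  by apply: divr_ge0; [exact: powR_ge0|lra].
have M0 : 0 <= M y - M x.
  apply: le_trans Ml; apply: mulr_ge0; first exact: powR_ge0.
  by apply: mulr_ge0 => //; apply: divr_ge0; lra.
have : 0 <= y `^ (n - 1) * (N x - N y) by apply: mulr_ge0 => //; exact: powR_ge0.
have : 0 <= y `^ (m - 1) * (M y - M x) by apply: mulr_ge0 => //; exact: powR_ge0.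
by rewrite /pF; lra.
Qed.

Lemma increments_left rh (M N : R -> R) x y : 0 < y -> y <= x ->
  primitive_pair m n rh M N y x -> (forall s, y < s -> s < x -> 0 <= rh s) ->
  pE M N x y <= 0 /\ 0 <= pF M N x y.
Proof.
move=> y0 yx Q r0; have m1 := m0; have n1 := n0.
have [N0 Ml Mu] := primitive_pair_ge0 m0 n0 y0 yx Q r0.
have yn : y `^ n = y `^ m * y `^ (n - m).
  by rewrite -powRD ?(gt_eqF y0) ?implybT//; congr (_ `^ _); ring.
split.
  have -> : pE M N x y = y `^ m / (- m) * (y `^ (n - m) * (- m / n * (N y - N x)) - (M x - M y)).
    by rewrite /pE yn; field; rewrite ?oppr_eq0 ?(lt_eqF m0) ?(gt_eqF n0).
  apply: mulr_ge0_le0; last lra.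
  by apply: divr_ge0; [exact: powR_ge0|lra].
have M0 : 0 <= M x - M y.
  apply: le_trans Ml; apply: mulr_ge0; first exact: powR_ge0.
  by apply: mulr_ge0 => //; apply: divr_ge0; lra.
have : 0 <= y `^ (n - 1) * (N y - N x) by apply: mulr_ge0 => //; exact: powR_ge0.
have : 0 <= y `^ (m - 1) * (M x - M y) by apply: mulr_ge0 => //; exact: powR_ge0.
by rewrite /pF; lra.
Qed.

(** The sign statements are applied to the rates e + (rho - c) and e - (rho - c), which are
    nonnegative between x and y; [pE] and [pF] are linear in the rate. *)
Lemma increments_bound c e x y : 0 < x -> 0 < y -> 0 <= e ->
  (forall s, Num.min x y < s -> s < Num.max x y -> `|rho s - c| <= e) ->
  `|pE MM NN x y - c * pE (fun s => s `^ (- m)) (fun s => s `^ (- n)) x y|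
    <= e * `|pE (fun s => s `^ (- m)) (fun s => s `^ (- n)) x y| /\
  `|pF MM NN x y - c * pF (fun s => s `^ (- m)) (fun s => s `^ (- n)) x y|
    <= e * `|pF (fun s => s `^ (- m)) (fun s => s `^ (- n)) x y|.
Proof.
move=> x0 y0 e0 H.
have Q1 a z : 0 < a -> a <= z -> primitive_pair m n (fun s => rho s + (e - c))
    (fun s => MM s + (e - c) * s `^ (- m)) (fun s => NN s + (e - c) * s `^ (- n)) a z.
  move=> a0 az; apply: primitive_pair_add => //; first exact: PP.
  exact: primitive_pair_cst.
have Q2 a z : 0 < a -> a <= z -> primitive_pair m n (fun s => - 1 * rho s + (e + c))
    (fun s => - 1 * MM s + (e + c) * s `^ (- m))
    (fun s => - 1 * NN s + (e + c) * s `^ (- n)) a z.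
  move=> a0 az; apply: primitive_pair_add => //; last exact: primitive_pair_cst.
  exact/primitive_pair_scale/PP.
have lin (k1 k2 : R) :
    pE (fun s => k1 * MM s + k2 * s `^ (- m)) (fun s => k1 * NN s + k2 * s `^ (- n)) x y =
    k1 * pE MM NN x y + k2 * pE (fun s => s `^ (- m)) (fun s => s `^ (- n)) x y /\
    pF (fun s => k1 * MM s + k2 * s `^ (- m)) (fun s => k1 * NN s + k2 * s `^ (- n)) x y =
    k1 * pF MM NN x y + k2 * pF (fun s => s `^ (- m)) (fun s => s `^ (- n)) x y.
  by rewrite /pE /pF; split; ring.
have [l1 l2] := lin (-1) (e + c); have [l3 l4] := lin 1 (e - c).
have one : ((fun s => MM s + (e - c) * s `^ (- m)) = fun s => 1 * MM s + (e - c) * s `^ (- m)) /\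
   ((fun s => NN s + (e - c) * s `^ (- n)) = fun s => 1 * NN s + (e - c) * s `^ (- n)).
  by split; apply/funext => s; rewrite mul1r.
have [one1 one2] := one; rewrite one1 one2 in Q1.
have [xy|yx] := leP x y.
  have hb s : x < s -> s < y -> - e <= rho s - c <= e.
    by move=> xs sy; rewrite -ler_norml; apply: H; rewrite ?(min_idPl xy) ?(max_idPr xy).
  have [|i1 i2] := increments_right x0 xy (Q1 _ _ x0 xy).
    by move=> s xs sy; have /andP[] := hb s xs sy; lra.
  have [|j1 j2] := increments_right x0 xy (Q2 _ _ x0 xy).
    by move=> s xs sy; have /andP[] := hb s xs sy; lra.
  rewrite l3 l4 in i1 i2; rewrite l1 l2 in j1 j2.
  have p1 := ler_wpM2l e0 (ler_norm (- pE (fun s => s `^ (- m)) (fun s => s `^ (- n)) x y)).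
  have p2 := ler_wpM2l e0 (ler_norm (- pF (fun s => s `^ (- m)) (fun s => s `^ (- n)) x y)).
  by rewrite !normrN in p1 p2; rewrite !ler_norml; split; apply/andP; split; lra.
have hb s : y < s -> s < x -> - e <= rho s - c <= e.
  move=> ys sx; rewrite -ler_norml; apply: H.
    by rewrite (min_idPr (ltW yx)).
  by rewrite (max_idPl (ltW yx)).
have yx' := ltW yx.
have [|i1 i2] := increments_left y0 yx' (Q1 _ _ y0 yx').
  by move=> s ys sx; have /andP[] := hb s ys sx; lra.
have [|j1 j2] := increments_left y0 yx' (Q2 _ _ y0 yx').
  by move=> s ys sx; have /andP[] := hb s ys sx; lra.
rewrite l3 l4 in i1 i2; rewrite l1 l2 in j1 j2.
have p1 := ler_wpM2l e0 (ler_norm (- pE (fun s => s `^ (- m)) (fun s => s `^ (- n)) x y)).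
have p2 := ler_wpM2l e0 (ler_norm (pF (fun s => s `^ (- m)) (fun s => s `^ (- n)) x y)).
by rewrite !normrN in p1; rewrite !ler_norml; split; apply/andP; split; lra.
Qed.

Lemma is_derive_powRZ p q x : 0 < x ->
  is_derive x 1 (fun y : R => q * y `^ p) (q * (p * x `^ (p - 1))).
Proof.
move=> x0; have dp := is_derive1_powR p x0.
exact: (@is_deriveZ _ _ _ _ q _ _ _ dp).
Qed.

Lemma is_derive_powR2 p1 q1 p2 q2 x : 0 < x ->
  is_derive x 1 (fun y : R => q1 * y `^ p1 + q2 * y `^ p2)
    (q1 * (p1 * x `^ (p1 - 1)) + q2 * (p2 * x `^ (p2 - 1))).
Proof.
by move=> x0; apply: is_deriveD; exact: is_derive_powRZ.
Qed.

Let powRB x p q : 0 < x -> x `^ p * x `^ q = x `^ (p + q).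
Proof. by move=> x0; rewrite powRD// (gt_eqF x0) implybT. Qed.

Lemma is_derive_pE1 x : 0 < x ->
  is_derive x 1 (pE (fun s => s `^ (- m)) (fun s => s `^ (- n)) x) 0.
Proof.
move=> x0; have m1 := m0; have n1 := n0.
have D := is_derive_powR2 m (x `^ (- m) / m) n (- (x `^ (- n) / n)) x0.
have D2 : is_derive x 1 (fun y => x `^ (- m) / m * y `^ m + - (x `^ (- n) / n) * y `^ n
    + (- m^-1 + n^-1)) (x `^ (- m) / m * (m * x `^ (m - 1)) +
      - (x `^ (- n) / n) * (n * x `^ (n - 1)) + 0).
  by apply: is_deriveD; exact: is_derive_cst.
have -> : (0 : R) = x `^ (- m) / m * (m * x `^ (m - 1)) +
      - (x `^ (- n) / n) * (n * x `^ (n - 1)) + 0.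
  have -> : x `^ (- m) / m * (m * x `^ (m - 1)) = x `^ (- m) * x `^ (m - 1).
    by field; rewrite lt_eqF.
  have -> : - (x `^ (- n) / n) * (n * x `^ (n - 1)) = - (x `^ (- n) * x `^ (n - 1)).
    by field; rewrite gt_eqF.
  by rewrite !powRB// !addrA !addNr addr0 subrr.
apply: is_derive_eq_pos D2 => // y y0; rewrite /pE !mulrBr !powRB// !subrr !powRr0.
by field; rewrite (lt_eqF m0) (gt_eqF n0).
Qed.

Lemma is_derive_pF1 x : 0 < x ->
  is_derive x 1 (pF (fun s => s `^ (- m)) (fun s => s `^ (- n)) x) ((m - n) * x `^ (- 2)).
Proof.
move=> x0; have m1 := m0; have n1 := n0.
have D := is_derive_powR2 (m - 1) (x `^ (- m)) (n - 1) (- (x `^ (- n))) x0.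
have -> : (m - n) * x `^ (- 2) = x `^ (- m) * ((m - 1) * x `^ (m - 1 - 1)) +
     - x `^ (- n) * ((n - 1) * x `^ (n - 1 - 1)).
  rewrite mulNr ![_ `^ _ * (_ * _)]mulrCA !powRB//.
  rewrite (_ : - m + (m - 1 - 1) = - 2); last ring.
  by rewrite (_ : - n + (n - 1 - 1) = - 2); ring.
apply: is_derive_eq_pos D => // y y0; rewrite /pF !mulrBr !powRB//.
rewrite (_ : n - 1 - n = - 1); last ring.
by rewrite (_ : m - 1 - m = - 1); ring.
Qed.

Let between_near e x c : 0 < x -> (\forall y \near x, `|rho y - c| <= e) ->
  \forall y \near x, 0 < y /\ forall s, Num.min x y < s -> s < Num.max x y -> `|rho s - c| <= e.
Proof.
move=> x0 /nbhs_ballP[d /= d0 Hd].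
near=> y; split; first by near: y; exact: lt_nbhsr.
have : `|x - y| < d by near: y; apply/nbhs_ballP; exists d.
rewrite ltr_norml => /andP[y1 y2] s; rewrite gt_min lt_max => s1 s2.
apply: Hd; rewrite /ball/= ltr_norml.
by move: s1 s2 => /orP[] s1 /orP[] s2; apply/andP; split; lra.
Unshelve. all: by end_near. Qed.

(** Under a bounded rate [pE] is at most C times its value for rate 1, which has derivative 0; the
    rest of the potential is a combination of two powers with coefficients frozen at x. *)
Lemma potential_derive k x C : 0 < x -> (\forall y \near x, `|rho y| <= C) ->
  is_derive x 1 (potential m n k MM NN) (potential' m n k MM NN x) /\
  {for x, continuous (potential' m n k MM NN)}.
Proof.
move=> x0 bd; have C0 : 0 <= C.
  by have := nbhs_singleton bd; apply: le_trans.
have bd' : \forall y \near x, `|rho y - 0| <= C by apply: filterS bd => y; rewrite subr0.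
have near1 := between_near x0 bd'.
split.
  have dE : is_derive x 1 (pE MM NN x) 0.
    apply: (is_derive_dominated (C := C) _ _ (is_derive_pE1 x0)).
    - by rewrite /pE !subrr !mulr0 oppr0 !mul0r addr0.
    - by rewrite /pE !subrr !mulr0 oppr0 !mul0r addr0.
    - apply: filterS near1 => y [y0 Hy].
      by have [] := increments_bound x0 y0 C0 Hy; rewrite mul0r subr0.
  have D := is_derive_powR2 m (- MM x / m) n (NN x / n) x0.
  have D2 : is_derive x 1 (fun y => k * ((- MM x / m) * y `^ m + (NN x / n) * y `^ n + pE MM NN x y))
      (k * ((- MM x / m) * (m * x `^ (m - 1)) + (NN x / n) * (n * x `^ (n - 1)) + 0)).
    have D1 := @is_deriveD _ _ _ _ _ _ _ _ _ D dE.
    exact: (@is_deriveZ _ _ _ _ k _ _ _ D1).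
  have -> : potential' m n k MM NN x =
      k * ((- MM x / m) * (m * x `^ (m - 1)) + (NN x / n) * (n * x `^ (n - 1)) + 0).
    by rewrite /potential'; field; rewrite (lt_eqF m0) (gt_eqF n0).
  apply: is_derive_eq_pos D2 => // y y0.
  by rewrite /potential /pE; field; rewrite (lt_eqF m0) (gt_eqF n0).
have F0 : pF MM NN x y @[y --> x] --> (0 : R).
  have cF1 : (C * `|pF (fun s => s `^ (- m)) (fun s => s `^ (- n)) x y|) @[y --> x] --> (0 : R).
    have c1 : {for x, continuous (pF (fun s => s `^ (- m)) (fun s => s `^ (- n)) x)}.
      apply/differentiable_continuous/derivable1_diffP.
      exact: (@ex_derive _ _ _ _ _ _ _ (is_derive_pF1 x0)).
    have e0 : pF (fun s => s `^ (- m)) (fun s => s `^ (- n)) x x = 0.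
      by rewrite /pF !subrr !mulr0 subr0.
    have : (C * `|pF (fun s => s `^ (- m)) (fun s => s `^ (- n)) x y|) @[y --> x] -->
       (C * `|pF (fun s => s `^ (- m)) (fun s => s `^ (- n)) x x|).
      by apply: cvgMr; apply: cvg_norm; exact: c1.
    by rewrite e0 normr0 mulr0.
  apply/norm_cvg0P; apply: (squeeze_cvgr _ (cvg_cst (0 : R)) cF1).
  apply: filterS near1 => y [y0 Hy]; rewrite normr_ge0/=.
  by have [_] := increments_bound x0 y0 C0 Hy; rewrite mul0r subr0.
have cv : (NN x * y `^ (n - 1) + (- MM x) * y `^ (m - 1)) @[y --> x] -->
    (NN x * x `^ (n - 1) + (- MM x) * x `^ (m - 1)).
  by apply: cvgD; apply: cvgMr; exact: powR_continuous_at.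
have E : potential' m n k MM NN = fun y => k * (NN x * y `^ (n - 1) + - MM x * y `^ (m - 1) + pF MM NN x y).
  by apply/funext => y; rewrite /potential' /pF; ring.
have Ex : potential' m n k MM NN x = k * (NN x * x `^ (n - 1) + - MM x * x `^ (m - 1) + 0).
  by rewrite /potential'; ring.
have L : (fun y => k * (NN x * y `^ (n - 1) + - MM x * y `^ (m - 1) + pF MM NN x y)) @ x -->
    k * (NN x * x `^ (n - 1) + - MM x * x `^ (m - 1) + 0).
  by apply: cvgMr; exact: cvgD cv F0.
by rewrite -E -Ex in L.
Qed.

(** Where the rate is continuous, [pF] is rho x + o(1) times its explicit value for rate 1. *)
Lemma potential_derive2 k x : 0 < x -> {for x, continuous rho} ->
  is_derive x 1 (potential' m n k MM NN)
   (k * ((n - 1) * x `^ (n - 2) * NN x - (m - 1) * x `^ (m - 2) * MM x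
     - (n - m) * rho x * x `^ (- 2))).
Proof.
move=> x0 cr.
have dF : is_derive x 1 (pF MM NN x) (rho x * ((m - n) * x `^ (- 2))).
  apply: (is_derive_proportional _ _ (is_derive_pF1 x0)).
  - by rewrite /pF !subrr !mulr0 subr0.
  - by rewrite /pF !subrr !mulr0 subr0.
  - move=> e e0; have := cr; rewrite /continuous_at => /cvgrPdist_le/(_ _ e0) near0.
    have near1 : \forall y \near x, `|rho y - rho x| <= e.
      by apply: filterS near0 => y; rewrite distrC.
    apply: filterS (between_near x0 near1) => y [y0 Hy].
    by have [_] := increments_bound x0 y0 (ltW e0) Hy.
have D := is_derive_powR2 (n - 1) (NN x) (m - 1) (- MM x) x0.
have D2 : is_derive x 1 (fun y => k * (NN x * y `^ (n - 1) + - MM x * y `^ (m - 1) + pF MM NN x y))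
   (k * (NN x * ((n - 1) * x `^ (n - 1 - 1)) + - MM x * ((m - 1) * x `^ (m - 1 - 1)) +
     rho x * ((m - n) * x `^ (- 2)))).
  have D1 := @is_deriveD _ _ _ _ _ _ _ _ _ D dF.
  exact: (@is_deriveZ _ _ _ _ k _ _ _ D1).
have e2 p : p - 1 - 1 = p - 2 :> R by ring.
rewrite !e2 in D2.
apply: (is_derive_eq_pos x0) => [y y0|]; last first.
  rewrite (_ : k * _ = k * (NN x * ((n - 1) * x `^ (n - 2)) + - MM x * ((m - 1) * x `^ (m - 2)) +
     rho x * ((m - n) * x `^ (- 2)))); [exact: D2|ring].
by rewrite /potential' /pF; ring.
Qed.

End Potential.

Section Verification.
Context {R : realType}.
Implicit Types (k x y a c : R) (rho MM NN u : R -> R).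

Lemma pair_glue (Q : R -> R -> Prop) p q :
  (forall a b c, 0 < a -> a <= b -> b <= c -> Q a b -> Q b c -> Q a c) ->
  0 < p -> p <= q ->
  (forall a c, 0 < a -> a <= c -> c <= p -> Q a c) ->
  (forall a c, p <= a -> a <= c -> c <= q -> Q a c) ->
  forall a c, 0 < a -> a <= c -> c <= q -> Q a c.
Proof.
move=> cat p0 pq Q1 Q2 a c a0 ac cq.
have [cp|pc] := leP c p; first exact: Q1.
have [pa|ap] := leP p a; first exact: Q2.
by apply: (cat a p c) => //; [exact: ltW|exact: ltW|apply: Q1 => //; exact: ltW|apply: Q2 => //; exact: ltW].
Qed.

Variables b sg r : R.
Hypotheses (sg0 : sg != 0) (r0 : 0 < r).
Local Notation m := (root_m b sg r).
Local Notation n := (root_n b sg r).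
Local Notation kap := ((sg ^+ 2 * (n - m))^-1).

Lemma root_eq : [/\ sg ^+ 2 * m ^+ 2 + (b - sg ^+ 2) * m - r = 0,
   sg ^+ 2 * n ^+ 2 + (b - sg ^+ 2) * n - r = 0 & m * n = - r / sg ^+ 2].
Proof.
have s2 : 0 <= (b - sg ^+ 2) ^+ 2 + 4 * sg ^+ 2 * r.
  apply: addr_ge0; first exact: sqr_ge0.
  by apply: mulr_ge0; [apply: mulr_ge0 => //; exact: sqr_ge0|exact: ltW].
have := sqr_sqrtr s2; rewrite /root_m /root_n; set q := Num.sqrt _ => e.
have s0 : sg ^+ 2 != 0 by rewrite expf_neq0.
have d0 : 2 * sg ^+ 2 != 0 by rewrite mulf_neq0.
have e' : (b - sg ^+ 2) ^+ 2 = q ^+ 2 - 4 * sg ^+ 2 * r by rewrite e addrK.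
split.
- have -> : sg ^+ 2 * ((sg ^+ 2 - b - q) / (2 * sg ^+ 2)) ^+ 2 +
    (b - sg ^+ 2) * ((sg ^+ 2 - b - q) / (2 * sg ^+ 2)) - r =
    (q ^+ 2 - ((b - sg ^+ 2) ^+ 2 + 4 * sg ^+ 2 * r)) / (4 * sg ^+ 2) by field.
  by rewrite e subrr mul0r.
- have -> : sg ^+ 2 * ((sg ^+ 2 - b + q) / (2 * sg ^+ 2)) ^+ 2 +
    (b - sg ^+ 2) * ((sg ^+ 2 - b + q) / (2 * sg ^+ 2)) - r =
    (q ^+ 2 - ((b - sg ^+ 2) ^+ 2 + 4 * sg ^+ 2 * r)) / (4 * sg ^+ 2) by field.
  by rewrite e subrr mul0r.
- have -> : (sg ^+ 2 - b - q) / (2 * sg ^+ 2) * ((sg ^+ 2 - b + q) / (2 * sg ^+ 2)) =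
    ((b - sg ^+ 2) ^+ 2 - q ^+ 2) / (4 * sg ^+ 2 * sg ^+ 2) by field.
  by rewrite e'; field.
Qed.

Hypotheses (m0 : m < 0) (n0 : 0 < n).
Variable h : R -> R.

Lemma potential_solves rho MM NN (F : set R) u :
  (forall a c, 0 < a -> a <= c -> primitive_pair m n rho MM NN a c) ->
  (forall x, 0 < x -> exists C, \forall y \near x, `|rho y| <= C) ->
  (forall x, regular_points h F x -> {for x, continuous rho}) ->
  (forall x, 0 < x -> potential m n kap MM NN x = u x) ->
  [/\ C1_C2_off h F u,
      forall x, 0 < x -> is_derive x 1 u (potential' m n kap MM NN x)
    & forall x, regular_points h F x ->
      sg ^+ 2 * x ^+ 2 * derive1 (derive1 u) x + b * x * derive1 u x - r * u x = - rho x].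
Proof.
move=> PP bd cr uE.
have du x : 0 < x -> is_derive x 1 u (potential' m n kap MM NN x).
  move=> x0; have [C HC] := bd x x0; have [d1 _] := potential_derive m0 n0 PP kap x0 HC.
  exact: is_derive_eq_pos d1.
have u'E x : 0 < x -> potential' m n kap MM NN x = derive1 u x.
  by move=> x0; rewrite derive1E (@derive_val _ _ _ _ _ _ _ (du x x0)).
have du' x : regular_points h F x -> is_derive x 1 (derive1 u)
   (kap * ((n - 1) * x `^ (n - 2) * NN x - (m - 1) * x `^ (m - 2) * MM x
     - (n - m) * rho x * x `^ (- 2))).
  move=> Sx; have [x0 _] := Sx.
  exact: is_derive_eq_pos (potential_derive2 m0 n0 PP kap x0 (cr x Sx)).
have sgn : sg ^+ 2 != 0 by rewrite expf_neq0.
have ode x : regular_points h F x ->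
    sg ^+ 2 * x ^+ 2 * derive1 (derive1 u) x + b * x * derive1 u x - r * u x = - rho x.
  move=> Sx; have [x0 _] := Sx.
  rewrite [derive1 (derive1 u) x]derive1E (@derive_val _ _ _ _ _ _ _ (du' x Sx)) -u'E// -uE//.
  have xn0 : x != 0 by rewrite gt_eqF.
  have p1 p : x `^ (p - 1) = x `^ p / x.
    by rewrite powRD ?(gt_eqF x0) ?implybT// powRN powRr1// ltW.
  have p2 p : x `^ (p - 2) = x `^ p / x / x by rewrite -!p1; congr (_ `^ _); ring.
  have p3 : x `^ (- 2) = x^-1 / x.
    by rewrite -[X in x `^ X]add0r p2 powRr0 mul1r.
  rewrite /potential /potential' !p1 !p2 p3.
  have [em en _] := root_eq.
  have m1 : m != 0 by rewrite lt_eqF.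
  have n1 : n != 0 by rewrite gt_eqF.
  have nm : n - m != 0 by rewrite gt_eqF// subr_gt0; exact: lt_trans m0 n0.
  have -> : sg ^+ 2 * x ^+ 2 * (kap * ((n - 1) * (x `^ n / x / x) * NN x -
     (m - 1) * (x `^ m / x / x) * MM x - (n - m) * rho x * (x^-1 / x))) +
     b * x * (kap * (x `^ n / x * NN x - x `^ m / x * MM x)) -
     r * (kap * (- (x `^ m * MM x) / m + x `^ n * NN x / n)) =
     kap * (x `^ n * NN x / n * (sg ^+ 2 * n ^+ 2 + (b - sg ^+ 2) * n - r)
     - x `^ m * MM x / m * (sg ^+ 2 * m ^+ 2 + (b - sg ^+ 2) * m - r)) - rho x.
    by field; rewrite ?nm ?xn0 ?m1 ?n1 ?sg0.
  by rewrite em en !mulr0 subr0 mulr0 add0r.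
split=> //; split.
- by move=> x x0; exact: (@ex_derive _ _ _ _ _ _ _ (du x x0)).
- move=> x x0; have [C HC] := bd x x0; have [_ c1] := potential_derive m0 n0 PP kap x0 HC.
  rewrite /prop_for /continuous_at -u'E//; apply: cvg_trans c1; apply: near_eq_cvg.
  by near=> y; apply: u'E; near: y; exact: lt_nbhsr.
- by move=> x Sx; exact: (@ex_derive _ _ _ _ _ _ _ (du' x Sx)).
apply/subspace_continuousP => x Sx; have [x0 _] := Sx.
(* Continuity of the second derivative is read off the equation: phi is the second derivative at
   regular points and is continuous there as a function of all nearby points. *)
pose phi y := (r * potential m n kap MM NN y - b * y * potential' m n kap MM NN y - rho y) / (sg ^+ 2 * y ^+ 2).
have phiE y : regular_points h F y -> phi y = derive1 (derive1 u) y.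
  move=> Sy; have [y0 _] := Sy; rewrite /phi uE// u'E//.
  have yn0 : y != 0 by rewrite gt_eqF.
  have := ode y Sy; set d2 := derive1 (derive1 u) y => o.
  have -> : r * u y - b * y * derive1 u y - rho y = sg ^+ 2 * y ^+ 2 * d2 by lra.
  by field; rewrite ?yn0 ?sg0.
have [C HC] := bd x x0; have [d1 c1] := potential_derive m0 n0 PP kap x0 HC.
have c0 : {for x, continuous (potential m n kap MM NN)}.
  apply/differentiable_continuous/derivable1_diffP.
  exact: (@ex_derive _ _ _ _ _ _ _ d1).
have cphi : phi y @[y --> x] --> phi x.
  apply: cvgM.
    apply: cvgB; last exact: cr.
    apply: cvgB; first exact: cvgMr.
    by apply: cvgM => //; apply: cvgMr; exact: cvg_id.
  apply: cvgV; first by rewrite mulf_neq0 ?expf_neq0// gt_eqF.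
  by apply: cvgMr; apply: cvgM; exact: cvg_id.
suff L : derive1 (derive1 u) y @[y --> within (regular_points h F) (nbhs x)] -->
    derive1 (derive1 u) x by exact: L.
rewrite -phiE//; apply: (@cvg_trans _ (phi y @[y --> within (regular_points h F) (nbhs x)])).
  apply: near_eq_cvg; rewrite near_withinE; near=> y => Sy; exact: phiE.
by apply: cvg_within_filter.
Unshelve. all: by end_near. Qed.

End Verification.

(** * Verification of the HJB equation *)

Section Pieces.
Context {R : realType}.
Local Notation mu := (@lebesgue_measure R).
Variables (m n : R) (h : R -> R) (M N : R -> R -> R).
Hypothesis H : averages m n h M N.
Hypothesis PPh : forall a c, 0 < a -> a <= c -> primitive_pair m n h (M 0) (N 0) a c.
Variables k k0 k1 be al d g : R.
Hypotheses (kk0 : k < k0) (k01 : 0 < k0 + k1).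
Hypotheses (SS : switch_sol M N k0 k1 be al) (ES : entry_sol M N k k0 be d g).

Definition rate1 x := if x <= d then - k else if x <= g then h x
  else if x <= be then - k0 else h x.
(** The rate is accumulated from 0 in [M1] and from infinity in [N1]. Neighbouring formulas agree at
    d and be by the shift rules alone; their agreement at g is the pair of equations in
    [entry_sol]. *)
Definition M1 x := if x <= d then - k * x `^ (- m) else if x <= g then M 0 x - M k d
  else if x <= be then - k0 * x `^ (- m) else M 0 x - M k0 be.
Definition N1 x := if x <= d then - k * x `^ (- n) else if x <= g then N 0 x - N k d
  else if x <= be then - k0 * x `^ (- n) + N k0 be else N 0 x.
Definition rate0 x := if x <= al then 0 else h x - k1.
Definition M0 x := if x <= al then 0 else M (- k1) x - M (- k1) al.
Definition N0 x := if x <= al then N (- k1) al else N (- k1) x.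

Lemma primitive_pair_eq rho rho' MM NN MM' NN' a c km kn : 0 < a ->
  (forall s, a < s -> s <= c -> rho s = rho' s) ->
  MM' c = MM c + km -> MM' a = MM a + km -> NN' c = NN c + kn -> NN' a = NN a + kn ->
  primitive_pair m n rho MM NN a c -> primitive_pair m n rho' MM' NN' a c.
Proof.
move=> a0 rr e1 e2 e3 e4 PP; apply: (primitive_pair_ext a0 _ _ e1 e2 e3 e4 PP).
  by move=> s s1 s2; apply: rr => //; exact: ltW.
case: PP => ir _ _; apply: eq_integrable ir => // s; rewrite inE /= in_itv/= => /andP[s1 s2].
by rewrite rr.
Qed.

Lemma boundary_order : [/\ 0 < d, d < g, g < be & be < al].
Proof. by have [? ? _ _] := SS; have [? ? ? _ _] := ES. Qed.

Lemma pair1_low x : x <= d -> [/\ rate1 x = - k, M1 x = - k * x `^ (- m) & N1 x = - k * x `^ (- n)].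
Proof. by move=> xd; rewrite /rate1 /M1 /N1 xd. Qed.

Lemma pair1_mid x : d <= x -> x <= g -> M1 x = M 0 x - M k d /\ N1 x = N 0 x - N k d.
Proof.
rewrite /M1 /N1 le_eqVlt => /predU1P[<-|dx] xg; last by rewrite leNgt dx xg.
by rewrite lexx (av_Mshift H 0 k d) (av_Nshift H 0 k d); split; ring.
Qed.

Lemma pair1_flat x : g <= x -> x <= be ->
  M1 x = - k0 * x `^ (- m) /\ N1 x = - k0 * x `^ (- n) + N k0 be.
Proof.
have [d0 dg gbe beal] := boundary_order; have [_ _ _ eM eN] := ES.
rewrite /M1 /N1 le_eqVlt => /predU1P[<-|gx] xbe.
  rewrite leNgt dg lexx /= (av_Mshift H k0 0 g) (av_Nshift H k0 0 g) eM -eN.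
  by split; ring.
by rewrite !leNgt gx (lt_trans dg gx)/= -leNgt xbe.
Qed.

Lemma pair1_top x : be <= x -> M1 x = M 0 x - M k0 be /\ N1 x = N 0 x.
Proof.
have [d0 dg gbe beal] := boundary_order.
rewrite /M1 /N1 le_eqVlt => /predU1P[<-|bx].
  rewrite !leNgt gbe (lt_trans dg gbe) ltxx /= (av_Mshift H k0 0 be) (av_Nshift H k0 0 be).
  by split; ring.
by rewrite !leNgt bx (lt_trans gbe bx) (lt_trans dg (lt_trans gbe bx)).
Qed.

Lemma pair1 a c : 0 < a -> a <= c -> primitive_pair m n rate1 M1 N1 a c.
Proof.
move=> a0 ac; have m0 := av_m0 H; have n0 := av_n0 H.
have [d0 dg gbe beal] := boundary_order.
have g0 : 0 < g by lra.
have be0 : 0 < be by lra.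
have cat := @primitive_pair_cat R m n rate1 M1 N1.
suff Q q : be <= q -> forall u v, 0 < u -> u <= v -> v <= q -> primitive_pair m n rate1 M1 N1 u v.
  by apply: (Q (Num.max be c)) => //; rewrite le_max lexx ?orbT.
move=> beq; apply: (pair_glue (p := be)) => //.
- apply: (pair_glue (p := g)) => //; first exact: ltW.
  + apply: (pair_glue (p := d)) => //; first exact: ltW.
    * move=> u v u0 uv vd; have ud := le_trans uv vd.
      have [_ e1 e3] := pair1_low vd; have [_ e2 e4] := pair1_low ud.
      apply: (primitive_pair_eq (km := 0) (kn := 0) u0 _ _ _ _ _
        (primitive_pair_cst m0 n0 (- k) u0 uv)); rewrite ?addr0//.
      by move=> s s1 s2; have [->] := pair1_low (le_trans s2 vd).
    * move=> u v du uv vg; have u0 : 0 < u by lra.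
      have [e1 e3] := pair1_mid (le_trans du uv) vg.
      have [e2 e4] := pair1_mid du (le_trans uv vg).
      apply: (primitive_pair_eq (km := - M k d) (kn := - N k d) u0 _ _ _ _ _ (PPh u0 uv)) => //.
      move=> s s1 s2; rewrite /rate1 (le_trans s2 vg) leNgt.
      by rewrite (le_lt_trans du s1).
  + move=> u v gu uv vb; have u0 : 0 < u by lra.
    have [e1 e3] := pair1_flat (le_trans gu uv) vb.
    have [e2 e4] := pair1_flat gu (le_trans uv vb).
    apply: (primitive_pair_eq (km := 0) (kn := N k0 be) u0 _ _ _ _ _
      (primitive_pair_cst m0 n0 (- k0) u0 uv)); rewrite ?addr0//.
    move=> s s1 s2; rewrite /rate1 (le_trans s2 vb).
    by rewrite !leNgt (le_lt_trans gu s1) (lt_trans dg (le_lt_trans gu s1)).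
- move=> u v bu uv vq; have u0 : 0 < u by lra.
  have [e1 e3] := pair1_top (le_trans bu uv).
  have [e2 e4] := pair1_top bu.
  apply: (primitive_pair_eq (km := - M k0 be) (kn := 0) u0 _ _ _ _ _ (PPh u0 uv)); rewrite ?addr0//.
  move=> s s1 s2; have bs := le_lt_trans bu s1.
  by rewrite /rate1 !leNgt bs (lt_trans gbe bs) (lt_trans dg (lt_trans gbe bs)).
Qed.

Lemma pair0_low x : x <= al -> [/\ rate0 x = 0, M0 x = 0 & N0 x = N (- k1) al].
Proof. by move=> xa; rewrite /rate0 /M0 /N0 xa. Qed.

Lemma pair0_top x : al <= x -> M0 x = M (- k1) x - M (- k1) al /\ N0 x = N (- k1) x.
Proof.
rewrite /M0 /N0 le_eqVlt => /predU1P[<-|ax]; last by rewrite leNgt ax.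
by rewrite lexx subrr.
Qed.

Lemma pair0 a c : 0 < a -> a <= c -> primitive_pair m n rate0 M0 N0 a c.
Proof.
move=> a0 ac; have m0 := av_m0 H; have n0 := av_n0 H.
have [d0 dg gbe beal] := boundary_order.
have al0 : 0 < al by lra.
have cat := @primitive_pair_cat R m n rate0 M0 N0.
suff Q q : al <= q -> forall u v, 0 < u -> u <= v -> v <= q -> primitive_pair m n rate0 M0 N0 u v.
  by apply: (Q (Num.max al c)) => //; rewrite le_max lexx ?orbT.
move=> alq; apply: (pair_glue (p := al)) => //.
- move=> u v u0 uv va; have ua := le_trans uv va.
  have [_ e1 e3] := pair0_low va; have [_ e2 e4] := pair0_low ua.
  apply: (primitive_pair_eq (km := 0) (kn := N (- k1) al) u0 _ _ _ _ _
    (primitive_pair_cst m0 n0 0 u0 uv)); rewrite ?mul0r ?addr0 ?add0r//.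
  by move=> s s1 s2; have [->] := pair0_low (le_trans s2 va).
- move=> u v au uv vq; have u0 : 0 < u by lra.
  have [e1 e3] := pair0_top (le_trans au uv); have [e2 e4] := pair0_top au.
  have Q := primitive_pair_add u0 (PPh u0 uv) (primitive_pair_cst m0 n0 (- k1) u0 uv).
  apply: (primitive_pair_eq (km := - M (- k1) al) (kn := 0) u0 _ _ _ _ _ Q).
  + by move=> s s1 s2; rewrite /rate0 leNgt (le_lt_trans au s1).
  + by rewrite e1 (av_Mshift H 0 (- k1) v) subr0.
  + by rewrite e2 (av_Mshift H 0 (- k1) u) subr0.
  + by rewrite e3 (av_Nshift H 0 (- k1) v) subr0 addr0.
  + by rewrite e4 (av_Nshift H 0 (- k1) u) subr0 addr0.
Qed.

Definition flux (MM NN : R -> R) x := x `^ n * NN x - x `^ m * MM x.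

Lemma powR_mulN (x p : R) : 0 < x -> x `^ p * x `^ (- p) = 1.
Proof. by move=> x0; rewrite -powRD ?subrr ?powRr0// (gt_eqF x0) implybT. Qed.

(** For the difference of the two rates it is enough to find one level q that separates the average
    over (0, x) from the average over (x, oo). *)
Lemma flux_le (MM NN MM' NN' : R -> R) q x : 0 < x ->
  MM x - MM' x <= q * x `^ (- m) -> q * x `^ (- n) <= NN x - NN' x ->
  flux MM' NN' x <= flux MM NN x.
Proof.
move=> x0 hM hN.
have p1 := ler_wpM2l (powR_ge0 x m) hM; have p2 := ler_wpM2l (powR_ge0 x n) hN.
have e1 : x `^ m * (q * x `^ (- m)) = q by rewrite mulrCA powR_mulN// mulr1.
have e2 : x `^ n * (q * x `^ (- n)) = q by rewrite mulrCA powR_mulN// mulr1.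
by rewrite e1 in p1; rewrite e2 in p2; rewrite /flux; lra.
Qed.

Lemma flux_ge0 (MM NN : R -> R) q x : 0 < x -> MM x <= q * x `^ (- m) ->
  q * x `^ (- n) <= NN x -> 0 <= flux MM NN x.
Proof.
move=> x0 hM hN; have := @flux_le MM NN (fun=> 0) (fun=> 0) q x x0.
by rewrite {1}/flux !mulr0 subrr !subr0; apply.
Qed.

(** The increment is at most (h x + q) (x^(-m) - a^(-m)), and the term with a is dropped. *)
Lemma M_chord a x q : 0 < a -> a <= x -> 0 <= h x + q ->
  M q x - M q a <= (h x + q) * x `^ (- m).
Proof.
move=> a0 ax hq; have [|_ d2 _] := av_down H (q := - h x) a0 ax.
  by move=> s as_ sx; have := av_incr H (lt_trans a0 as_) (ltW sx); lra.
have m0 := av_m0 H; have n0 := av_n0 H.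
have [|N0' _ _] := av_down H (q := - h x) a0 ax.
  by move=> s as_ sx; have := av_incr H (lt_trans a0 as_) (ltW sx); lra.
have d0 : 0 <= M (- h x) a - M (- h x) x.
  apply: le_trans d2; apply: mulr_ge0; first exact: powR_ge0.
  by apply: mulr_ge0 => //; apply: divr_ge0; lra.
have p : 0 <= (h x + q) * a `^ (- m) by apply: mulr_ge0 => //; exact: powR_ge0.
by move: d0; rewrite (av_Mshift H q (- h x) a) (av_Mshift H q (- h x) x); lra.
Qed.

Lemma N_chord a x q : 0 < x -> x <= a -> h x + q <= 0 ->
  (h x + q) * x `^ (- n) <= N q x - N q a.
Proof.
move=> x0 xa hq; have [|d0 _ _] := av_up H (q := - h x) x0 xa.
  by move=> s xs sa; have := av_incr H x0 (ltW xs); lra.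
have p : 0 <= - (h x + q) * a `^ (- n) by apply: mulr_ge0; [lra|exact: powR_ge0].
by move: d0; rewrite (av_Nshift H q (- h x) a) (av_Nshift H q (- h x) x); lra.
Qed.

Lemma chord_down q a x : 0 < a -> a <= x -> (forall s, s < x -> 0 < s -> h s + q <= 0) ->
  N q a <= N q x /\ M q x <= M q a.
Proof.
move=> a0 ax hs; have m0 := av_m0 H; have n0 := av_n0 H.
have [|d1 d2 _] := av_down H (q := q) a0 ax.
  by move=> s as_ sx; apply: hs => //; lra.
split; first lra.
suff : 0 <= M q a - M q x by lra.
apply: le_trans d2; apply: mulr_ge0; first exact: powR_ge0.
by apply: mulr_ge0 => //; apply: divr_ge0; lra.
Qed.

Lemma chord_up q a x : 0 < a -> a <= x -> (forall s, a < s -> 0 <= h s + q) ->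
  N q x <= N q a /\ M q a <= M q x.
Proof.
move=> a0 ax hs; have m0 := av_m0 H; have n0 := av_n0 H.
have [|d1 d2 _] := av_up H (q := q) a0 ax; first by move=> s as_ _; apply: hs.
split; first lra.
suff : 0 <= M q x - M q a by lra.
apply: le_trans d2; apply: mulr_ge0; first exact: powR_ge0.
by apply: mulr_ge0 => //; apply: divr_ge0; lra.
Qed.

Lemma payoff_neg s : 0 < s -> s <= be -> h s + k0 < 0.
Proof.
move=> s0 sb; have [hb _] := switch_sol_signs H SS k01.
by have := av_incr H s0 sb; lra.
Qed.

Lemma payoff_pos s : al <= s -> k1 < h s.
Proof.
move=> sa; have [_ [t [bt ta ht]]] := switch_sol_signs H SS k01.
have [d0 dg gbe beal] := boundary_order.
have t0 : 0 < t by lra.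
have ts : t <= s by lra.
by have := av_incr H t0 ts; lra.
Qed.

Lemma N_alpha_gt0 : 0 < N (- k1) al.
Proof.
have [d0 dg gbe beal] := boundary_order; have al0 : 0 < al by lra.
apply: lt_le_trans (av_Nge H (- k1) al0); apply: mulr_gt0; last exact: powR_gt0.
by have := payoff_pos (lexx al); lra.
Qed.

Lemma coef_signs : [/\ M k0 be < 0, 0 < N (- k1) al, M k0 g < 0 & N k0 g - N k0 be < 0].
Proof.
have [d0 dg gbe beal] := boundary_order; have g0 : 0 < g by lra.
have be0 : 0 < be by lra.
have neg x : 0 < x -> x <= be -> M k0 x < 0.
  move=> x0 xb; apply: (le_lt_trans (av_Mle H k0 x0)).
  by rewrite pmulr_llt0 ?powR_gt0//; exact: payoff_neg.
split; [exact: neg|exact: N_alpha_gt0|apply: neg => //; exact: ltW|].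
by have [] := av_downs H g0 gbe (payoff_neg be0 (lexx be)); lra.
Qed.

Lemma flux0_ge0 x : 0 < x -> 0 <= flux M0 N0 x.
Proof.
move=> x0; have [d0 dg gbe beal] := boundary_order; have al0 : 0 < al by lra.
have [xa|ax] := leP x al.
  have [_ e1 e2] := pair0_low xa; rewrite /flux e1 e2 mulr0 subr0.
  by apply: mulr_ge0; [exact: powR_ge0|exact/ltW/N_alpha_gt0].
have hx := payoff_pos (ltW ax); have [e1 e2] := pair0_top (ltW ax).
apply: (flux_ge0 (q := h x - k1)) => //; rewrite ?e1 ?e2; last exact: (av_Nge H).
by apply: M_chord => //; [exact: ltW|lra].
Qed.

Lemma flux1_low x : 0 < x -> x <= d -> flux M1 N1 x = 0.
Proof.
move=> x0 xd; have [_ e1 e2] := pair1_low xd; rewrite /flux e1 e2.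
by rewrite !mulrA ![_ `^ _ * - k]mulrC -!mulrA !powR_mulN// subrr.
Qed.

(** The separating level is -k on (d, g], -k0 on (g, be], and beyond be it is h x or -k0 according
    to the sign of h x + k0. *)
Lemma flux1_ge0 x : 0 < x -> 0 <= flux M1 N1 x.
Proof.
move=> x0; have [d0 dg gbe beal] := boundary_order; have be0 : 0 < be by lra.
have [xd|dx] := leP x d; first by rewrite flux1_low.
have [xg|gx] := leP x g.
  have [e1 e2] := pair1_mid (ltW dx) xg.
  have [|v1 v2] := @chord_down k d x d0 (ltW dx).
    have kk := kk0; move=> s sx s0; have sb : s <= be by lra.
    by have := payoff_neg s0 sb; lra.
  apply: (flux_ge0 (q := - k)) => //; rewrite ?e1 ?e2.
    by rewrite (av_Mshift H k 0 x); lra.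
  by rewrite (av_Nshift H k 0 x); lra.
have [xb|bx] := leP x be.
  have [e1 e2] := pair1_flat (ltW gx) xb.
  have [_ _ _ eN] := SS; have := N_alpha_gt0; rewrite -eN => N0'.
  by apply: (flux_ge0 (q := - k0)) => //; rewrite ?e1 ?e2//; lra.
have [e1 e2] := pair1_top (ltW bx).
have sM := av_Mshift H k0 0 x; have sN := av_Nshift H k0 0 x.
have [hx|hx] := leP 0 (h x + k0).
  have := M_chord be0 (ltW bx) hx; have := av_Nge H k0 x0 => v1 v2.
  by apply: (flux_ge0 (q := h x)) => //; rewrite ?e1 ?e2; lra.
have [|v1 v2] := @chord_down k0 be x be0 (ltW bx).
  by move=> s sx s0; have := av_incr H s0 (ltW sx); lra.
have [_ _ _ eN] := SS; have := N_alpha_gt0; rewrite -eN => N0'.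
by apply: (flux_ge0 (q := - k0)) => //; rewrite ?e1 ?e2; lra.
Qed.

(** With the level k0 the equations at g turn both inequalities into the monotonicity of M k0 and N
    k0 on (x, g), where h + k0 < 0. *)
Lemma flux_gap_low x : 0 < x -> x <= g -> flux M1 N1 x <= flux M0 N0 x.
Proof.
move=> x0 xg; have [d0 dg gbe beal] := boundary_order.
have xa : x <= al by lra.
have [xd|dx] := leP x d; first by rewrite flux1_low// flux0_ge0.
have [e1 e2] := pair1_mid (ltW dx) xg; have [_ e3 e4] := pair0_low xa.
have [|v1 v2] := @chord_down k0 x g x0 xg.
  move=> s sx s0; have sb : s <= be by lra.
  by have := payoff_neg s0 sb; lra.
have [_ _ _ eN] := SS; have [_ _ _ eMe eNe] := ES.
apply: (flux_le (q := k0)) => //; rewrite ?e1 ?e2 ?e3 ?e4.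
  by rewrite (av_Mshift H k0 0 x); lra.
by rewrite (av_Nshift H k0 0 x); lra.
Qed.

(** The separating level is h x clipped to [-k0, k1]. *)
Lemma flux_gap_high x : be <= x -> x <= al -> flux M0 N0 x <= flux M1 N1 x.
Proof.
move=> bx xa; have [d0 dg gbe beal] := boundary_order.
have be0 : 0 < be by lra.
have x0 : 0 < x by lra.
have [e1 e2] := pair1_top bx; have [_ e3 e4] := pair0_low xa.
have [_ _ eM eN] := SS.
have sM q := av_Mshift H q 0 x; have sN q := av_Nshift H q 0 x.
have [h1|h1] := leP (h x + k0) 0.
  have [|v1 v2] := @chord_down k0 be x be0 bx.
    by move=> s sx s0; have := av_incr H s0 (ltW sx); lra.
  apply: (flux_le (q := - k0)) => //; rewrite ?e1 ?e2 ?e3 ?e4.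
    by have := sM k0; lra.
  by have := sN k0; lra.
have [h2|h2] := leP k1 (h x).
  have [|v1 v2] := @chord_up (- k1) x al x0 xa.
    by move=> s xs; have := av_incr H x0 (ltW xs); lra.
  apply: (flux_le (q := k1)) => //; rewrite ?e1 ?e2 ?e3 ?e4.
    by have := sM (- k1); lra.
  by have := sN (- k1); lra.
have v1 := M_chord be0 bx (ltW h1).
have h3 : h x + - k1 <= 0 by lra.
have v2 := N_chord x0 xa h3.
apply: (flux_le (q := h x)) => //; rewrite ?e1 ?e2 ?e3 ?e4.
  by have := sM k0; lra.
by have := sN (- k1); lra.
Qed.

Lemma rates_bounded (x : R) : 0 < x ->
  exists C, \forall y \near x, `|rate1 y| <= C /\ `|rate0 y| <= C.
Proof.
move=> x0; exists (`|h (x / 2)| + `|h (2 * x)| + `|k| + `|k0| + `|k1|).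
have x2 : x / 2 < x by lra.
have xx : x < 2 * x by lra.
near=> y.
have y1 : x / 2 < y by near: y; exact: lt_nbhsr.
have y2 : y < 2 * x by near: y; exact: lt_nbhsl.
have hx0 : 0 < x / 2 by lra.
have y0 : 0 < y by lra.
have h1 := av_incr H hx0 (ltW y1); have h2 := av_incr H y0 (ltW y2).
have hy : `|h y| <= `|h (x / 2)| + `|h (2 * x)|.
  have := ler_norm (h (2 * x)); have := ler_norm (- h (x / 2)); rewrite normrN => n1 n2.
  have := normr_ge0 (h (x / 2)); have := normr_ge0 (h (2 * x)) => n3 n4.
  by rewrite ler_norml; apply/andP; split; lra.
have n1 := normr_ge0 (h (x / 2)); have n2 := normr_ge0 (h (2 * x)).
have n3 := normr_ge0 k; have n4 := normr_ge0 k0; have n5 := normr_ge0 k1.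
split; rewrite /rate1 /rate0; repeat case: ifP => _; rewrite ?normrN ?normr0; try lra.
by apply: (le_trans (ler_normB _ _)); lra.
Unshelve. all: by end_near. Qed.

Lemma rates_continuous (x : R) : 0 < x -> {for x, continuous h} ->
  x != d -> x != g -> x != be -> x != al ->
  {for x, continuous rate1} /\ {for x, continuous rate0}.
Proof.
move=> x0 ch xd xg xb xa.
have side (p : R) : x != p -> \forall y \near x, (y <= p) = (x <= p).
  move=> xp; have [lt|gt|e] := ltgtP x p; last by rewrite e eqxx in xp.
  - by near=> y; apply/ltW; near: y; exact: lt_nbhsl.
  - by near=> y; apply/negbTE; rewrite -ltNge; near: y; exact: lt_nbhsr.
have piece (p : R) (u v : R -> R) : x != p -> {for x, continuous u} -> {for x, continuous v} ->
    {for x, continuous (fun y => if y <= p then u y else v y)}.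
  move=> xp cu cv; have near0 := side p xp.
  have L : (if y <= p then u y else v y) @[y --> x] --> (if x <= p then u x else v x).
    apply: (@cvg_trans _ ((if x <= p then u y else v y) @[y --> x])).
      by apply: near_eq_cvg; apply: filterS near0 => y ->.
    by case: ifP => _; [exact: cu|exact: cv].
  exact: L.
have cc (q : R) : {for x, continuous (fun=> q)} by exact: cvg_cst.
split; first by do 3! [apply: (piece) => //].
by apply: (piece) => //; apply: cvgB; [exact: ch|exact: cvg_cst].
Unshelve. all: by end_near. Qed.

End Pieces.

(** * The piecewise functions as potentials, and the variational inequalities *)

Section HJBAssembly.
Context {R : realType}.
Variables b sg r : R.
Hypotheses (sg0 : sg != 0) (r0 : 0 < r).
Local Notation m := (root_m b sg r).
Local Notation n := (root_n b sg r).
Local Notation kap := ((sg ^+ 2 * (n - m))^-1).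
Variables (h : R -> R) (M N : R -> R -> R).
Hypothesis H : averages m n h M N.
Hypothesis PPh : forall a c, 0 < a -> a <= c -> primitive_pair m n h (M 0) (N 0) a c.
Hypothesis wintM : forall q c, 0 < c -> - m * wint m h q 0 c = M q c.
Hypothesis wintN : forall q a, 0 < a -> n * wint_oo n h q a = N q a.
Hypothesis wintD : forall q a c, 0 < a -> a <= c -> n * wint n h q a c = N q a - N q c.
Variables K K0 K1 be al d g : R.
Hypotheses (K_0 : 0 <= K) (KK0 : K < K0) (K1_0 : 0 < K1).
Hypothesis SS : switch_sol M N (r * K0) (r * K1) be al.
Hypothesis ES : entry_sol M N (r * K) (r * K0) be d g.

Local Notation M1' := (M1 m M (r * K) (r * K0) be d g).
Local Notation N1' := (N1 n N (r * K) (r * K0) be d g).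
Local Notation M0' := (M0 M (r * K1) al).
Local Notation N0' := (N0 N (r * K1) al).
Local Notation w1 := (w1_fun b sg r h K K1 K0 d g be al).
Local Notation w0 := (w0_fun b sg r h K1 K0 be al).

Let m0 : m < 0. Proof. exact: av_m0 H. Qed.
Let n0 : 0 < n. Proof. exact: av_n0 H. Qed.
Let mN0 : m != 0. Proof. by rewrite lt_eqF. Qed.
Let nN0 : n != 0. Proof. by rewrite gt_eqF. Qed.
Let nmN0 : n - m != 0.
Proof. by have m1 := m0; have n1 := n0; rewrite gt_eqF//; lra. Qed.
Let kap0 : 0 < kap.
Proof.
have m1 := m0; have n1 := n0; rewrite invr_gt0; apply: mulr_gt0; last lra.
by rewrite lt_neqAle sqr_ge0 andbT eq_sym expf_neq0.
Qed.
Let kk0 : r * K < r * K0. Proof. by rewrite ltr_pM2l. Qed.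
Let k01 : 0 < r * K0 + r * K1.
Proof. by have k1 := K1_0; have k2 := K_0; have k3 := KK0; rewrite -mulrDr mulr_gt0//; lra. Qed.

(** This rests on m n = -r / sg^2 and makes q / r the potential of the constant rate q. *)
Lemma kap_root : kap * (n^-1 - m^-1) = r^-1.
Proof.
have [_ _ e] := root_eq b sg0 r0; have nm : n - m != 0.
  by have m1 := m0; have n1 := n0; rewrite gt_eqF//; lra.
have -> : n^-1 - m^-1 = - (n - m) / (m * n) by field; rewrite ?mN0 ?nN0 ?nmN0 ?sg0 ?(gt_eqF r0).
by rewrite e; field; rewrite ?nm ?sg0 ?(gt_eqF r0).
Qed.

Let wintME q c : 0 < c -> wint m h q 0 c = M q c / - m.
Proof. by move=> c0; rewrite -wintM//; field; rewrite ?oppr_eq0. Qed.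
Let wintNE q a : 0 < a -> wint_oo n h q a = N q a / n.
Proof. by move=> a0; rewrite -wintN//; field. Qed.
Let wintDE q a c : 0 < a -> a <= c -> wint n h q a c = (N q a - N q c) / n.
Proof. by move=> a0 ac; rewrite -wintD//; field. Qed.
Let mulN (x p : R) : 0 < x -> x `^ p * x `^ (- p) = 1.
Proof. by move=> x0; rewrite -powRD ?subrr ?powRr0// (gt_eqF x0) implybT. Qed.

Lemma coefficients : [/\ A_coef b sg r h K0 be = kap / m * M (r * K0) be,
   B_coef b sg r h K1 al = kap / n * N (- (r * K1)) al,
   Gamma1_coef b sg r h K0 g = kap / m * M (r * K0) g
 & Gamma2_coef b sg r h K0 g be = - (kap / n) * (N (r * K0) g - N (r * K0) be)].
Proof.
have [d0 dg gbe beal] := boundary_order SS ES.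
have g0 : 0 < g by lra.
have be0 : 0 < be by lra.
have al0 : 0 < al by lra.
rewrite /A_coef /B_coef /Gamma1_coef /Gamma2_coef wintNE// wintDE ?(ltW gbe)// !wintME//.
have e z : - kap * (z / - m) = kap / m * z by field; rewrite ?mN0 ?nmN0 ?sg0.
by rewrite !e; split => //; ring.
Qed.

Lemma coefficients_gt0 : [/\ 0 < A_coef b sg r h K0 be, 0 < B_coef b sg r h K1 al,
   0 < Gamma1_coef b sg r h K0 g & 0 < Gamma2_coef b sg r h K0 g be].
Proof.
have [-> -> -> ->] := coefficients; have [s1 s2 s3 s4] := coef_signs H k01 SS ES.
have k0' : kap / m < 0 by rewrite pmulr_rlt0// invr_lt0.
have k0'' : 0 < kap / n by rewrite divr_gt0.
split.
- by rewrite nmulr_rgt0.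
- exact: mulr_gt0.
- by rewrite nmulr_rgt0.
- by rewrite mulNr oppr_gt0 pmulr_rlt0.
Qed.

Let RhE x : 0 < x -> R_h b sg r h x = kap * (x `^ m * (M 0 x / - m) + x `^ n * (N 0 x / n)).
Proof. by move=> x0; rewrite /R_h wintME// wintNE. Qed.

Let cst_potential q x c : 0 < x -> kap * (- (x `^ m * (q * x `^ (- m))) / m
   + x `^ n * (q * x `^ (- n) + c) / n) = q / r + kap / n * c * x `^ n.
Proof.
move=> x0; have e1 p : x `^ p * (q * x `^ (- p)) = q by rewrite mulrCA mulN// mulr1.
rewrite (mulrDr (x `^ n)) !e1 -kap_root.
by field; rewrite ?mN0 ?nN0 ?nmN0 ?sg0 ?(gt_eqF r0).
Qed.

Lemma w1_potential x : 0 < x -> potential m n kap M1' N1' x = w1 x.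
Proof.
move=> x0; have [d0 dg gbe beal] := boundary_order SS ES.
have [_ _ eM eN] := SS; have [_ _ _ eMe eNe] := ES.
have [cA cB c1 c2] := coefficients; rewrite /w1_fun cA cB c1 c2 RhE// /potential.
have [xd|dx] := leP x d.
  have [_ -> ->] := pair1_low m n h M N (r * K) (r * K0) be g xd.
  have := cst_potential (- (r * K)) 0 x0; rewrite addr0 => ->.
  by field; rewrite ?mN0 ?nN0 ?nmN0 ?sg0 ?(gt_eqF r0).
have [xg|gx] := ltP x g.
  have [-> ->] := pair1_mid H (r * K) (r * K0) be (ltW dx) (ltW xg).
  by rewrite eMe -eNe; field; rewrite ?mN0 ?nN0 ?nmN0 ?sg0 ?(gt_eqF r0).
have [xb|bx] := leP x be.
  have [-> ->] := pair1_flat H SS ES gx xb.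
  (* The coefficient of x^n involves N_{rK0}(be); [eN] turns it into N_{-rK1}(al), which is the one
     in B. *)
  by rewrite cst_potential// eN; field; rewrite ?mN0 ?nN0 ?nmN0 ?sg0 ?(gt_eqF r0).
have [-> ->] := pair1_top H SS ES (ltW bx).
by field; rewrite ?mN0 ?nN0 ?nmN0 ?sg0 ?(gt_eqF r0).
Qed.

Lemma w0_potential x : 0 < x -> potential m n kap M0' N0' x = w0 x.
Proof.
move=> x0; have [d0 dg gbe beal] := boundary_order SS ES.
have [_ _ eM eN] := SS.
have [cA cB c1 c2] := coefficients; rewrite /w0_fun cA cB RhE// /potential.
have [xa|ax] := ltP x al.
  have [_ -> ->] := pair0_low h M N (r * K1) (ltW xa).
  by field; rewrite ?mN0 ?nN0 ?nmN0 ?sg0 ?(gt_eqF r0).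
have [-> ->] := pair0_top M N (r * K1) ax.
(* [eM] exchanges M_{-rK1}(al) for M_{rK0}(be), so that above alpha the function w0 has the same
   coefficient A as w1. *)
rewrite (av_Mshift H 0 (- (r * K1)) x) (av_Nshift H 0 (- (r * K1)) x) !subr0 eM.
have := cst_potential (- (r * K1)) 0 x0; rewrite addr0 mulr0 mul0r addr0 => e.
have eK : - K1 = - (r * K1) / r by field; rewrite gt_eqF.
rewrite [X in _ = _ + X]eK -e.
by field; rewrite ?mN0 ?nN0 ?nmN0 ?sg0 ?(gt_eqF r0).
Qed.

Let F : set R := [set d] `|` [set g] `|` [set be] `|` [set al].

Let regular_neq x : regular_points h F x -> [/\ x != d, x != g, x != be & x != al].
Proof.
move=> [_ [nF _]].
by split; apply/eqP => e; apply: nF; rewrite e /F /=; tauto.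
Qed.

Let bounded1 (x : R) : 0 < x -> exists C, \forall y \near x, `|rate1 h (r * K) (r * K0) be d g y| <= C.
Proof.
move=> /(rates_bounded H (r * K) (r * K0) (r * K1) be al d g)[C HC].
by exists C; apply: filterS HC => y [].
Qed.

Let bounded0 (x : R) : 0 < x -> exists C, \forall y \near x, `|rate0 h (r * K1) al y| <= C.
Proof.
move=> /(rates_bounded H (r * K) (r * K0) (r * K1) be al d g)[C HC].
by exists C; apply: filterS HC => y [].
Qed.

Lemma w1_solves : [/\ C1_C2_off h F w1,
      forall x : R, 0 < x -> is_derive x 1 w1 (potential' m n kap M1' N1' x)
    & forall x, regular_points h F x ->
      sg ^+ 2 * x ^+ 2 * derive1 (derive1 w1) x + b * x * derive1 w1 x - r * w1 x
      = - rate1 h (r * K) (r * K0) be d g x].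
Proof.
apply: (potential_solves sg0 r0 m0 n0 _ bounded1 _ w1_potential).
- by move=> a c a0 ac; exact: (pair1 H PPh SS ES a0 ac).
- move=> x Sx; have [x0 [_ ch]] := Sx; have [? ? ? ?] := regular_neq Sx.
  by have [] := rates_continuous (r * K) (r * K0) (r * K1) x0 ch (be := be) (al := al) (d := d) (g := g).
Qed.

Lemma w0_solves : [/\ C1_C2_off h F w0,
      forall x : R, 0 < x -> is_derive x 1 w0 (potential' m n kap M0' N0' x)
    & forall x, regular_points h F x ->
      sg ^+ 2 * x ^+ 2 * derive1 (derive1 w0) x + b * x * derive1 w0 x - r * w0 x
      = - rate0 h (r * K1) al x].
Proof.
apply: (potential_solves sg0 r0 m0 n0 _ bounded0 _ w0_potential).
- by move=> a c a0 ac; exact: (pair0 H PPh SS ES a0 ac).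
- move=> x Sx; have [x0 [_ ch]] := Sx; have [? ? ? ?] := regular_neq Sx.
  by have [] := rates_continuous (r * K) (r * K0) (r * K1) x0 ch (be := be) (al := al) (d := d) (g := g).
Qed.

Let potential'E MM NN x : 0 < x -> potential' m n kap MM NN x = kap / x * flux m n MM NN x.
Proof.
move=> x0; have p1 p : x `^ (p - 1) = x `^ p / x.
  by rewrite powRD ?(gt_eqF x0) ?implybT// powRN powRr1// ltW.
by rewrite /potential' /flux !p1; field; rewrite ?nmN0 ?sg0 ?(gt_eqF x0).
Qed.

Lemma w1_increasing : increasing_pos w1.
Proof.
move=> x y x0 xy; have [_ D _] := w1_solves.
apply: (le_of_derive xy (v := potential' m n kap M1' N1')) => [z xz _|z xz _].
  by apply: D; lra.
have z0 : 0 < z by lra.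
rewrite potential'E//; apply: mulr_ge0; first by rewrite divr_ge0 ?ltW.
by have := flux1_ge0 H kk0 k01 SS ES z0.
Qed.

Lemma w0_increasing : increasing_pos w0.
Proof.
move=> x y x0 xy; have [_ D _] := w0_solves.
apply: (le_of_derive xy (v := potential' m n kap M0' N0')) => [z xz _|z xz _].
  by apply: D; lra.
have z0 : 0 < z by lra.
rewrite potential'E//; apply: mulr_ge0; first by rewrite divr_ge0 ?ltW.
by have := flux0_ge0 H k01 SS ES z0.
Qed.

(** The factor s is 1 or -1 in use, which covers the increasing and the decreasing stretch of w1 -
    w0. *)
Lemma gap_mono a c (s : R) : 0 < a -> a <= c ->
  (forall x, a < x -> x < c ->
     0 <= s * (flux m n M1' N1' x - flux m n M0' N0' x)) ->
  s * (w1 a - w0 a) <= s * (w1 c - w0 c).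
Proof.
move=> a0 ac Hs; have [_ D1 _] := w1_solves; have [_ D0 _] := w0_solves.
apply: (le_of_derive ac (u := fun x => s * (w1 x - w0 x))
  (v := fun x => s * (potential' m n kap M1' N1' x - potential' m n kap M0' N0' x))).
  move=> x ax _; have x0 : 0 < x by lra.
  have D := @is_deriveB _ _ _ _ _ _ _ _ _ (D1 x x0) (D0 x x0).
  exact: (@is_deriveZ _ _ _ _ s _ _ _ D).
move=> x ax xc; have x0 : 0 < x by lra.
rewrite !potential'E// -mulrBr mulrCA; apply: mulr_ge0; first by rewrite divr_ge0 ?ltW.
exact: Hs.
Qed.

Lemma gap_flat x : g <= x -> x <= be -> w1 x - w0 x = - K0.
Proof.
move=> gx xb; have [d0 dg gbe beal] := boundary_order SS ES.
rewrite /w1_fun /w0_fun (leNgt x d) (lt_le_trans dg gx) (ltNge x g) gx xb /=.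
by rewrite (le_lt_trans xb beal); ring.
Qed.

Lemma gap_top x : al <= x -> w1 x - w0 x = K1.
Proof.
move=> ax; have [d0 dg gbe beal] := boundary_order SS ES.
have bx := lt_le_trans beal ax; have gx := lt_trans gbe bx.
rewrite /w1_fun /w0_fun (leNgt x d) (lt_trans dg gx) (ltNge x g) (ltW gx) (leNgt x be) bx.
by rewrite (ltNge x al) ax /=; ring.
Qed.

Lemma w0_ge0 x : 0 < x -> 0 <= w0 x.
Proof.
move=> x0; have [d0 dg gbe beal] := boundary_order SS ES.
have y0 : 0 < Num.min x be by rewrite lt_min x0; lra.
have yx : Num.min x be <= x by rewrite ge_min lexx.
apply: le_trans (w0_increasing y0 yx).
rewrite /w0_fun (_ : Num.min x be < al); last by rewrite gt_min beal orbT.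
have [_ B0 _ _] := coefficients_gt0.
by rewrite mulr_ge0 ?powR_ge0// ltW.
Qed.

Lemma w1_ge x : 0 < x -> - K <= w1 x.
Proof.
move=> x0; have [d0 dg gbe beal] := boundary_order SS ES.
have y0 : 0 < Num.min x d by rewrite lt_min x0.
have yx : Num.min x d <= x by rewrite ge_min lexx.
by apply: le_trans (w1_increasing y0 yx); rewrite /w1_fun ge_min lexx orbT.
Qed.

(** The gap w1 - w0 is at most 0 on (0, d], decreases to -K0 at g, stays there up to be, increases
    to K1 at al and equals K1 from there on. *)
Lemma gap_bounds x : 0 < x -> - K0 <= w1 x - w0 x <= K1.
Proof.
move=> x0; have [d0 dg gbe beal] := boundary_order SS ES.
have K00 : 0 <= K0 by have := K_0; have := KK0; lra.
have K10 := K1_0; have Kp := K_0.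
have KK : - K0 <= K1 by lra.
have g0 : 0 < g by lra.
(* Here 0 <= K enters: w1 = -K <= 0 <= w0 on (0, d]. *)
have low y : 0 < y -> y <= d -> w1 y - w0 y <= 0.
  by move=> y0 yd; rewrite {1}/w1_fun yd; have := w0_ge0 y0; move: (w0 y) => v; lra.
have dec a c : 0 < a -> a <= c -> c <= g -> w1 c - w0 c <= w1 a - w0 a.
  move=> a0 ac cg; have := @gap_mono a c (-1) a0 ac.
  rewrite !mulN1r lerN2; apply => z az zc; rewrite mulN1r oppr_ge0 subr_le0.
  by apply: (flux_gap_low H k01 SS ES); lra.
have inc a c : be <= a -> a <= c -> c <= al -> w1 a - w0 a <= w1 c - w0 c.
  move=> ba ac ca; have a0 : 0 < a by lra.
  have := @gap_mono a c 1 a0 ac.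
  rewrite !mul1r; apply => z az zc; rewrite mul1r subr_ge0.
  by apply: (flux_gap_high H SS ES); lra.
have [xg|gx] := leP x g.
  have e1 := gap_flat (lexx g) (ltW gbe); have e2 := dec x g x0 xg (lexx g).
  have e3 : w1 x - w0 x <= 0.
    have [xd|dx] := leP x d; first exact: low.
    exact: le_trans (dec d x d0 (ltW dx) xg) (low d d0 (lexx d)).
  by apply/andP; split; [rewrite -e1|exact: le_trans e3 (ltW K10)].
have [xb|bx] := leP x be; first by rewrite gap_flat ?(ltW gx)// lexx.
have [xa|ax] := leP x al; last by rewrite gap_top ?(ltW ax)// lexx andbT.
have e1 := gap_flat (ltW gbe) (lexx be); have e2 := gap_top (lexx al).
have e3 := inc be x (lexx be) (ltW bx) xa; have e4 := inc x al (ltW bx) xa (lexx al).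
by apply/andP; split; [rewrite -e1|apply: le_trans e4 _; rewrite e2].
Qed.

Let max3 (x y z : R) : x <= 0 -> y <= 0 -> z <= 0 -> [\/ x = 0, y = 0 | z = 0] ->
  Num.max (Num.max x y) z = 0.
Proof.
move=> x0 y0 z0 e; apply/eqP; rewrite eq_le !ge_max x0 y0 z0 /= !le_max.
by case: e => ->; rewrite lexx ?orbT.
Qed.

Lemma free_boundary_HJB : HJB_solution b sg r h K K1 K0 w1 w0.
Proof.
have [C1 _ L1] := w1_solves; have [C0 _ L0] := w0_solves.
have [d0 dg gbe beal] := boundary_order SS ES.
exists F; split => //.
  by rewrite /F !finite_setU; split; first split; first split; exact: finite_set1.
move=> x Sx; have [x0 _] := Sx; have [xd xg xb xa] := regular_neq Sx.
have /andP[D1 D2] := gap_bounds x0; have W1 := w1_ge x0; have W0 := w0_ge0 x0.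
have Kp := K_0.
have neg y : 0 < y -> y <= be -> h y < - (r * K0).
  by move=> y0 yb; have := payoff_neg H k01 SS y0 yb; lra.
have kk := kk0.
have G1 : w0 x - w1 x - K0 <= 0 by move: D1; move: (w1 x) (w0 x) => u v; lra.
have G2 : w1 x - w0 x - K1 <= 0 by rewrite subr_le0.
have G3 : - w1 x - K <= 0 by move: W1; move: (w1 x) => u; lra.
have G4 : - w0 x - K <= 0 by move: W0; move: (w0 x) => u; lra.
split.
- have -> : sg ^+ 2 * x ^+ 2 * derive1 (derive1 w1) x + b * x * derive1 w1 x - r * w1 x + h x =
    h x - rate1 h (r * K) (r * K0) be d g x by rewrite (L1 x Sx) addrC.
  apply: (max3 _ G1 G3).
    rewrite /rate1; case: (leP x d) => [h1|h1].
      have xb' : x <= be by lra.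
      by have := neg x x0 xb'; lra.
    case: (leP x g) => [h2|h2]; first by rewrite subrr.
    case: (leP x be) => [h3|h3]; last by rewrite subrr.
    by have := neg x x0 h3; lra.
  rewrite /rate1; case: (leP x d) => [h1|h1].
    by apply: Or33; rewrite /w1_fun h1; ring.
  case: (leP x g) => [h2|h2]; first by apply: Or31; ring.
  case: (leP x be) => [h3|h3]; last by apply: Or31; ring.
  by apply: Or32; have := gap_flat (ltW h2) h3; move: (w1 x) (w0 x) => u v; lra.
- rewrite (L0 x Sx); apply: (max3 _ G2 G4).
    rewrite /rate0; case: (leP x al) => [h1|h1]; first by rewrite oppr0.
    by rewrite oppr_le0 subr_ge0 ltW//; exact: (payoff_pos H k01 SS ES (ltW h1)).
  rewrite /rate0; case: (leP x al) => [h1|h1]; first by apply: Or31; rewrite oppr0.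
  by apply: Or32; rewrite (gap_top (ltW h1)) subrr.
Qed.

End HJBAssembly.

(** * Translation of the data and conclusion *)

Section RegularPoints.
Context {R : realType}.
Local Notation mu := (@lebesgue_measure R).
Variable h : R -> R.
Hypothesis hh : payoff_regular h.

Lemma discontinuities_countable (a c : R) : 0 < a ->
  countable [set x | a < x < c /\ ~ {for x, continuous h}].
Proof.
move=> a0; have [hr hi _] := hh.
have hm : {in `[a, c] &, {homo h : x y / x <= y}}.
  by move=> x y; rewrite in_itv/= => /andP[ax _] _; apply: hi; exact: lt_le_trans ax.
apply: sub_countable (discontinuity_countable hm); apply: subset_card_le.
move=> x [xac nc]; split; first by rewrite in_itv.
have /andP[ax xc] := xac; have x0 : 0 < x by exact: lt_trans ax.
have hl : cvg (h y @[y --> x^'-]).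
  apply: (@nondecreasing_at_left_is_cvgr _ h x).
  - near=> z => u v; rewrite !in_itv/= => /andP[zu ux] _ uv; apply: hi uv.
    by apply: lt_trans zu; near: z; exact: nbhs_left_gt.
  - near=> z; exists (h x) => _ /= [u + <-]; rewrite in_itv/= => /andP[zu ux].
    apply: hi; last exact: ltW.
    by apply: lt_trans zu; near: z; exact: nbhs_left_gt.
have hc : cvg (h y @[y --> x^'+]) by apply/cvg_ex; exists (h x); exact: hr.
(* By right-continuity the right limit is h x, so equality of the one-sided limits would give
   continuity at x. *)
split=> //; apply/eqP => e; apply: nc.
have el : lim (h y @[y --> x^'+]) = h x by apply: cvg_lim => //; exact: hr.
apply/left_right_continuousP; split; last exact: hr.
by rewrite -[X in _ --> X]el -e.
Unshelve. all: by end_near. Qed.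

(** The equations hold only off F and off the jumps of h. These exceptions are countable on (e/2,
    e), hence null, and cannot fill the interval. *)
Lemma regular_point_near0 (F : set R) (e : R) : finite_set F -> 0 < e ->
  exists x, regular_points h F x /\ x < e.
Proof.
move=> finF e0; apply: contrapT => none.
have e2 : 0 < e / 2 by lra.
pose D := [set x | e / 2 < x < e /\ ~ {for x, continuous h}].
have sub : `](e / 2), e[%classic `<=` D `|` F.
  move=> x /= xe; have := xe; rewrite in_itv/= => /andP[x1 x2].
  have [Fx|nF] := pselect (F x); first by right.
  left; split; first by rewrite x1.
  move=> cx; apply: none; exists x; split => //; split; [lra|by []].
have cDF : countable (D `|` F).
  have -> : D `|` F = \bigcup_(i in [set: bool]) (if i then D else F).
    apply/seteqP; split=> x; first by case=> ?; [exists true|exists false].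
    by case=> -[] _ ?; [left|right].
  apply: bigcup_countable => // -[] _; first exact: discontinuities_countable.
  exact: finite_set_countable.
have := countable_lebesgue_measure0 (sub_countable (subset_card_le sub) cDF).
rewrite lebesgue_measure_itv/= lte_fin ifT; last by lra.
by rewrite -EFinB => /eqP; rewrite eqe => /eqP; lra.
Qed.

(** As an infimum, possibly -oo, h(0) can be compared with a real number through a single point of
    (0, oo). *)
Lemma h_at0_inf : h_at0 h = ereal_inf [set (h x)%:E | x in [set x | 0 < x]].
Proof.
have [_ hi _] := hh.
have -> : [set x : R | 0 < x] = [set` Interval (BRight 0) +oo%O].
  by apply/seteqP; split => x /=; rewrite in_itv/= andbT.
apply/cvg_lim => //; apply: (nondecreasing_at_right_cvge (f := EFin \o h)) => //.
move=> x y; rewrite !in_itv/= !andbT => x0 _ xy.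
by rewrite /= lee_fin; exact: hi.
Qed.

Lemma h_at0_le x : 0 < x -> (h_at0 h <= (h x)%:E)%E.
Proof. by move=> x0; rewrite h_at0_inf; apply: ereal_inf_lbound; exists x. Qed.

Lemma h_at0_ltP q : (h_at0 h < q%:E)%E <-> exists2 x, 0 < x & h x < q.
Proof.
split=> [|[x x0 hx]]; last by apply: le_lt_trans (h_at0_le x0) _; rewrite lte_fin.
rewrite h_at0_inf => /ereal_inf_lt [_ [x /= x0 <-]]; rewrite lte_fin => hx.
by exists x.
Qed.

End RegularPoints.

(** * From the stated system to the functions M and N *)

Section Translation.
Context {R : realType}.
Variables b sg r : R.
Local Notation m := (root_m b sg r).
Local Notation n := (root_n b sg r).
Variables (h : R -> R) (M N : R -> R -> R).
Hypothesis H : averages m n h M N.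
Hypothesis wintM : forall q a c, 0 < a -> a <= c -> m * wint m h q a c = M q a - M q c.
Hypothesis wintN : forall q a c, 0 < a -> a <= c -> n * wint n h q a c = N q a - N q c.
Hypothesis wintoo : forall q a, 0 < a -> n * wint_oo n h q a = N q a.
Variables K K1 K0 : R.

Lemma system_sol d g be al : ordered d g be al ->
  free_boundary_system b sg r h K K1 K0 d g be al <->
  switch_sol M N (r * K0) (r * K1) be al /\ entry_sol M N (r * K) (r * K0) be d g.
Proof.
move=> [d0 dg gb ba]; have be0 : 0 < be by lra.
have sM p q x := av_Mshift H p q x; have sN p q x := av_Nshift H p q x.
rewrite /free_boundary_system !wintM ?wintN ?wintoo ?(ltW ba) ?(ltW dg)//.
have e1 := sM 0 (r * K0) be; have e2 := sM 0 (- (r * K1)) al.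
have e3 := sN 0 (r * K0) be; have e4 := sN 0 (- (r * K1)) al.
have e5 := sM (r * K0) (r * K) d; have e6 := sN (r * K0) (r * K) d.
split=> [[s1 s2 s3 s4]|[[_ _ s1 s2] [_ _ _ s3 s4]]].
  by do 2 split=> //; lra.
by split; lra.
Qed.

Lemma dagger_solP p : is_dagger b sg r h K K1 p <->
  dagger_sol M N (r * K) (r * K1) p.1 p.2.
Proof.
have n0 : n != 0 by rewrite gt_eqF// (av_n0 H).
split=> [[p0 pp e1 e2]|[p0 pp e1 e2]].
  split => //; first by rewrite -wintoo// e1 mulr0.
  by move: e2; rewrite wintM ?(ltW pp)// (av_Mshift H (- (r * K1)) (r * K) p.1); lra.
split => //.
  by apply: (mulfI n0); rewrite wintoo// e1 mulr0.
by rewrite wintM ?(ltW pp)// -e2 (av_Mshift H (- (r * K1)) (r * K) p.1); ring.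
Qed.

Lemma xhat_eqP p x : 0 < p.1 -> is_xhat b sg r h K1 p x <->
  [/\ p.1 < x, x < p.2 & hat_eq m n M N (r * K1) x p.2 = 0].
Proof.
move=> p0; have key : p.1 < x -> x < p.2 ->
    m * x `^ m * wint m h (- (r * K1)) x p.2 - n * x `^ n * wint n h (- (r * K1)) x p.2 =
    hat_eq m n M N (r * K1) x p.2.
  move=> px xp; have x0 : 0 < x by exact: lt_trans px.
  rewrite /hat_eq -!wintM ?(ltW xp)// -!wintN ?(ltW xp)//; ring.
by split=> [[px xp e]|[px xp e]]; split => //; rewrite -e ?key.
Qed.

Lemma K0_starE : r != 0 -> 0 < xhat b sg r h K K1 -> xhat b sg r h K K1 < (dagger b sg r h K K1).2 ->
  r * K0_star b sg r h K K1 =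
  hat_level m M (r * K1) (xhat b sg r h K K1) (dagger b sg r h K K1).2.
Proof.
move=> r0 x0 xp; rewrite /hat_level -wintM ?(ltW xp)// /K0_star; field.
exact: r0.
Qed.

End Translation.

Lemma averages_payoff (R : realType) (m n : R) (h : R -> R) :
  m < 0 -> 0 < n -> payoff_regular h ->
  (forall x q, 0 < x -> (@lebesgue_measure R).-integrable `[x, +oo[
     (EFin \o (fun s => s `^ (- n - 1) * (h s + q)))) ->
  (forall x q, 0 < x -> (@lebesgue_measure R).-integrable `]0, x]
     (EFin \o (fun s => s `^ (- m - 1) * (h s + q)))) ->
  averages m n h (Mq m h) (Nq n h).
Proof.
move=> m0 n0 hh hoo hz; constructor => //.
- exact: (payoff_incr hh).
- exact: (payoff_unbounded hh).
- exact: Mq_shift.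
- exact: Nq_shift.
- exact: (Mq_le m0 n0 hh hoo hz).
- exact: (Nq_ge m0 n0 hh hoo hz).
- exact: (Mq_small m0 n0 hoo hz).
- exact: (Mq_Nq_up m0 n0 hh hoo hz).
- exact: (Mq_Nq_down m0 n0 hh hoo hz).
- exact: (Mq_Nq_up_strict m0 n0 hh hoo hz).
- exact: (Mq_Nq_down_strict m0 n0 hh hoo hz).
- exact: (Mq_unbounded m0 n0 hh hoo hz).
- exact: (Nq_neg_near0 m0 n0 hh hoo hz).
- exact: (Mq_Nq_continuous m0 n0 hh hoo hz).
Qed.

Lemma root_signs (R : realType) (b sg r : R) : sg != 0 -> 0 < r ->
  root_m b sg r < 0 /\ 0 < root_n b sg r.
Proof.
move=> sg0 r0; have s2 : 0 < sg ^+ 2 by rewrite lt_neqAle eq_sym expf_neq0//= sqr_ge0.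
have d2 : 0 < (2 * sg ^+ 2)^-1 by rewrite invr_gt0 mulr_gt0.
have : `|b - sg ^+ 2| < Num.sqrt ((b - sg ^+ 2) ^+ 2 + 4 * sg ^+ 2 * r).
  have c0 : 0 < 4 * sg ^+ 2 * r by apply: mulr_gt0 => //; exact: mulr_gt0.
  have q0 : 0 < (b - sg ^+ 2) ^+ 2 + 4 * sg ^+ 2 * r by apply: ltr_wpDl => //; exact: sqr_ge0.
  by rewrite -sqrtr_sqr ltr_sqrt// ltrDl.
rewrite ltr_norml /root_m /root_n => /andP[h1 h2].
by split; [rewrite pmulr_llt0//; lra|rewrite pmulr_lgt0//; lra].
Qed.

(** * Existence, uniqueness and necessity for the given data *)

Section Assembly.
Context {R : realType}.
Variables b sg r : R.
Hypotheses (sg0 : sg != 0) (r0 : 0 < r).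
Local Notation m := (root_m b sg r).
Local Notation n := (root_n b sg r).
Variable h : R -> R.
Hypothesis hh : payoff_regular h.
Hypothesis hoo : forall x q, 0 < x -> (@lebesgue_measure R).-integrable `[x, +oo[
     (EFin \o (fun s => s `^ (- n - 1) * (h s + q))).
Hypothesis hz : forall x q, 0 < x -> (@lebesgue_measure R).-integrable `]0, x]
     (EFin \o (fun s => s `^ (- m - 1) * (h s + q))).
Variables K K1 : R.
Hypothesis K1_0 : 0 < K1.
Local Notation M := (Mq m h).
Local Notation N := (Nq n h).

Let m0 : m < 0. Proof. by have [] := root_signs b sg0 r0. Qed.
Let n0 : 0 < n. Proof. by have [] := root_signs b sg0 r0. Qed.
Let H : averages m n h M N. Proof. exact: averages_payoff. Qed.
Let wM := wint_mE m0 n0 hh hoo hz.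
Let wN := wint_nE m0 n0 hh hoo hz.
Let wM0 := wint_m0E m0 n0 hoo hz.
Let woo := wint_n_ooE m0 n0 hoo hz.

Let PPh a c : 0 < a -> a <= c -> primitive_pair m n h (M 0) (N 0) a c.
Proof.
move=> a0 ac; have := Mq_Nq_primitive_pair m0 n0 hh hoo hz 0 a0 ac.
by under eq_fun do rewrite addr0.
Qed.

Lemma h_at0_neg q : (h_at0 h < (- (r * q))%:E)%E <-> exists2 x, 0 < x & h x + r * q < 0.
Proof.
rewrite (h_at0_ltP hh); split=> -[x x0 hx]; exists x => //; lra.
Qed.

Lemma dagger_xhat : 0 <= K -> (h_at0 h < (- (r * K))%:E)%E ->
  [/\ exists! p, is_dagger b sg r h K K1 p,
      exists! x, is_xhat b sg r h K1 (dagger b sg r h K K1) x,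
      is_dagger b sg r h K K1 (dagger b sg r h K K1)
    & is_xhat b sg r h K1 (dagger b sg r h K K1) (xhat b sg r h K K1)].
Proof.
move=> K_0 /h_at0_neg h0.
have kk : 0 < r * K + r * K1 by rewrite -mulrDr mulr_gt0//; have := K1_0; lra.
have dP := dagger_solP H wM woo K K1.
have [d [a S]] := dagger_sol_exists H kk h0.
have uniq p : is_dagger b sg r h K K1 p -> (d, a) = p.
  move=> /dP S'; have [e1 e2] := dagger_sol_unique H kk S S'.
  by move: e1 e2; case: p {S'} => p1 p2 /= -> ->.
have Sda : is_dagger b sg r h K K1 (d, a) by apply/dP.
have eD : dagger b sg r h K K1 = (d, a).
  by apply/esym/uniq; apply: (@xgetPex _ (0, 0) [set p | is_dagger b sg r h K K1 p]); exists (d, a).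
have [d0 da _ _] := S.
have xP z : is_xhat b sg r h K1 (d, a) z <->
    [/\ d < z, z < a & hat_eq m n M N (r * K1) z a = 0].
  exact: (@xhat_eqP _ _ _ _ _ _ _ wM wN K1 (d, a) z d0).
have [x [dx xa xE]] := hat_exists H kk S.
have Sx : is_xhat b sg r h K1 (d, a) x by apply/xP.
have uniqx y : is_xhat b sg r h K1 (d, a) y -> x = y.
  by move=> /xP[dy ya yE]; exact: (hat_unique H kk S dy ya yE dx xa xE).
split.
- by exists (d, a); split.
- by rewrite eD; exists x; split.
- by rewrite eD.
- have := @xgetPex _ 0 [set x | is_xhat b sg r h K1 (dagger b sg r h K K1) x].
  by apply; exists x; rewrite eD.
Qed.

Lemma K0_star_bounds : 0 <= K -> (h_at0 h < (- (r * K))%:E)%E ->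
  K < K0_star b sg r h K K1 /\
  ((K0_star b sg r h K K1)%:E < (- r^-1)%:E * h_at0 h)%E.
Proof.
move=> K_0 h0; have [_ _ D X] := dagger_xhat K_0 h0.
have kk : 0 < r * K + r * K1 by rewrite -mulrDr mulr_gt0//; have := K1_0; lra.
have /(dagger_solP H wM woo) S := D; have [d0 da _ _] := S.
have /(@xhat_eqP _ _ _ _ _ _ _ wM wN K1 _ _ d0)[dx xa xE] := X.
have x0 := lt_trans d0 dx.
have [l1 l2] := hat_level_gt H kk S dx xa xE.
rewrite -(K0_starE wM (lt0r_neq0 r0) x0 xa) in l1 l2.
split; first by rewrite -(ltr_pM2l r0).
set Ks := K0_star b sg r h K K1 in l1 l2 *.
have hx := h_at0_le hh x0.
(* For h(0) = -oo the right-hand side is +oo; h(0) = +oo is excluded by h(0) <= h xhat. *)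
move: hx; case: (h_at0 h) => [v| |]; last 2 first.
- by rewrite leye_eq.
- by move=> _; rewrite lt0_muleNy ?ltry// lte_fin oppr_lt0 invr_gt0.
rewrite lee_fin => hv; rewrite -EFinM lte_fin.
by rewrite mulNr mulrC -mulNr ltr_pdivlMr// mulrC; lra.
Qed.

Variable K0 : R.
Hypothesis K0_0 : 0 < K0.

Let k01 : 0 < r * K0 + r * K1.
Proof. by have k1 := K1_0; have k0 := K0_0; rewrite -mulrDr mulr_gt0//; lra. Qed.

Lemma entry_sol_K0_star be al : 0 <= K -> K < K0 -> (h_at0 h < (- (r * K))%:E)%E ->
  switch_sol M N (r * K0) (r * K1) be al ->
  (exists d g, entry_sol M N (r * K) (r * K0) be d g) <-> K0 < K0_star b sg r h K K1.
Proof.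
move=> K_0 KK0 h0 SS; have [_ _ D X] := dagger_xhat K_0 h0.
have kk : 0 < r * K + r * K1 by rewrite -mulrDr mulr_gt0//; have := K1_0; lra.
have kk0 : r * K < r * K0 by rewrite ltr_pM2l.
have /(dagger_solP H wM woo) S := D; have [d0 da _ _] := S.
have /(@xhat_eqP _ _ _ _ _ _ _ wM wN K1 _ _ d0)[dx xa xE] := X.
have x0 := lt_trans d0 dx.
rewrite (entry_criterion H kk kk0 S dx xa xE SS) -(K0_starE wM (lt0r_neq0 r0) x0 xa).
by rewrite ltr_pM2l.
Qed.

Let max3_le (x y z : R) : Num.max (Num.max x y) z = 0 -> y <= 0 /\ z <= 0.
Proof. by move=> e; rewrite -e !le_max !lexx !orbT. Qed.

(** Near 0 the functions are w1 = -K and w0 = B x^n. The constraint w0 - w1 <= K0 reads B x^n + K <=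
    K0, hence K < K0; the constraint -w0 <= K reads -B x^n <= K, hence 0 <= K as x tends to 0. The
    other two conditions come from the signs at beta and from the criterion for (delta, gamma). *)
Lemma necessary_conditions d g be al : ordered d g be al ->
  free_boundary_system b sg r h K K1 K0 d g be al ->
  0 < B_coef b sg r h K1 al ->
  HJB_solution b sg r h K K1 K0 (w1_fun b sg r h K K1 K0 d g be al) (w0_fun b sg r h K1 K0 be al) ->
  [/\ 0 <= K, (h_at0 h < (- (r * K0))%:E)%E, K < K0 & K0 < K0_star b sg r h K K1].
Proof.
move=> O S B0 [F [finF _ _ Q]]; have [d0 dg gbe beal] := O.
have [SS ES] := (system_sol H wM wN woo K K1 K0 O).1 S.
have near0 e : 0 < e -> exists x, [/\ 0 < x, x < e, - (B_coef b sg r h K1 al * x `^ n) - K <= 0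
    & B_coef b sg r h K1 al * x `^ n - - K - K0 <= 0].
  move=> e0; have de : 0 < Num.min d e by rewrite lt_min d0.
  have [x [Sx]] := regular_point_near0 hh finF de; rewrite lt_min => /andP[xd xe].
  have [x0 _] := Sx; have [/max3_le[q1 _] /max3_le[_ q2]] := Q x Sx.
  exists x; move: q1 q2; rewrite /w1_fun /w0_fun (ltW xd).
  by rewrite (lt_trans xd (lt_trans dg (lt_trans gbe beal))).
have KK0 : K < K0.
  have [x [x0 _ _]] := near0 d d0; have : 0 < B_coef b sg r h K1 al * x `^ n.
    by rewrite mulr_gt0 ?powR_gt0.
  lra.
have K_0 : 0 <= K.
  rewrite leNgt; apply/negP => Kneg.
  (* A regular point below the n-th root of -K / B has B x^n < -K, against the constraint. *)
  have q0 : 0 < - K / B_coef b sg r h K1 al by rewrite divr_gt0// oppr_gt0.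
  have [x [x0 xe xB _]] := near0 _ (powR_gt0 n^-1 q0).
  have : x `^ n < (- K / B_coef b sg r h K1 al) `^ n^-1 `^ n.
    have n1 := n0; apply: gt0_ltr_powR => //; rewrite nnegrE; first exact: ltW.
    exact: powR_ge0.
  rewrite -powRrM mulVf ?(gt_eqF n0)// powRr1 ?(ltW q0)// ltr_pdivlMr// mulrC.
  lra.
have [hb _] := switch_sol_signs H SS k01.
have h0 : (h_at0 h < (- (r * K0))%:E)%E.
  by apply/h_at0_neg; exists be => //; exact: lt_trans (lt_trans d0 dg) gbe.
have h0' : (h_at0 h < (- (r * K))%:E)%E.
  by apply: (lt_trans h0); rewrite lte_fin ltrN2 ltr_pM2l.
by split=> //; apply/(entry_sol_K0_star K_0 KK0 h0' SS); exists d, g.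
Qed.

Lemma free_boundaries_exist : 0 <= K -> (h_at0 h < (- (r * K0))%:E)%E -> K < K0 ->
  K0 < K0_star b sg r h K K1 ->
  exists d g be al, [/\ ordered d g be al,
    switch_sol M N (r * K0) (r * K1) be al, entry_sol M N (r * K) (r * K0) be d g
    & forall d' g' be' al', ordered d' g' be' al' ->
        free_boundary_system b sg r h K K1 K0 d' g' be' al' ->
        [/\ d' = d, g' = g, be' = be & al' = al]].
Proof.
move=> K_0 h0 KK0 Kst; have kk0 : r * K < r * K0 by rewrite ltr_pM2l.
have h0' : (h_at0 h < (- (r * K))%:E)%E.
  by apply: (lt_trans h0); rewrite lte_fin ltrN2.
have [be [al SS]] := switch_sol_exists H k01 ((h_at0_neg K0).1 h0).
have [d [g ES]] := (entry_sol_K0_star K_0 KK0 h0' SS).2 Kst.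
have [hb _] := switch_sol_signs H SS k01.
have [d0 dg gb _ _] := ES; have [_ ba _ _] := SS.
exists d, g, be, al; split => // d' g' be' al' O' S'.
have [SS' ES'] := (system_sol H wM wN woo K K1 K0 O').1 S'.
have [eb ea] := switch_sol_unique H SS SS' k01; rewrite eb in ES'.
by have [ed eg] := entry_sol_unique H kk0 hb ES ES'.
Qed.

Lemma free_boundary_solvability :
  (exists delta gamma beta alpha : R,
      [/\ ordered delta gamma beta alpha,
          free_boundary_system b sg r h K K1 K0 delta gamma beta alpha,
          forall delta' gamma' beta' alpha' : R,
            ordered delta' gamma' beta' alpha' ->
            free_boundary_system b sg r h K K1 K0 delta' gamma' beta' alpha' ->
            [/\ delta' = delta, gamma' = gamma, beta' = beta & alpha' = alpha],
          [/\ 0 < A_coef b sg r h K0 beta,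
              0 < B_coef b sg r h K1 alpha,
              0 < Gamma1_coef b sg r h K0 gamma
            & 0 < Gamma2_coef b sg r h K0 gamma beta]
        & let w1 := w1_fun b sg r h K K1 K0 delta gamma beta alpha in
          let w0 := w0_fun b sg r h K1 K0 beta alpha in
          [/\ increasing_pos w1, increasing_pos w0
            & HJB_solution b sg r h K K1 K0 w1 w0]])
   <->
   [/\ 0 <= K, (h_at0 h < (- (r * K0))%:E)%E, K < K0
     & K0 < K0_star b sg r h K K1].
Proof.
split=> [[d [g [be [al [or S _ [_ B0 _ _] [_ _ J]]]]]]|[K_0 h0 KK0 Kst]].
  exact: (necessary_conditions or S B0 J).
have [d [g [be [al [or SS ES U]]]]] := free_boundaries_exist K_0 h0 KK0 Kst.
exists d, g, be, al; split => //.
- exact: (system_sol H wM wN woo K K1 K0 or).2 (conj SS ES).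
- exact: (coefficients_gt0 sg0 r0 H wM0 woo wN K_0 KK0 K1_0 SS ES).
- split.
  + exact: (w1_increasing sg0 r0 H PPh wM0 woo wN K_0 KK0 K1_0 SS ES).
  + exact: (w0_increasing sg0 r0 H PPh wM0 woo wN K_0 KK0 K1_0 SS ES).
  + exact: (free_boundary_HJB sg0 r0 H PPh wM0 woo wN K_0 KK0 K1_0 SS ES).
Qed.

End Assembly.

Unset Implicit Arguments.
Set Strict Implicit.

(** The first conjunct gives [K0_star] its meaning: the points entering its definition exist and are
    unique under 0 <= K and h(0) < -r K, and these follow from the right-hand side of the
    equivalence because K < K0. *)
Theorem lemma6 (R : realType) (d : measure_display) (T : measurableType d)
    (P : probability T R) (W : R -> T -> R) (hW : brownian_motion P W)
    (b sg r : R) (hsg : sg != 0) (hr : 0 < r)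
    (h : R -> R) (hh : payoff_regular h)
    (hint : payoff_integrable P b sg r h W)
    (K1 K0 K : R) (hK1 : 0 < K1) (hK0 : 0 < K0) :
  (0 <= K -> (h_at0 h < (- (r * K))%:E)%E ->
    [/\ exists! p : R * R, is_dagger b sg r h K K1 p,
        exists! x : R, is_xhat b sg r h K1 (dagger b sg r h K K1) x,
        K < K0_star b sg r h K K1
      & ((K0_star b sg r h K K1)%:E < (- r^-1)%:E * h_at0 h)%E])
  /\
  ((exists delta gamma beta alpha : R,
      [/\ ordered delta gamma beta alpha,
          free_boundary_system b sg r h K K1 K0 delta gamma beta alpha,
          forall delta' gamma' beta' alpha' : R,
            ordered delta' gamma' beta' alpha' ->
            free_boundary_system b sg r h K K1 K0 delta' gamma' beta' alpha' ->
            [/\ delta' = delta, gamma' = gamma, beta' = beta & alpha' = alpha],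
          [/\ 0 < A_coef b sg r h K0 beta,
              0 < B_coef b sg r h K1 alpha,
              0 < Gamma1_coef b sg r h K0 gamma
            & 0 < Gamma2_coef b sg r h K0 gamma beta]
        & let w1 := w1_fun b sg r h K K1 K0 delta gamma beta alpha in
          let w0 := w0_fun b sg r h K1 K0 beta alpha in
          [/\ increasing_pos w1, increasing_pos w0
            & HJB_solution b sg r h K K1 K0 w1 w0]])
   <->
   [/\ 0 <= K, (h_at0 h < (- (r * K0))%:E)%E, K < K0
     & K0 < K0_star b sg r h K K1]).
Proof.
have pw := payoff_weights hW hsg hr (let: And3 _ hi _ := hh in hi) hint.
have hoo x q (x0 : 0 < x) := (pw x q x0).1.
have hz x q (x0 : 0 < x) := (pw x q x0).2.
split=> [K_0 h0|]; last exact: free_boundary_solvability.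
have [D X _ _] := dagger_xhat hsg hr hh hoo hz hK1 K_0 h0.
by have [? ?] := K0_star_bounds hsg hr hh hoo hz hK1 K_0 h0.
Qed.
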